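(* Let $A\in K(H)^+$. Then: (i) $E(\mathscr U(A))\subset E(\mathscr V(A))\cap\{B\in\mathscr D\mid\operatorname{Tr}(R_B^\perp)\le\operatorname{Tr}(R_A^\perp)\}$. (ii) If $R_A=I$, then $$E(\mathscr U(A))=E(\mathscr V(A))\cap\{B\in\mathscr D\mid R_B=I\}=\begin{cases}\{B\in\mathscr D\cap K(H)^+\mid s(B)\prec s(A),\ R_B=I\}\setminus\mathscr L_1 & \text{if }\operatorname{Tr}(A)=\infty,\\ \{B\in\mathscr D\cap K(H)^+\mid s(B)\preccurlyeq s(A),\ R_B=I\} & \text{if }\operatorname{Tr}(A)<\infty.\end{cases}$$ (iii) The inclusion in (i) is proper unless $R_A=I$ or $A$ has finite rank.
   Context: $H$ is a complex separable infinite-dimensional Hilbert space with a fixed orthonormal basis $\{e_k\}_{k\in\mathbb N}$; $B(H)$ is the algebra of bounded operators, $K(H)$ the ideal of compact operators, $K(H)^+$ its positive elements, $\mathscr L_1$ the trace class, $\operatorname{Tr}$ the usual trace (with values in $[0,\infty]$ on positive operators). $\mathscr D$ is the algebra of operators that are diagonal with respect to $\{e_k\}$, and $E:B(H)\to\mathscr D$ sends an operator to its main diagonal (the normal faithful trace-preserving conditional expectation). $R_A$ denotes the range projection of $A$ and $R_A^\perp=I-R_A$. The unitary orbit of $A$ is $\mathscr U(A):=\{UAU^*\mid U\in B(H)\text{ unitary}\}$ and the partial isometry orbit of $A$ is $\mathscr V(A):=\{VAV^*\mid V\in B(H)\text{ a partial isometry},\ V^*V=R_A\vee R_{A^*}\}$;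 $E(\mathscr U(A))$, $E(\mathscr V(A))$ are their images under $E$. For compact $A$, $s(A)$ is the nonincreasing sequence of singular numbers of $A$, repeated according to multiplicity, with infinitely many zeros added if $A$ has finite rank. $\mathrm{c}_{\mathrm{o}}^*$ is the cone of nonnegative nonincreasing sequences converging to $0$; for $\xi,\eta\in \mathrm{c}_{\mathrm{o}}^*$, $\xi\prec\eta$ means $\sum_{j=1}^n\xi_j\le\sum_{j=1}^n\eta_j$ for every $n$, and $\xi\preccurlyeq\eta$ means $\xi\prec\eta$ and $\liminf_n\sum_{j=1}^n(\eta_j-\xi_j)=0$. *)

(* Defs.v *)
From HB Require Import structures.
From mathcomp Require Import all_boot all_order all_algebra.
From mathcomp Require Import sesquilinear complex.
From mathcomp Require Import all_classical all_reals all_analysis.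

Set Implicit Arguments.
Unset Strict Implicit.
Unset Printing Implicit Defensive.

Import Order.TTheory GRing.Theory Num.Theory.
Import numFieldNormedType.Exports.

Local Open Scope classical_set_scope.
Local Open Scope ring_scope.

(* A complex Hilbert space is a complete normed module [H] over [R[i]] whose
   norm comes from an inner product [ip : {dot H for Num.conj}]
   ([hilbert_norm ip]). Inner products are linear in the first argument.
   Operators are plain functions [H -> H], so that equality of operators is
   Leibniz equality; membership in B(H) is [bounded_op]. *)

Section Hilbert.
Context {R : realType} {H : completeNormedModType R[i]}.
Variable ip : {dot H for (@Num.conj R[i])}.

Definition hilbert_norm := forall x : H, `|x| ^+ 2 = ip x x.

(* A sequence indexed by [nat] in which every vector has a convergent
   expansion: this also makes [H] separable and infinite dimensional. *)
Definition orthonormal_basis (e : nat -> H) :=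
  (forall j k, ip (e j) (e k) = (j == k)%:R) /\
  (forall x, (fun n => \sum_(k < n) ip x (e k) *: e k) @ \oo --> x).

Definition bounded_op (T : H -> H) := linear T /\ continuous T.

Definition compact_op (T : H -> H) :=
  bounded_op T /\ precompact (T @` [set x | `|x| <= 1]).

(* In the partial order of [R[i]], [0 <= z] says that [z] is real and
   nonnegative. *)
Definition positive_op (T : H -> H) :=
  bounded_op T /\ forall x, 0 <= ip (T x) x.

(* K(H)^+ *)
Definition compact_positive (T : H -> H) := compact_op T /\ positive_op T.

(* For bounded [T] the vector selected here exists by the Riesz representation
   theorem, and it is unique. *)
Definition adjoint (T : H -> H) (y : H) : H :=
  xget 0 [set z | forall x, ip (T x) y = ip x z].

(* The nearest-point projection onto [M]; meaningful for closed subspaces. *)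
Definition orthproj (M : set H) (x : H) : H :=
  xget 0 [set y | M y /\ forall z, M z -> ip (x - y) z = 0].

(* R_A and R_A^\perp *)
Definition range_proj (T : H -> H) : H -> H := orthproj (closure (range T)).

Definition range_proj_perp (T : H -> H) (x : H) : H := x - range_proj T x.

(* P \/ Q in the lattice of projections: the projection onto the closed linear
   span of the two ranges. *)
Definition proj_join (P Q : H -> H) : H -> H :=
  orthproj (closure [set x + y | x in range P & y in range Q]).

Definition unitary_op (U : H -> H) :=
  [/\ bounded_op U, U \o adjoint U = id & adjoint U \o U = id].

Definition partial_isometry (V : H -> H) :=
  bounded_op V /\
  forall x, (forall y, V y = 0 -> ip x y = 0) -> `|V x| = `|x|.

Definition unitary_orbit (A : H -> H) : set (H -> H) :=
  [set U \o A \o adjoint U | U in [set U | unitary_op U]].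

Definition partial_isometry_orbit (A : H -> H) : set (H -> H) :=
  [set V \o A \o adjoint V | V in [set V | partial_isometry V /\
     adjoint V \o V = proj_join (range_proj A) (range_proj (adjoint A))]].

Definition has_dim (W : set H) (n : nat) :=
  exists v : 'I_n -> H,
    (forall c : 'I_n -> R[i], \sum_i c i *: v i = 0 -> forall i, c i = 0) /\
    W = [set x | exists c : 'I_n -> R[i], x = \sum_i c i *: v i].

Definition finite_rank (T : H -> H) := exists n, has_dim (range T) n.

(* A positive operator has exactly one positive square root;
   |T| = (T^* T)^(1/2). *)
Definition op_sqrt (P : H -> H) : H -> H :=
  xget (fun=> 0) [set S | positive_op S /\ S \o S = P].

Definition op_abs (T : H -> H) : H -> H := op_sqrt (adjoint T \o T).

Definition eigenspace_op (T : H -> H) (l : R) : set H :=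
  [set x | T x = (l%:C)%C *: x].

(* The cone c_o^*. *)
Definition c0star (s : R^nat) :=
  [/\ forall n, 0 <= s n, nonincreasing_seq s & s @ \oo --> (0 : R)].

(* The nonincreasing sequence of the eigenvalues of |T| repeated according to
   multiplicity. Only the multiplicity of nonzero values is prescribed: zeros
   then occur, infinitely often, exactly when [T] has finite rank. *)
Definition is_singular_numbers (T : H -> H) (s : R^nat) :=
  c0star s /\
  forall l : R, 0 < l -> exists n : nat,
    ([set k | s k = l] #= `I_n)%card /\ has_dim (eigenspace_op (op_abs T) l) n.

Definition singular_numbers (T : H -> H) : R^nat :=
  xget (fun=> 0) [set s | is_singular_numbers T s].

Section Basis.
Variable e : nat -> H.

Definition diagonal_op (T : H -> H) :=
  bounded_op T /\ forall j k, j != k -> ip (T (e j)) (e k) = 0.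

(* E(T) = \sum_k <T e_k, e_k> <., e_k> e_k, the series converging pointwise. *)
Definition diag_expectation (T : H -> H) (x : H) : H :=
  lim ((fun n => \sum_(k < n) (ip (T (e k)) (e k) * ip x (e k)) *: e k) @ \oo).

(* Meaningful for positive [T], whose diagonal entries are real and
   nonnegative. *)
Definition Tr (T : H -> H) : \bar R :=
  (\sum_(0 <= k <oo) (complex.Re (ip (T (e k)) (e k)))%:E)%E.

Definition trace_class (T : H -> H) :=
  bounded_op T /\ (Tr (op_abs T) < +oo)%E.

End Basis.
End Hilbert.

(* [majorized xi eta] is xi \prec eta; [strongly_majorized xi eta] is
   xi \preccurlyeq eta, with the liminf taken in the extended reals. *)
Definition majorized {R : realType} (xi eta : R^nat) :=
  forall n, \sum_(0 <= j < n) xi j <= \sum_(0 <= j < n) eta j.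

Definition strongly_majorized {R : realType} (xi eta : R^nat) :=
  majorized xi eta /\
  limn_einf (fun n => (\sum_(0 <= j < n) (eta j - xi j))%:E) = 0%E.

(* Main.v *)
Require Import Defs.
From HB Require Import structures.
From mathcomp Require Import all_boot all_order all_algebra.
From mathcomp Require Import sesquilinear complex.
From mathcomp Require Import all_classical all_reals all_analysis.
From mathcomp Require Import ring lra zify.
Import Order.TTheory GRing.Theory Num.Theory.
Import numFieldNormedType.Exports.
Local Open Scope classical_set_scope.
Local Open Scope ring_scope.

(* Write A = sum_j s_j <., f_j> f_j with s decreasing. The diagonal of V A V^*
   has the entries <A u_k, u_k> with u_k = V^* e_k, and Ky Fan's inequality bounds
   their partial sums by those of s; the total sums agree by Tonelli. A zero entry
   forces u_k into the kernel of A, which gives (i) by Bessel's inequality.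

   For (iii), all nonzero eigenvalues of A form a diagonal in E(V(A)); were it the
   diagonal of a unitary conjugate, the loss in Ky Fan's inequality caused by a
   unit vector w of ker A, at least s_n sum_{k<n} |<u_k, w>|^2, would vanish.

   For (ii) one needs, given xi majorized by s, an orthonormal basis u with
   <A u_k, u_k> = xi_k. The vectors are produced one at a time: u_k is a
   combination of two vectors g_0, g_l of the current frame, g_0 belonging to the
   largest remaining eigenvalue; the orthogonal combination of g_0, g_l goes back
   into the frame and keeps the compression of A diagonal. The partner l is taken
   far away, with eigenvalue at most xi_k / 2, whenever the majorization permits.
   A unit vector w orthogonal to all u_k would by Ky Fan leave a gap <A w, w> > 0 in
   the majorization at every stage. This is absurd if liminf sum (s - xi) = 0.
   Otherwise sum xi diverges; the gap makes every late step a far one, which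
   decreases a fixed finite sum of top eigenvalues by at least xi_k / 2, absurd
   again. *)

Set Implicit Arguments.
Unset Strict Implicit.
Unset Printing Implicit Defensive.


(** * Inner products with real-valued square norms *)

Section ComplexNumbers.
Context {R : realType}.
Implicit Types z w : R[i].

(** Norms take values in [R[i]], whose order is only partial. All estimates therefore run through
    the real squares [csq] and [sqnorm], which also keeps square roots away. In (ii) the obstacle is
    totality of the vectors [u_k], not their diagonal values. The first eigenvalue that drops to
    [xi_k] is always an admissible partner, but it may take almost nothing off the top eigenvalues.
    A far partner removes [xi_k - eta_l >= xi_k / 2] from them, but it can break the majorization at
    lengths below [l]; the condition [slack] rules this out. The assumption R_A = I enters as
    injectivity, which makes <A w, w> positive for the hypothetical missing vector [w]. A partial
    isometry [V] whose diagonal has full range is never completed to a unitary. It only supplies a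
    majorization and an equality of traces, and a new unitary is built from the two sequences alone.
    That construction wants decreasing data, so it runs on the rearranged diagonal and is permuted
    back; the rearrangement is a bijection of the indices because R_B = I excludes zero entries. *)

Definition csq z : R := complex.Re z ^+ 2 + complex.Im z ^+ 2.

Lemma csqE z : ((csq z)%:C)%C = `|z| ^+ 2.
Proof. exact: add_Re2_Im2. Qed.

Lemma csq_ge0 z : 0 <= csq z.
Proof. by rewrite addr_ge0 ?sqr_ge0. Qed.

Lemma csq_eq0 z : csq z = 0 -> z = 0.
Proof.
case: z => a b; rewrite /csq /= => /eqP; rewrite paddr_eq0 ?sqr_ge0 //.
by rewrite !sqrf_eq0 => /andP[/eqP -> /eqP ->].
Qed.

Lemma csq0 : csq 0 = 0.
Proof. by rewrite /csq /= expr0n addr0. Qed.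

Lemma csqM z w : csq (z * w) = csq z * csq w.
Proof. by case: z => a b; case: w => c d; rewrite /csq /=; ring. Qed.

Lemma csqJ z : csq (Num.conj z) = csq z.
Proof. by case: z => a b; rewrite /csq /=; ring. Qed.

Lemma csq_real (a : R) : csq (a%:C)%C = a ^+ 2.
Proof. by rewrite /csq /= expr0n addr0. Qed.

Lemma ReD z w : complex.Re (z + w) = complex.Re z + complex.Re w.
Proof. by case: z; case: w. Qed.

Lemma ReN z : complex.Re (- z) = - complex.Re z.
Proof. by case: z. Qed.

Lemma ReJ z : complex.Re (Num.conj z) = complex.Re z.
Proof. by case: z. Qed.

Lemma ReZ (a : R) z : complex.Re ((a%:C)%C * z) = a * complex.Re z.
Proof. by case: z => x y /=; ring. Qed.

Lemma Re_sum I r (P : pred I) (F : I -> R[i]) :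
  complex.Re (\sum_(i <- r | P i) F i) = \sum_(i <- r | P i) complex.Re (F i).
Proof. by apply: (big_morph _ ReD). Qed.

Lemma conj_real (a : R) : Num.conj (a%:C)%C = (a%:C)%C.
Proof. exact: conjc_real. Qed.

Lemma mul_conj z : z * Num.conj z = ((csq z)%:C)%C.
Proof. by rewrite csqE normCK. Qed.

Lemma ge0_complexP z : 0 <= z <-> exists2 a : R, 0 <= a & z = (a%:C)%C.
Proof.
split=> [|[a a0 ->]]; last by rewrite ler0c.
by rewrite lecE /= => /andP[/eqP h a0]; exists (complex.Re z) => //;
  case: z h a0 => a b /= -> _.
Qed.

Lemma csqD_le z w : csq (z + w) <= (csq z + csq w) *+ 2.
Proof.
case: z => a b; case: w => c d; rewrite /csq /=.
have := sqr_ge0 (a - c); have := sqr_ge0 (b - d); rewrite !mulr2n; nra.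
Qed.

End ComplexNumbers.

Section InnerProduct.
Context {R : realType} {H : completeNormedModType R[i]}.
Variable ip : {dot H for (@Num.conj R[i])}.
Implicit Types (x y z : H) (a : R[i]) (r : R).

Lemma ipC x y : ip x y = Num.conj (ip y x).
Proof. by rewrite hermC /= expr0 mul1r. Qed.

Lemma ipDl x y z : ip (x + y) z = ip x z + ip y z.
Proof. exact: linearDl. Qed.
Lemma ipDr x y z : ip x (y + z) = ip x y + ip x z.
Proof. exact: linearDr. Qed.
Lemma ipBl x y z : ip (x - y) z = ip x z - ip y z.
Proof. exact: linearBl. Qed.
Lemma ipBr x y z : ip x (y - z) = ip x y - ip x z.
Proof. exact: linearBr. Qed.
Lemma ipNl x y : ip (- x) y = - ip x y.
Proof. exact: linearNl. Qed.
Lemma ipNr x y : ip x (- y) = - ip x y.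
Proof. exact: linearNr. Qed.
Lemma ip0l x : ip 0 x = 0.
Proof. exact: linear0l. Qed.
Lemma ip0r x : ip x 0 = 0.
Proof. exact: linear0r. Qed.
Lemma ipZl a x y : ip (a *: x) y = a * ip x y.
Proof. exact: linearZl_LR. Qed.
Lemma ipZr a x y : ip x (a *: y) = Num.conj a * ip x y.
Proof. exact: linearZr_LR. Qed.

Lemma ip_suml I s (P : pred I) (F : I -> H) y :
  ip (\sum_(i <- s | P i) F i) y = \sum_(i <- s | P i) ip (F i) y.
Proof. by apply: (big_morph (ip^~ y)) => [? ?|]; rewrite ?ipDl ?ip0l. Qed.

Lemma ip_sumr I s (P : pred I) (F : I -> H) y :
  ip y (\sum_(i <- s | P i) F i) = \sum_(i <- s | P i) ip y (F i).
Proof. by apply: (big_morph (ip y)) => [? ?|]; rewrite ?ipDr ?ip0r. Qed.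

Definition sqnorm x : R := complex.Re (ip x x).

Lemma ip_ge0 x : 0 <= ip x x.
Proof. exact: dnorm_ge0. Qed.

Lemma ipxx x : ip x x = ((sqnorm x)%:C)%C.
Proof. by have /ge0_complexP[a _ h] := ip_ge0 x; rewrite /sqnorm h. Qed.

Lemma nsq_ge0 x : 0 <= sqnorm x.
Proof. by have := ip_ge0 x; rewrite ipxx ler0c. Qed.

Lemma nsq_eq0 x : sqnorm x = 0 -> x = 0.
Proof. by move=> h; apply/eqP; rewrite -(dnorm_eq0 ip) ipxx h. Qed.

Lemma nsq0 : sqnorm 0 = 0.
Proof. by rewrite /sqnorm ip0l. Qed.

Lemma nsqD x y : sqnorm (x + y) = sqnorm x + sqnorm y + complex.Re (ip x y) *+ 2.
Proof.
rewrite /sqnorm !ipDl !ipDr !ReD [ip y x]ipC ReJ; ring.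
Qed.

Lemma nsqN x : sqnorm (- x) = sqnorm x.
Proof. by rewrite /sqnorm ipNl ipNr opprK. Qed.

Lemma nsqB x y : sqnorm (x - y) = sqnorm x + sqnorm y - complex.Re (ip x y) *+ 2.
Proof. by rewrite nsqD nsqN ipNr ReN mulNrn. Qed.

Lemma nsqZ a x : sqnorm (a *: x) = csq a * sqnorm x.
Proof. by rewrite /sqnorm ipZl ipZr mulrA mul_conj ReZ. Qed.

Lemma nsqD_le x y : sqnorm (x + y) <= (sqnorm x + sqnorm y) *+ 2.
Proof. have := nsq_ge0 (x - y); rewrite nsqB nsqD !mulr2n; lra. Qed.

Lemma nsqB_le x y : sqnorm (x - y) <= (sqnorm x + sqnorm y) *+ 2.
Proof. by rewrite -[sqnorm y]nsqN; exact: nsqD_le. Qed.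

(** The case [c = 0] is kept so that the bound also serves semidefinite forms such as <A x, y>. *)
Lemma discriminant_le (a b c : R) : 0 <= c ->
  (forall t, 0 <= a + t * b *+ 2 + t ^+ 2 * c) -> b ^+ 2 <= a * c.
Proof.
rewrite le_eqVlt => /predU1P[<- h|c0 h].
  rewrite mulr0; have [-> |b0] := eqVneq b 0; first by rewrite expr0n.
  (* For [c = 0] and [b != 0] the affine function takes the value -1 at this [t]. *)
  have := h (- (a + 1) / (b *+ 2)).
  have -> : - (a + 1) / (b *+ 2) * b *+ 2 = - (a + 1) by field.
  by rewrite mulr0 addr0; lra.
have := h (- b / c).
have -> : a + (- b / c) * b *+ 2 + (- b / c) ^+ 2 * c = (a * c - b ^+ 2) / c.
  by field; rewrite gt_eqF.
by rewrite pmulr_lge0 ?invr_gt0 // subr_ge0.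
Qed.

(* The vector [x + t <x,y> y] makes the discriminant see [|<x,y>|^2] instead of
   [Re <x,y>]. *)
Lemma nsq_cs x y : csq (ip x y) <= sqnorm x * sqnorm y.
Proof.
have [->|h] := eqVneq (csq (ip x y)) 0; first by rewrite mulr_ge0 ?nsq_ge0.
have h0 : 0 < csq (ip x y) by rewrite lt_neqAle eq_sym h csq_ge0.
pose a := ip x y.
have : (csq a) ^+ 2 <= sqnorm x * (csq a * sqnorm y).
  apply: discriminant_le => [|t]; first by rewrite mulr_ge0 ?csq_ge0 ?nsq_ge0.
  have := nsq_ge0 (x + ((t%:C)%C * a) *: y).
  rewrite nsqD nsqZ csqM csq_real ipZr rmorphM /= conj_real -/a.
  have -> : (t%:C)%C * Num.conj a * a = (t%:C)%C * (a * Num.conj a) by ring.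
  by rewrite mul_conj ReZ /= !mulr2n; lra.
by rewrite expr2 mulrCA ler_pM2l.
Qed.

End InnerProduct.

(** * Convergence and boundedness through the square norm *)

Section HilbertTopology.
Context {R : realType} {H : completeNormedModType R[i]}.
Variable ip : {dot H for (@Num.conj R[i])}.
Hypothesis hH : hilbert_norm ip.
Implicit Types (x y z : H) (u : nat -> H).
Local Notation nsq := (sqnorm ip).

Lemma norm_lt_real x (r : R) : 0 < r -> (`|x| < (r%:C)%C) = (nsq x < r ^+ 2).
Proof.
move=> r0; rewrite -(@ltr_pXn2r _ 2) ?nnegrE ?normr_ge0 ?ler0c ?(ltW r0) //.
by rewrite hH ipxx -rmorphXn /= ltcR.
Qed.

Lemma norm_le1 x : (`|x| <= 1) = (nsq x <= 1).
Proof.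
rewrite -(@ler_pXn2r _ 2) ?nnegrE ?normr_ge0 ?ler01 //.
by rewrite hH ipxx expr1n -lecR.
Qed.

Lemma norm_eq_nsq x y : `|x| = `|y| <-> nsq x = nsq y.
Proof.
split=> [h|h]; first by have := hH x; rewrite h hH !ipxx => /complexI.
apply/eqP; rewrite -(@eqrXn2 _ 2) ?normr_ge0 //.
by rewrite !hH !ipxx h.
Qed.

Lemma cvg_nsqP (T : Type) (F : set_system T) (FF : Filter F) (f : T -> H) x :
  f @ F --> x <-> forall eps : R, 0 < eps -> F [set t | nsq (x - f t) < eps].
Proof.
split=> [/cvgrPdist_lt h eps e0|h].
  have /h : 0 < ((Num.sqrt eps)%:C)%C :> R[i] by rewrite ltcR sqrtr_gt0.
  apply: filterS => t /=; rewrite norm_lt_real ?sqrtr_gt0 //.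
  by rewrite sqr_sqrtr // ltW.
apply/cvgrPdist_lt => eps e0.
have [r r0 er] := (ge0_complexP eps).1 (ltW e0).
have {}r0 : 0 < r by rewrite -ltcR -er.
have := h _ (exprn_gt0 2 r0); apply: filterS => t /=.
by rewrite er norm_lt_real.
Qed.

Lemma nbhs_nsq x (eps : R) : 0 < eps -> nbhs x [set y | nsq (x - y) < eps].
Proof.
move=> e0; have h : id @ nbhs x --> x by [].
by have /(_ _)/iffLR/(_ h _ e0) := cvg_nsqP (F := nbhs x) _ id x; exact.
Qed.

Lemma cvg_seqP u x : u @ \oo --> x <->
  forall eps : R, 0 < eps -> exists N, forall n, (N <= n)%N -> nsq (x - u n) < eps.
Proof.
split=> [/cvg_nsqP h eps e0|h].
  by have [N _ hN] := h _ e0; exists N => n; exact: hN.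
by apply/cvg_nsqP => eps /h[N hN]; exists N => // n /=; exact: hN.
Qed.

Lemma cauchy_seq_cvg u :
  (forall eps : R, 0 < eps -> exists N, forall m n, (N <= m)%N -> (N <= n)%N ->
     nsq (u m - u n) < eps) -> exists x, u @ \oo --> x.
Proof.
move=> h; apply/cvg_ex/cauchy_cvgP/cauchy_ballP => eps e0; near_simpl.
have [r r0 er] := (ge0_complexP eps).1 (ltW e0).
have {}r0 : 0 < r by rewrite -ltcR -er.
have [N hN] := h _ (exprn_gt0 2 r0).
exists ([set n | (N <= n)%N], [set n | (N <= n)%N]); first by split; exists N.
move=> [m n] [/= hm hn]; rewrite -ball_normE /ball_ /= er norm_lt_real //.
exact: hN.
Qed.

Lemma cvg_uniq u x y : u @ \oo --> x -> u @ \oo --> y -> x = y.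
Proof.
move=> ux uy; rewrite -(cvg_lim _ ux) // -(cvg_lim _ uy) //.
Qed.

Lemma ip_lim_eq u x y (c : R[i]) N : u @ \oo --> x ->
  (forall n, (N <= n)%N -> ip (u n) y = c) -> ip x y = c.
Proof.
move=> /cvg_seqP ux uc; apply/eqP; rewrite -subr_eq0; apply/eqP/csq_eq0/eqP.
rewrite eq_le csq_ge0 andbT; apply/ler_addgt0Pl => eps e0; rewrite addr0.
have d0 : 0 < eps / (nsq y + 1) by rewrite divr_gt0 ?ltr_wpDl ?nsq_ge0.
have [M hM] := ux _ d0.
have lM : (M <= maxn M N)%N by rewrite leq_maxl.
rewrite -(uc (maxn M N)) ?leq_maxr // -ipBl.
apply: le_trans (nsq_cs ip _ y) _.
have y1 : 0 < nsq y + 1 by rewrite ltr_wpDl ?nsq_ge0.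
have := hM _ lM; rewrite ltr_pdivlMr // => h; apply/ltW/(le_lt_trans _ h).
by rewrite ler_wpM2l ?nsq_ge0 // lerDl.
Qed.

Lemma ip_lim u x y : u @ \oo --> x ->
  forall eps : R, 0 < eps -> exists N, forall n, (N <= n)%N ->
    csq (ip (u n) y - ip x y) < eps.
Proof.
move=> /cvg_seqP ux eps e0.
have y1 : 0 < nsq y + 1 by rewrite ltr_wpDl ?nsq_ge0.
have d0 : 0 < eps / (nsq y + 1) by rewrite divr_gt0.
have [M hM] := ux _ d0; exists M => n /hM; rewrite ltr_pdivlMr // => h.
rewrite -ipBl; apply: le_lt_trans (nsq_cs ip _ y) _.
rewrite -nsqN opprB; apply: le_lt_trans h.
by rewrite ler_wpM2l ?nsq_ge0 // lerDl.
Qed.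

Lemma cvg_cst_seq u x N : (forall n, (N <= n)%N -> u n = x) -> u @ \oo --> x.
Proof.
move=> h; apply/cvg_seqP => eps e0; exists N => n /h ->.
by rewrite subrr nsq0.
Qed.

Lemma closure_nsqP (M : set H) x :
  closure M x <-> forall eps : R, 0 < eps -> exists2 y, M y & nsq (x - y) < eps.
Proof.
split=> [cx eps e0|h B].
  by have [y [My hy]] := cx _ (nbhs_nsq x e0); exists y.
move=> /nbhs_ballP[e /= e0 sB].
have [r r0 er] := (ge0_complexP e).1 (ltW e0).
have {}r0 : 0 < r by rewrite -ltcR -er.
have [y My hy] := h _ (exprn_gt0 2 r0); exists y; split=> //; apply: sB.
by rewrite -ball_normE /ball_ /= er norm_lt_real.
Qed.

(** * Linear maps and boundedness *)

Section LinearOperators.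
Variable T : H -> H.
Hypothesis linT : linear T.

Lemma linD x y : T (x + y) = T x + T y.
Proof. by have := linT 1 x y; rewrite !scale1r. Qed.

Lemma lin0 : T 0 = 0.
Proof.
have := linT 1 0 0; rewrite !scale1r add0r => /eqP.
by rewrite -subr_eq0 opprD addrA subrr sub0r oppr_eq0 => /eqP.
Qed.

Lemma linZ a x : T (a *: x) = a *: T x.
Proof. by have := linT a x 0; rewrite addr0 lin0 addr0. Qed.

Lemma linN x : T (- x) = - T x.
Proof. by rewrite -scaleN1r linZ scaleN1r. Qed.

Lemma linB x y : T (x - y) = T x - T y.
Proof. by rewrite linD linN. Qed.

Lemma lin_sum I s (P : pred I) (F : I -> H) :
  T (\sum_(i <- s | P i) F i) = \sum_(i <- s | P i) T (F i).
Proof. by apply: (big_morph T) => [? ?|]; rewrite ?linD ?lin0. Qed.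

Lemma continuous_nsq_bounded : continuous T ->
  exists2 C : R, 0 < C & forall x, nsq (T x) <= C * nsq x.
Proof.
move=> /(_ 0)/cvg_nsqP/(_ 1 ltr01); rewrite lin0 => h.
move: h => /nbhs_ballP[e /= e0 sB].
have [r r0 er] := (ge0_complexP e).1 (ltW e0).
have {}r0 : 0 < r by rewrite -ltcR -er.
exists (2 / r ^+ 2) => [|x]; first by rewrite divr_gt0 // exprn_gt0.
have [x0|x0] := eqVneq (nsq x) 0.
  by rewrite x0 mulr0 (nsq_eq0 x0) lin0 nsq0.
have {}x0 : 0 < nsq x by rewrite lt_neqAle eq_sym x0 nsq_ge0.
(* The factor 2 puts [t x] strictly inside the ball of radius [r], on which [nsq (T _) < 1]. *)
pose t := r / Num.sqrt (2 * nsq x).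
have st : t ^+ 2 = r ^+ 2 / (2 * nsq x).
  by rewrite /t expr_div_n sqr_sqrtr // mulr_ge0 ?ltW.
have := sB ((t%:C)%C *: x); rewrite -ball_normE /ball_ /= er norm_lt_real //.
rewrite !sub0r !nsqN linZ !nsqZ csq_real st.
have r2 : 0 < r ^+ 2 by rewrite exprn_gt0.
have -> : r ^+ 2 / (2 * nsq x) * nsq x = r ^+ 2 / 2 by field; rewrite gt_eqF.
rewrite ltr_pdivrMr // ltr_pMr // ltr1n => /(_ isT) /ltW.
rewrite mulrAC ler_pdivrMr ?mulr_gt0 // mul1r => h.
by rewrite mulrAC ler_pdivlMr // mulrC.
Qed.

Lemma nsq_bounded_continuous (C : R) :
  (forall x, nsq (T x) <= C * nsq x) -> continuous T.
Proof.
move=> h x; apply/cvg_nsqP => eps e0.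
have C1 : 0 < `|C| + 1 by rewrite ltr_wpDl.
have := nbhs_nsq x (divr_gt0 e0 C1).
apply: filterS => y /=; rewrite ltr_pdivlMr // => hy.
rewrite -linB; apply: le_lt_trans (h _) _; apply: le_lt_trans hy.
rewrite mulrC ler_wpM2l ?nsq_ge0 //.
by rewrite (le_trans (ler_norm _)) // lerDl.
Qed.

Lemma bounded_cvg u x : continuous T -> u @ \oo --> x -> (T \o u) @ \oo --> T x.
Proof. by move=> cT ux; apply: cvg_comp ux _; exact: cT. Qed.

End LinearOperators.
End HilbertTopology.

(** * Orthonormal sequences and the operators they carry *)

Lemma cvgn_realP (R : realType) (s : R^nat) (l : R) : s @ \oo --> l <->
  forall eps : R, 0 < eps -> exists N, forall n, (N <= n)%N -> `|l - s n| < eps.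
Proof.
split=> [/cvgrPdist_lt h eps e0|h].
  by have [N _ hN] := h _ e0; exists N => n; exact: hN.
by apply/cvgrPdist_lt => eps /h[N hN]; exists N => // n /=; exact: hN.
Qed.

Lemma cvgn_le (R : realType) (s : R^nat) (l b : R) N : s @ \oo --> l ->
  (forall n, (N <= n)%N -> s n <= b) -> l <= b.
Proof.
move=> /cvgn_realP sl sb; apply/ler_addgt0Pl => eps /sl[M hM].
have := hM (maxn M N) (leq_maxl _ _).
have := sb (maxn M N) (leq_maxr _ _).
by rewrite ltr_norml => h /andP[_ h2]; lra.
Qed.

Lemma cvgn_ge (R : realType) (s : R^nat) (l b : R) N : s @ \oo --> l ->
  (forall n, (N <= n)%N -> b <= s n) -> b <= l.
Proof.
move=> sl sb; rewrite -lerN2; apply: (cvgn_le (cvgN sl) (N := N)) => n /sb.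
by rewrite lerN2.
Qed.

Lemma nondecreasing_bounded_cauchy (R : realType) (s : R^nat) (M : R) :
  {homo s : m n / (m <= n)%N >-> m <= n} -> (forall n, s n <= M) ->
  forall eps : R, 0 < eps -> exists N, forall m n, (N <= m)%N -> (m <= n)%N ->
    s n - s m < eps.
Proof.
move=> ns sM eps e0.
have hs : has_sup (range s).
  by split; [exists (s 0%N); exists 0%N|exists M => _ [n _ <-]].
have [_ [N _ <-] hN] := sup_adherent e0 hs.
exists N => m n Nm mn.
have h1 : s n <= sup (range s) by apply: ub_le_sup; [case: hs|exists n].
have h2 := ns _ _ Nm; lra.
Qed.

Section Orthonormal.
Context {R : realType} {H : completeNormedModType R[i]}.
Variable ip : {dot H for (@Num.conj R[i])}.
Hypothesis hH : hilbert_norm ip.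
Implicit Types (x y z : H) (u v : nat -> H) (a c : nat -> R[i]).
Local Notation nsq := (sqnorm ip).

Lemma cvg_Re_ip u x y : u @ \oo --> x ->
  (fun n => complex.Re (ip (u n) y)) @ \oo --> complex.Re (ip x y).
Proof.
move=> ux; apply/cvgn_realP => eps e0.
have [N hN] := ip_lim hH y ux (exprn_gt0 2 e0).
exists N => n /hN; rewrite -ipBl.
have -> : complex.Re (ip x y) - complex.Re (ip (u n) y) =
    - complex.Re (ip (u n - x) y) by rewrite ipBl ReD ReN opprB.
rewrite normrN; set z := ip _ _ => hz; rewrite ltNge; apply/negP => h.
have : eps ^+ 2 <= complex.Re z ^+ 2.
  rewrite -[X in _ <= X]real_normK ?num_real // ler_sqr ?nnegrE //.
  exact: ltW.
by have := sqr_ge0 (complex.Im z); move: hz; rewrite /csq; lra.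
Qed.

(** Because of this, an identity between inner products that holds for all [y] need only be checked
    on real parts. *)
Lemma Im_ip x y : complex.Im (ip x y) = complex.Re (ip x ('i%C *: y)).
Proof. by rewrite ipZr; case: (ip x y) => a b /=; ring. Qed.

Lemma cvg_nsq u x : u @ \oo --> x -> (fun n => nsq (u n)) @ \oo --> nsq x.
Proof.
move=> ux.
have h1 : (fun n => nsq (x - u n)) @ \oo --> (0 : R).
  apply/cvgn_realP => eps e0; have [N hN] := (cvg_seqP hH u x).1 ux _ e0.
  by exists N => n /hN; rewrite sub0r normrN ger0_norm ?nsq_ge0.
have h2 := cvg_Re_ip (y := x) ux.
have -> : nsq x = 0 - nsq x + complex.Re (ip x x) *+ 2.
  by rewrite -/(nsq x) mulr2n; lra.
have -> : (fun n => nsq (u n)) =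
    (fun n => nsq (x - u n) - nsq x + complex.Re (ip (u n) x) *+ 2).
  by apply/funext => n; rewrite nsqB [ip x _]ipC ReJ !mulr2n; lra.
apply: cvgD; first by apply: cvgB => //; exact: cvg_cst.
by rewrite !mulr2n; apply: cvgD.
Qed.

Definition orthonormal_sequence u := forall j k, ip (u j) (u k) = (j == k)%:R.

Section OneSequence.
Variable u : nat -> H.
Hypothesis ou : orthonormal_sequence u.

Lemma onsq1 k : nsq (u k) = 1.
Proof. by rewrite /sqnorm ou eqxx. Qed.

Lemma ip_onsum a n k :
  ip (\sum_(j < n) a j *: u j) (u k) = if (k < n)%N then a k else 0.
Proof.
rewrite ip_suml; case: ltnP => h.
  rewrite (bigD1 (Ordinal h)) //= big1 ?addr0; last first.
    move=> i; rewrite -val_eqE /= => /negbTE ik.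
    by rewrite ipZl ou ik mulr0.
  by rewrite ipZl ou eqxx mulr1.
rewrite big1 // => i _; rewrite ipZl ou; case: eqP => [ik|_]; last by rewrite mulr0.
by have := ltn_ord i; rewrite ik ltnNge h.
Qed.

Lemma ip_onsum2 a n m : (m <= n)%N ->
  ip (\sum_(j < n) a j *: u j) (\sum_(j < m) a j *: u j) =
  ((\sum_(j < m) csq (a j))%:C)%C.
Proof.
move=> mn; rewrite ip_sumr rmorph_sum /=; apply: eq_bigr => i _.
by rewrite ipZr ip_onsum (leq_trans _ mn) // mulrC mul_conj.
Qed.

Lemma nsq_onsum a n : nsq (\sum_(j < n) a j *: u j) = \sum_(j < n) csq (a j).
Proof. by rewrite /sqnorm ip_onsum2. Qed.

Lemma nsq_onsumB a n m : (m <= n)%N ->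
  nsq (\sum_(j < n) a j *: u j - \sum_(j < m) a j *: u j) =
  \sum_(j < n) csq (a j) - \sum_(j < m) csq (a j).
Proof. by move=> mn; rewrite nsqB !nsq_onsum ip_onsum2 //= mulr2n; lra. Qed.

Lemma nsq_residual x n :
  nsq (x - \sum_(j < n) ip x (u j) *: u j) =
  nsq x - \sum_(j < n) csq (ip x (u j)).
Proof.
rewrite nsqB (nsq_onsum (fun j => ip x (u j))).
have -> : ip x (\sum_(j < n) ip x (u j) *: u j) =
    ((\sum_(j < n) csq (ip x (u j)))%:C)%C.
  rewrite ip_sumr rmorph_sum /=; apply: eq_bigr => i _.
  by rewrite ipZr mulrC mul_conj.
by rewrite /= mulr2n; lra.
Qed.

Lemma bessel x n : \sum_(j < n) csq (ip x (u j)) <= nsq x.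
Proof. by rewrite -subr_ge0 -nsq_residual nsq_ge0. Qed.

Lemma sum_csq_homo a :
  {homo (fun n => \sum_(j < n) csq (a j)) : m n / (m <= n)%N >-> m <= n}.
Proof.
move=> m n mn; rewrite -!(big_mkord xpredT (fun j => csq (a j))).
rewrite [leRHS](@big_cat_nat _ _ _ m 0) //=.
by rewrite lerDl sumr_ge0 // => i _; exact: csq_ge0.
Qed.

(** The squared distance of two partial sums is a difference of partial sums of a bounded
    nondecreasing real sequence. *)
Lemma riesz_fischer a (M : R) : (forall n, \sum_(j < n) csq (a j) <= M) ->
  exists x, (fun n => \sum_(j < n) a j *: u j) @ \oo --> x.
Proof.
move=> hM; apply: (cauchy_seq_cvg hH) => eps e0.
have [N hN] := nondecreasing_bounded_cauchy (@sum_csq_homo a) hM e0.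
exists N => m n Nm Nn; case/orP: (leq_total m n) => mn; last first.
  by rewrite nsq_onsumB //; exact: hN.
by rewrite -nsqN opprB nsq_onsumB //; exact: hN.
Qed.

End OneSequence.

(* Diagonal operators, unitaries, partial isometries and range projections are
   all of this form. *)
Definition tensor_series u v c x : H :=
  lim ((fun n => \sum_(k < n) (c k * ip x (u k)) *: v k) @ \oo).

Section TensorSeries.
Variables (u v : nat -> H).
Hypothesis (ou : orthonormal_sequence u) (ov : orthonormal_sequence v).
Variables (c : nat -> R[i]) (C : R).
Hypothesis cC : forall k, csq (c k) <= C.

Lemma tensor_series_le x n : \sum_(j < n) csq (c j * ip x (u j)) <= C * nsq x.
Proof.
have C0 : 0 <= C by apply: le_trans (csq_ge0 _) (cC 0).
apply: (@le_trans _ _ (C * \sum_(j < n) csq (ip x (u j)))); last first.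
  by rewrite ler_wpM2l // bessel.
rewrite mulr_sumr ler_sum // => i _; rewrite csqM.
by rewrite ler_wpM2r ?csq_ge0.
Qed.

Lemma tensor_series_cvg x :
  (fun n => \sum_(k < n) (c k * ip x (u k)) *: v k) @ \oo --> tensor_series u v c x.
Proof.
have [y hy] := riesz_fischer ov (a := fun j => c j * ip x (u j)) (@tensor_series_le x).
by rewrite /tensor_series (cvg_lim _ hy).
Qed.

Lemma ip_tensor_series x k : ip (tensor_series u v c x) (v k) = c k * ip x (u k).
Proof.
apply: (ip_lim_eq hH (N := k.+1) (tensor_series_cvg (x := x))) => n kn.
by rewrite (ip_onsum ov (fun k => c k * ip x (u k))) kn.
Qed.

Lemma tensor_series_ortho x y : (forall k, ip (v k) y = 0) ->
  ip (tensor_series u v c x) y = 0.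
Proof.
move=> h; apply: (ip_lim_eq hH (N := 0) (tensor_series_cvg (x := x))) => n _.
by rewrite ip_suml big1 // => i _; rewrite ipZl h mulr0.
Qed.

(** The defect [d] of linearity is orthogonal to every [v k], hence to the three series it is made
    of, hence to itself. *)
Lemma tensor_series_linear : linear (tensor_series u v c).
Proof.
move=> a x y; apply/eqP; rewrite -subr_eq0; apply/eqP/(nsq_eq0 (ip := ip)).
set d := _ - _; rewrite /sqnorm.
have hd k : ip (v k) d = 0.
  rewrite ipC /d ipBl ipDl ipZl !ip_tensor_series ipDl ipZl.
  by apply/eqP; rewrite conjc_eq0; apply/eqP; ring.
by rewrite {1}/d ipBl ipDl ipZl !tensor_series_ortho // mulr0 addr0 subrr.
Qed.

Lemma nsq_tensor_series x : nsq (tensor_series u v c x) <= C * nsq x.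
Proof.
apply: (cvgn_le (N := 0) (cvg_nsq (tensor_series_cvg (x := x)))) => n _.
rewrite (nsq_onsum ov (fun k => c k * ip x (u k))).
exact: tensor_series_le.
Qed.

End TensorSeries.

(** [v] may fail to be total; the last hypothesis places [z] in its closed span, where the
    coefficients determine it. *)
Lemma tensor_series_uniq u v c (C : R) x z :
  orthonormal_sequence u -> orthonormal_sequence v -> (forall k, csq (c k) <= C) ->
  (forall k, ip z (v k) = c k * ip x (u k)) ->
  (forall y, (forall k, ip (v k) y = 0) -> ip z y = 0) ->
  tensor_series u v c x = z.
Proof.
move=> ou ov cC hz z0; apply/eqP; rewrite -subr_eq0; apply/eqP/(nsq_eq0 (ip := ip)).
set d := _ - _; rewrite /sqnorm {1}/d ipBl.
have hd k : ip (v k) d = 0.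
  by rewrite ipC ipBl (ip_tensor_series ou ov cC) hz subrr rmorph0.
by rewrite (tensor_series_ortho ou ov cC) // z0 // subrr.
Qed.

Section TensorSeriesAdjoint.
Variables (u v : nat -> H).
Hypothesis (ou : orthonormal_sequence u) (ov : orthonormal_sequence v).
Variables (c : nat -> R[i]) (C : R).
Hypothesis cC : forall k, csq (c k) <= C.

Lemma tensor_series_adj x y : ip (tensor_series u v c x) y =
  ip x (tensor_series v u (fun k => Num.conj (c k)) y).
Proof.
have cC' k : csq (Num.conj (c k)) <= C by rewrite csqJ.
have key z : complex.Re (ip (tensor_series u v c x) z) =
  complex.Re (ip x (tensor_series v u (fun k => Num.conj (c k)) z)).
  have h1 := cvg_Re_ip (y := z) (tensor_series_cvg ou ov cC (x := x)).
  have h2 := cvg_Re_ip (y := x) (tensor_series_cvg ov ou cC' (x := z)).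
  rewrite [in RHS]ipC ReJ -(cvg_lim _ h1) // -[RHS](cvg_lim _ h2) //.
  suff -> : (fun n => complex.Re (ip (\sum_(k < n) (c k * ip x (u k)) *: v k) z)) =
    (fun n => complex.Re
       (ip (\sum_(k < n) (Num.conj (c k) * ip z (v k)) *: u k) x)) by [].
  apply/funext => n.
  rewrite [in RHS]ip_suml [in LHS]ip_suml !Re_sum; apply: eq_bigr => i _.
  rewrite !ipZl -[LHS]ReJ !rmorphM /= -!ipC.
  by congr (complex.Re _); rewrite mulrAC.
have := key ('i%C *: y); have := key y.
rewrite (linZ (tensor_series_linear ov ou cC')) -!Im_ip.
case: (ip _ _) => p q; case: (ip _ _) => r t /=.
by move=> -> ->.
Qed.

End TensorSeriesAdjoint.
End Orthonormal.

(** * Majorization of null sequences *)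

(* The sequence [s] with its entries [0] and [l] deleted and [b] inserted at
   place [p < l]. *)
Definition reinsert (T : Type) (p l : nat) (b : T) (s : nat -> T) (i : nat) : T :=
  if (i < p)%N then s i.+1 else
  if (i == p)%N then b else if (i < l)%N then s i else s i.+1.

Section ReinsertSums.
Context {R : realType}.
Implicit Types (s : R^nat) (p l n : nat) (b : R).

(** There are three ranges of lengths: up to [p] only entry 0 is lost, between [p] and [l] the value
    [b] has been gained, and from [l] on entry [l] is lost too. Each deleted entry beyond the
    inserted one shifts the upper limit by one. *)
Lemma sum_reinsert_le s p l b n : (n <= p)%N ->
  \sum_(i < n) reinsert p l b s i = \sum_(i < n.+1) s i - s 0%N.
Proof.
move=> np; rewrite big_ord_recl /= addrC addKr; apply: eq_bigr => i _.
by rewrite /reinsert (leq_trans (ltn_ord i) np).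
Qed.

Lemma sum_reinsert_mid s p l b n : (p < n)%N -> (n <= l)%N ->
  \sum_(i < n) reinsert p l b s i = \sum_(i < n) s i - s 0%N + b.
Proof.
elim: n => // n IH; rewrite ltnS leq_eqVlt => /predU1P[<- pl|pn nl].
  by rewrite big_ord_recr /= sum_reinsert_le // {1}/reinsert ltnn eqxx.
rewrite big_ord_recr /= IH // ?(ltnW nl) // [in RHS]big_ord_recr /=.
by rewrite {1}/reinsert ltnNge (ltnW pn) /= (gtn_eqF pn) nl; ring.
Qed.

Lemma sum_reinsert_ge s p l b n : (p < l)%N -> (l <= n)%N ->
  \sum_(i < n) reinsert p l b s i = \sum_(i < n.+1) s i - s 0%N - s l + b.
Proof.
move=> pl; elim: n => [|n IH]; first by rewrite leqn0 => /eqP l0; rewrite l0 in pl.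
rewrite leq_eqVlt => /predU1P[e|ln].
  by rewrite sum_reinsert_mid -?e // [in RHS]big_ord_recr /=; ring.
rewrite ltnS in ln; rewrite big_ord_recr /= IH // [in RHS]big_ord_recr /=.
have pn : (p < n)%N by exact: leq_trans ln.
rewrite {1}/reinsert ltnNge (ltnW pn) /= (gtn_eqF pn) ltnNge ln /=; ring.
Qed.

End ReinsertSums.

Section MajorizationStep.
Context {R : realType}.
Implicit Types (xi eta : R^nat).

Definition noninc eta := forall m n, (m <= n)%N -> eta n <= eta m.

Definition maj xi eta := forall n, \sum_(i < n) xi i <= \sum_(i < n) eta i.

Lemma null_seq_le eta (eps : R) : eta @ \oo --> (0 : R) -> 0 < eps ->
  exists N, forall n, (N <= n)%N -> eta n <= eps.
Proof.
move=> /cvgn_realP h /h[N hN]; exists N => n /hN.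
by rewrite sub0r normrN => /ltW; apply: le_trans; exact: ler_norm.
Qed.

(* Sufficient for the first [n] partial sums to survive when [xi 0] is carved out
   of [eta 0] and a later entry. *)
Definition slack_at xi eta n := \sum_(i < n) xi i + xi n <= \sum_(i < n) eta i \/
  forall j, (j <= n)%N -> xi 0%N <= eta j.

Definition slack xi eta := forall n, (0 < n)%N -> slack_at xi eta n.

(** * One carving step on eigenvalue sequences *)

Section Step.
Variables (xi eta : R^nat) (l p : nat).
Hypothesis (ni_xi : noninc xi) (ni_eta : noninc eta) (eta0 : forall n, 0 <= eta n).
Hypothesis (xi_eta : maj xi eta) (l0 : (0 < l)%N) (lxi : eta l <= xi 0%N).

(** Conservation of the trace on a two-dimensional span: the entries [eta 0] and [eta l] are traded
    for [xi 0] and this remainder. *)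
Let a : R := eta 0%N + eta l - xi 0%N.

Hypothesis (pl : (p < l)%N) (pa : forall j, (0 < j <= p)%N -> a <= eta j).
Hypothesis (pa' : eta p.+1 <= a).

Let eta' := reinsert p l a eta.

Lemma step_xi0 : xi 0%N <= eta 0%N.
Proof. by have := xi_eta 1; rewrite !big_ord1. Qed.

(** Together with [step_ge] this is Cauchy interlacing, [eta i.+1 <= eta' i <= eta i], for a
    compression of codimension one. Positivity and the limit 0 of [eta'] are read off from it. *)
Lemma step_le i : eta' i <= eta i.
Proof.
rewrite /eta' /reinsert; case: ltnP => [ip|pi]; first exact: ni_eta.
case: eqP => [->|/eqP ne]; last by case: ltnP => // _; exact: ni_eta.
have [-> |p0] := posnP p; first by rewrite /a -addrA gerDl subr_le0.
by apply: pa; rewrite p0 leqnn.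
Qed.

Lemma step_ge i : eta i.+1 <= eta' i.
Proof.
rewrite /eta' /reinsert; case: ltnP => // pi; case: eqP => [->//|_].
by case: ifP => // _; exact: ni_eta.
Qed.

Lemma step_noninc : noninc eta'.
Proof.
suff h i : eta' i.+1 <= eta' i.
  move=> m n; elim: n => [|n IH]; first by rewrite leqn0 => /eqP ->.
  rewrite leq_eqVlt => /predU1P[->//|]; rewrite ltnS => /IH; exact: le_trans.
have [e|ne] := eqVneq i.+1 p.
  rewrite /eta' /reinsert e ltnn eqxx -e ltnSn; apply: pa; rewrite -e; lia.
apply: (@le_trans _ _ (eta i.+1)); [exact: step_le | exact: step_ge].
Qed.

Lemma step_ge0 i : 0 <= eta' i.
Proof. by apply: le_trans (step_ge i). Qed.

Lemma step_cvg0 : eta @ \oo --> (0 : R) -> eta' @ \oo --> (0 : R).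
Proof.
move=> h; apply/cvgn_realP => eps e0; have e2 : 0 < eps / 2 by lra.
have [N hN] := null_seq_le h e2; exists N => n /hN hn.
rewrite sub0r normrN ger0_norm ?step_ge0 //.
have := step_le n; lra.
Qed.

(** From length [l] on, both sides lose exactly [xi 0]. Below [l], the first alternative of
    [slack_at] pays for the missing entry [eta l]; under the second, every [eta' i >= eta i.+1] is
    already at least [xi 0 >= xi i.+1]. *)
Lemma step_maj : (forall n, (0 < n < l)%N -> slack_at xi eta n) ->
  maj (fun n => xi n.+1) eta'.
Proof.
move=> sl n.
have sxi m : \sum_(i < m.+1) xi i = xi 0%N + \sum_(i < m) xi i.+1.
  by rewrite big_ord_recl.
have [ln|nl] := leqP l n.
  rewrite sum_reinsert_ge // /a; have := xi_eta n.+1; rewrite sxi; lra.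
have [->|n0] := posnP n; first by rewrite !big_ord0.
have [] : slack_at xi eta n by apply: sl; rewrite n0.
  move=> h; have h2 : \sum_(i < n) eta i - eta 0%N + a <= \sum_(i < n) eta' i.
    have [np|pn] := leqP n p; last by rewrite sum_reinsert_mid // ltnW.
    rewrite sum_reinsert_le // big_ord_recr /=.
    have := pa (j := n); rewrite n0 np => /(_ isT); lra.
  apply: le_trans h2; have := sxi n; rewrite big_ord_recr /= /a => h3.
  have := eta0 l; lra.
move=> h; apply: ler_sum => i _; apply: le_trans (step_ge i).
apply: le_trans (ni_xi (leq0n i.+1)) _; apply: h.
by have := ltn_ord i; lia.
Qed.

(** [eta M < a] forces the remainder to be inserted among the first [M] entries, so their sum really
    loses [xi 0 - eta l], or more if [l < M]. For a far partner this is at least half of [xi 0]. *)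
Lemma step_decr M : eta M < a ->
  \sum_(i < M) eta' i <= \sum_(i < M) eta i - (xi 0%N - eta l).
Proof.
move=> Ma; have [Ml|lM] := leqP M l; last first.
  rewrite sum_reinsert_ge ?(ltnW lM) // big_ord_recr /= /a.
  by have := ni_eta (ltnW lM); lra.
suff pM : (p < M)%N by rewrite sum_reinsert_mid // /a; set S := \sum_(i < M) _; lra.
rewrite ltnNge; apply/negP => Mp.
have M0 : (0 < M)%N.
  by case: M Ma {Ml Mp} => // ; rewrite /a ltNge; have := lxi; have := step_xi0; lra.
by have := pa (j := M); rewrite M0 Mp => /(_ isT); lra.
Qed.

End Step.

Lemma exists_insertion_place eta (l : nat) (a : R) : (0 < l)%N -> eta l <= a ->
  exists p, [/\ (p < l)%N, forall j, (0 < j <= p)%N -> a <= eta j & eta p.+1 <= a].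
Proof.
move=> l0 la; have ex : exists p, eta p.+1 <= a by exists l.-1; rewrite prednK.
exists (ex_minn ex); case: ex_minnP => p hp mp; split=> //.
  by have := mp l.-1; rewrite prednK // => /(_ la); lia.
move=> j /andP[]; case: j => // j _ jp; rewrite leNgt; apply/negP => /ltW /mp.
by rewrite leqNgt jp.
Qed.

Lemma exists_far eta (eps : R) : eta @ \oo --> (0 : R) -> 0 < eps ->
  exists2 l, (0 < l)%N & eta l <= eps.
Proof.
move=> h e; have [N hN] := null_seq_le h e.
by exists N.+1 => //; apply: hN.
Qed.

(** Take the first positive index whose entry is at most [xi 0]: all entries before it are at least
    [xi 0], which is the second alternative of [slack_at]. *)
Lemma exists_near xi eta : eta @ \oo --> (0 : R) -> 0 < xi 0%N ->
  maj xi eta -> exists l, [/\ (0 < l)%N, eta l <= xi 0%N &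
    forall n, (0 < n < l)%N -> slack_at xi eta n].
Proof.
move=> h x0 m; have [l1 l10 hl1] := exists_far h x0.
have ex : exists l, (0 < l)%N && (eta l <= xi 0%N) by exists l1; rewrite l10.
exists (ex_minn ex); case: ex_minnP => l /andP[l0 hl] ml; split=> // n /andP[n0 nl].
right=> j jn; have [->|j0] := posnP j; first exact: step_xi0.
rewrite leNgt; apply/negP => /ltW hj.
by have := ml j; rewrite j0 hj => /(_ isT); lia.
Qed.

(* The gap [g] comes from a vector orthogonal to everything built so far. *)
Lemma gap_slack xi eta (g : R) : noninc xi -> noninc eta ->
  (forall n, \sum_(i < n) xi i + g <= \sum_(i < n.+1) eta i) ->
  xi 0%N <= g / 2 -> slack xi eta.
Proof.
move=> nx ne h xg n n0; have [e|e] := leP (g / 2) (eta n).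
  by right=> j jn; apply: le_trans xg _; apply: le_trans e _; exact: ne.
left; have := h n; have := nx 0%N n (leq0n n); rewrite big_ord_recr /=; lra.
Qed.

(** Write each eigenvalue as its excess over [eta m] plus [eta m]; the column sums of [b] bound the
    contribution of the excesses. With [t = 1] this is Ky Fan's inequality. A smaller [t], recording
    the mass that a row leaves in the kernel, yields the loss needed for properness. *)
Lemma kyfan_sum (m n : nat) (b : nat -> nat -> R) (q t eta : R^nat) : noninc eta ->
  (forall k, (k < n)%N ->
     q k <= \sum_(j < m) (eta j - eta m) * b k j + eta m * t k) ->
  (forall j, (j < m)%N -> \sum_(k < n) b k j <= 1) ->
  \sum_(k < n) q k <= \sum_(j < m) (eta j - eta m) + eta m * \sum_(k < n) t k.
Proof.
move=> ne hq hb.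
apply: (@le_trans _ _
  (\sum_(k < n) (\sum_(j < m) (eta j - eta m) * b k j + eta m * t k))).
  by apply: ler_sum => k _; exact: hq.
rewrite big_split /= exchange_big /= mulr_sumr lerD2r; apply: ler_sum => j _.
rewrite -mulr_sumr -[leRHS]mulr1 ler_wpM2l ?hb // subr_ge0.
by apply: ne; exact: ltnW.
Qed.

Lemma sum_sub_const (m : nat) eta (c : R) :
  \sum_(j < m) (eta j - c) + c * m%:R = \sum_(j < m) eta j.
Proof. by rewrite sumrB sumr_const card_ord mulr_natr subrK. Qed.

End MajorizationStep.

(** * One step of the Schur-Horn construction *)

Lemma dependent_choice_inv (T : Type) (P : nat -> T -> Prop)
    (Q : nat -> T -> T -> Prop) (s0 : T) : P 0%N s0 ->
  (forall n s, P n s -> exists s', P n.+1 s' /\ Q n s s') ->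
  exists F : nat -> T, F 0%N = s0 /\ forall n, P n (F n) /\ Q n (F n) (F n.+1).
Proof.
move=> P0 h.
have ex (ns : nat * T) : exists s', P ns.1 ns.2 -> P ns.1.+1 s' /\ Q ns.1 ns.2 s'.
  have [p|np] := pselect (P ns.1 ns.2); last by exists ns.2.
  by have [s' hs'] := h _ _ p; exists s'.
have [f hf] := choice ex.
pose F := fix F n := if n is m.+1 then f (m, F m) else s0.
have PF n : P n (F n) by elim: n => [//|n IH]; exact: (hf (n, F n) IH).1.
by exists F; split=> // n; split=> //; exact: (hf (n, F n) (PF n)).2.
Qed.

Section Horn.
Context {R : realType} {H : completeNormedModType R[i]}.
Variable ip : {dot H for (@Num.conj R[i])}.
Local Notation nsq := (sqnorm ip).
Local Notation orthonormal_seq := (orthonormal_sequence ip).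
Implicit Types (x w : H) (g : nat -> H) (eta xi : R^nat).

(** The set [W] is there because, during the construction, [q] expands in the current frame only on
    the space that remains. The vectors [x k] satisfy Bessel-type bounds instead of orthonormality,
    so that images of a basis under the adjoint of an isometry qualify. *)
Lemma kyfan (q : H -> R) g eta (W : set H) : orthonormal_seq g -> noninc eta ->
  (forall n, 0 <= eta n) ->
  (forall x, W x ->
     (fun N => \sum_(j < N) eta j * csq (ip x (g j))) @ \oo --> q x) ->
  forall (x : nat -> H) n, (forall k, W (x k)) -> (forall k, nsq (x k) <= 1) ->
  (forall j m, \sum_(k < m) csq (ip (x k) (g j)) <= 1) ->
  \sum_(k < n) q (x k) <= \sum_(j < n) eta j.
Proof.
move=> og ne eta0 hq x n Wx nx hx.
have := kyfan_sum (n := n) (m := n) (b := fun k j => csq (ip (x k) (g j)))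
  (q := fun k => q (x k)) (t := fun=> 1) ne.
rewrite sumr_const card_ord sum_sub_const; apply=> // k _.
rewrite mulr1; apply: (cvgn_le (N := n) (hq _ (Wx k))) => N nN.
rewrite (bigID (fun j : 'I_N => (j < n)%N)) /=.
have -> : \sum_(j < n) (eta j - eta n) * csq (ip (x k) (g j)) =
    \sum_(j < N | (j < n)%N) (eta j - eta n) * csq (ip (x k) (g j)).
  rewrite -(big_mkord xpredT (fun j => (eta j - eta n) * csq (ip (x k) (g j)))).
  rewrite (big_nat_widen _ _ _ _ _ nN) big_mkord.
  by apply: eq_bigl => j.
have -> : \sum_(j < N | (j < n)%N) eta j * csq (ip (x k) (g j)) =
    \sum_(j < N | (j < n)%N) (eta j - eta n) * csq (ip (x k) (g j)) +
    eta n * \sum_(j < N | (j < n)%N) csq (ip (x k) (g j)).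
  by rewrite mulr_sumr -big_split /=; apply: eq_bigr => j _; rewrite -mulrDl subrK.
rewrite -addrA lerD2l.
apply: (@le_trans _ _ (eta n * \sum_(j < N) csq (ip (x k) (g j)))); last first.
  rewrite -[leRHS]mulr1 ler_wpM2l //; apply: le_trans (nx k); exact: bessel.
rewrite [in leRHS](bigID (fun j : 'I_N => (j < n)%N)) /= mulrDr lerD2l mulr_sumr.
apply: ler_sum => j; rewrite -leqNgt => nj; rewrite ler_wpM2r ?csq_ge0 //.
exact: ne.
Qed.

Lemma reinsert_cases (T : Type) p l (b : T) (s : nat -> T) i :
  (i == p /\ reinsert p l b s i = b) \/
  [/\ i != p, reinsert p l b s i = s (if (i < p) || (l <= i) then i.+1 else i)%N &
      ((p < i) || (i < p))%N].
Proof.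
rewrite /reinsert; have [->|ne] := eqVneq i p; first by left; rewrite ltnn.
right; split=> //; last by lia.
by case: ltnP => //= pi; case: ltnP.
Qed.

Lemma orthonormal_reinsert p l b g : (0 < l)%N -> (p < l)%N -> orthonormal_seq g ->
  nsq b = 1 -> (forall j, j != 0 -> j != l -> ip b (g j) = 0) ->
  orthonormal_seq (reinsert p l b g).
Proof.
move=> l0 pl og b1 bg i j.
have [[/eqP -> ->]|[ip' -> ci]] := reinsert_cases p l b g i;
have [[/eqP -> ->]|[jp -> cj]] := reinsert_cases p l b g j.
- by rewrite eqxx ipxx b1.
- rewrite eq_sym (negbTE jp) bg //; case: ifP; lia.
- rewrite (negbTE ip') ipC bg ?rmorph0 //; case: ifP; lia.
rewrite og; congr (nat_of_bool _)%:R; do 2!case: ifP; lia.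
Qed.

Lemma mixing_weights (e0 e1 t : R) : e1 <= t -> t <= e0 ->
  exists c s : R, c ^+ 2 + s ^+ 2 = 1 /\ c ^+ 2 * e0 + s ^+ 2 * e1 = t.
Proof.
move=> h1 h2; pose d := (t - e1) / (e0 - e1).
have [e|ne] := eqVneq (e0 - e1) 0.
  exists 1, 0; rewrite expr1n expr0n mul1r mul0r !addr0; split=> //.
  by move: e => /eqP; rewrite subr_eq0 => /eqP e; lra.
have p : 0 < e0 - e1 by rewrite lt_def ne /= subr_ge0 (le_trans h1).
have d0 : 0 <= d by rewrite divr_ge0 ?(ltW p) ?subr_ge0.
have d1 : d <= 1 by rewrite ler_pdivrMr // mul1r lerD2r.
exists (Num.sqrt d), (Num.sqrt (1 - d)).
rewrite !sqr_sqrtr ?subr_ge0 //; split; first by ring.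
by rewrite /d; field.
Qed.

(* [hs_vec] is the vector produced last, [hs_space] the orthogonal complement of
   all vectors produced so far, [hs_frame] an orthonormal basis of it in which the
   compression of the operator is diagonal with entries [hs_eta]. *)
Record horn_state := HornState {
  hs_vec : H; hs_space : set H; hs_frame : nat -> H; hs_eta : R^nat }.

Section Algorithm.
Variables (q : H -> R) (xi : R^nat).
Hypotheses (xi0 : forall n, 0 < xi n) (ni_xi : noninc xi).
Local Notation tail r := (fun n => xi (r + n)%N).

(** The operator itself never appears: that its compression is diagonal in the frame is expressed by
    the expansion of [q] on the remaining space. *)
Definition horn_inv (r : nat) (s : horn_state) :=
  [/\ orthonormal_seq (hs_frame s),
      (forall j, hs_space s (hs_frame s j)) /\
      (forall a x y, hs_space s x -> hs_space s y -> hs_space s (a *: x + y)),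
      forall x, hs_space s x -> (fun N => \sum_(j < N)
        hs_eta s j * csq (ip x (hs_frame s j))) @ \oo --> q x,
      [/\ noninc (hs_eta s), forall n, 0 <= hs_eta s n & hs_eta s @ \oo --> (0 : R)] &
      maj (tail r) (hs_eta s)].

(* The entries [e 0] and [e l] are replaced by [x 0], which is split off, and the
   remainder [e 0 + e l - x 0]; far partners [l] are preferred, since they make the
   largest entry decrease by at least [x 0 / 2]. *)
Definition eta_step (x e e' : R^nat) := exists l p,
  [/\ (0 < l)%N /\ (p < l)%N, e l <= x 0%N /\ (slack x e -> e l <= x 0%N / 2),
      forall j, (0 < j <= p)%N -> e 0%N + e l - x 0%N <= e j,
      e p.+1 <= e 0%N + e l - x 0%N &
      e' = reinsert p l (e 0%N + e l - x 0%N) e].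

Definition horn_step (r : nat) (s s' : horn_state) :=
  [/\ hs_space s (hs_vec s'), nsq (hs_vec s') = 1, q (hs_vec s') = xi r,
      hs_space s' = [set x | hs_space s x /\ ip x (hs_vec s') = 0] &
      eta_step (tail r) (hs_eta s) (hs_eta s')].

Lemma sum_delta_mul (F : nat -> R) k N : (k < N)%N ->
  \sum_(j < N) F j * (j == k :> nat)%:R = F k.
Proof.
move=> kN; rewrite (bigD1 (Ordinal kN)) //= eqxx mulr1 big1 ?addr0 // => j.
by rewrite -val_eqE /= => /negbTE ->; rewrite mulr0.
Qed.

Lemma exists_horn_step r s : horn_inv r s ->
  exists s', horn_inv r.+1 s' /\ horn_step r s s'.
Proof.
case: s => u0 W g e [/= og [Wg Wlin] hq [ne e0 e_cvg] me].
have nx : noninc (tail r) by move=> m n mn; apply: ni_xi; rewrite leq_add2l.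
have x0 : 0 < tail r 0%N by rewrite xi0.
have [l [l0 lx sl lfar]] : exists l, [/\ (0 < l)%N, e l <= tail r 0%N,
    forall n, (0 < n < l)%N -> slack_at (tail r) e n &
    slack (tail r) e -> e l <= tail r 0%N / 2].
  (* If [slack] holds, [l] may be as far out as desired. Otherwise the near partner is taken, and
     the last requirement is vacuous. *)
  have [far|nfar] := pselect (slack (tail r) e).
    have [l l0 hl] := exists_far e_cvg (divr_gt0 x0 (ltr0n _ 2)).
    exists l; split=> //; first by apply: le_trans hl _; lra.
    by move=> n /andP[n0 _]; exact: far.
  by have [l [l0 hl sl]] := exists_near e_cvg x0 me; exists l.
have xe : tail r 0%N <= e 0%N := step_xi0 me.
pose a := e 0%N + e l - tail r 0%N.
have [p [pl pa pa']] : exists p, [/\ (p < l)%N,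
    forall j, (0 < j <= p)%N -> a <= e j & e p.+1 <= a].
  by apply: exists_insertion_place => //; rewrite /a; lra.
have [c [t [ct1 cte]]] := mixing_weights lx xe.
pose u := (c%:C)%C *: g 0%N + (t%:C)%C *: g l.
(* As [g 0] and [g l] diagonalize [q] on their span, [u'] carries the complementary value
   [t ^+ 2 * e 0 + c ^+ 2 * e l = a]. *)
pose u' := ((- t)%:C)%C *: g 0%N + (c%:C)%C *: g l.
have n0l : (0 == l)%N = false by lia.
have ug j : ip u (g j) = ((c * (j == 0%N)%:R + t * (j == l)%:R)%:C)%C.
  rewrite ipDl !ipZl !og [in RHS]rmorphD !rmorphM /= !rmorph_nat.
  by rewrite ![_ == j]eq_sym.
have u'g j : ip u' (g j) = ((- t * (j == 0%N)%:R + c * (j == l)%:R)%:C)%C.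
  rewrite ipDl !ipZl !og [in RHS]rmorphD !rmorphM /= !rmorph_nat.
  by rewrite ![_ == j]eq_sym.
have nu : nsq u = 1.
  rewrite /sqnorm [ip u (u)]ipDr !ipZr !conj_real !ug eqxx n0l [l == _]eq_sym n0l.
  by rewrite eqxx -[RHS]ct1 /=; ring.
have nu' : nsq u' = 1.
  rewrite /sqnorm [ip u' (u')]ipDr !ipZr !conj_real !u'g eqxx n0l [l == _]eq_sym n0l.
  by rewrite eqxx -[RHS]ct1 /=; ring.
have u'u : ip u' u = 0.
  rewrite [ip u' u]ipDr !ipZr !conj_real !u'g eqxx n0l [l == _]eq_sym n0l eqxx.
  by rewrite -!rmorphM -rmorphD /= (_ : _ + _ = 0) //; ring.
have gu j : j != 0%N -> j != l -> ip (g j) u = 0.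
  move=> /negbTE j0 /negbTE jl; rewrite ipC ug j0 jl !mulr0 addr0; exact: rmorph0.
have W0 : W 0 by have := Wlin (-1) _ _ (Wg 0%N) (Wg 0%N); rewrite scaleN1r addNr.
have Wcomb a1 a2 : W (a1 *: g 0%N + a2 *: g l).
  by apply: (Wlin) => //; rewrite -[_ *: _]addr0; exact: Wlin.
have Wu : W u by exact: Wcomb.
have Wu' : W u' by exact: Wcomb.
exists (HornState u [set x | W x /\ ip x u = 0] (reinsert p l u' g) (reinsert p l a e)).
have WR j : W (reinsert p l u' g j) /\ ip (reinsert p l u' g j) u = 0.
  have [[_ ->//]|[jp -> cj]] := reinsert_cases p l u' g j.
  by split; [exact: Wg | apply: gu; case: ifP; lia].
split.
  split=> /=.
  - apply: orthonormal_reinsert => // j /negbTE j0 /negbTE jl.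
    by rewrite u'g j0 jl !mulr0 addr0; exact: rmorph0.
  - split=> // b x y [Wx xu] [Wy yu]; split; first exact: Wlin.
    by rewrite ipDl ipZl xu yu mulr0 addr0.
  - move=> x [Wx xu]; have := hq x Wx; move=> /cvgn_realP h.
    apply/cvgn_realP => eps /h[N hN]; exists (maxn N l) => n.
    rewrite geq_max => /andP[Nn ln].
    (* The term at [u'] replaces the terms 0 and [l] of the old expansion. Once these three terms
       are seen to balance, the new sum of length [n >= l] is the old one of length [n.+1]. *)
    have -> : \sum_(j < n) reinsert p l a e j * csq (ip x (reinsert p l u' g j)) =
        \sum_(j < n) reinsert p l (a * csq (ip x u'))
           (fun j => e j * csq (ip x (g j))) j.
      by apply: eq_bigr => j _; rewrite /reinsert; do 3![case: ifP => _ //].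
    rewrite sum_reinsert_ge //.
    suff -> : a * csq (ip x u') = e 0%N * csq (ip x (g 0%N)) + e l * csq (ip x (g l)).
      set S := \sum_(i < n.+1) _.
      have -> : S - e 0%N * csq (ip x (g 0%N)) - e l * csq (ip x (g l)) +
        (e 0%N * csq (ip x (g 0%N)) + e l * csq (ip x (g l))) = S by ring.
      by apply: hN; rewrite leqW.
    move: xu; rewrite [ip x u]ipDr [ip x u']ipDr !ipZr !conj_real /a -cte.
    case: (ip x (g 0%N)) => x1 x2; case: (ip x (g l)) => y1 y2 [].
    rewrite !mul0r !subr0 !addr0 => h1 h2.
    rewrite /csq /= !mul0r !subr0 !addr0.
    (* Orthogonality to [u] makes the coordinates of [x] at [g 0], [g l] a multiple of (-t, c). It
       is solved for real and imaginary parts separately. *)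
    have solve r1 r2 : c * r1 + t * r2 = 0 ->
        exists z, [/\ - t * r1 + c * r2 = z, r1 = - t * z & r2 = c * z].
      move=> hc; have h' : t * r2 = - (c * r1) by apply/eqP; rewrite -addr_eq0 addrC hc.
      have h'' : c * r1 = - (t * r2) by rewrite h' opprK.
      exists (- t * r1 + c * r2); split=> //.
        have -> : - t * (- t * r1 + c * r2) = t ^+ 2 * r1 - c * (t * r2) by ring.
        by rewrite h' -[LHS]mul1r -ct1; ring.
      have -> : c * (- t * r1 + c * r2) = c ^+ 2 * r2 - t * (c * r1) by ring.
      by rewrite h'' -[LHS]mul1r -ct1; ring.
    have -> : e 0%N + e l - (c ^+ 2 * e 0%N + t ^+ 2 * e l) =
        t ^+ 2 * e 0%N + c ^+ 2 * e l.
      have -> : c ^+ 2 = 1 - t ^+ 2 by rewrite -ct1 addrK.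
      by ring.
    have [z1 [-> -> ->]] := solve _ _ h1; have [z2 [-> -> ->]] := solve _ _ h2.
    by ring.
  - split; first exact: step_noninc.
      by move=> n; exact: step_ge0.
    exact: step_cvg0.
  - have := step_maj (xi := tail r) nx ne e0 me l0 lx pl pa pa' sl.
    rewrite (_ : (fun n => tail r n.+1) = tail r.+1) //.
    by apply/funext => n; rewrite addSnnS.
split=> //=; last by exists l, p.
apply: (cvg_unique _ (hq _ Wu)) => //.
apply/cvgn_realP => eps eps0; exists l.+1 => n ln.
suff -> : \sum_(j < n) e j * csq (ip u (g j)) = xi r by rewrite subrr normr0.
rewrite (eq_bigr (fun j : 'I_n => c ^+ 2 * e j * (j == 0 :> nat)%N%:R +
  t ^+ 2 * e j * (j == l :> nat)%N%:R)); last first.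
  move=> j _; rewrite ug csq_real; have : ~~ ((j == 0 :> nat)%N && (j == l :> nat)).
    by apply/negP => /andP[/eqP -> /eqP h]; rewrite -h in l0.
  by case: (j == 0 :> nat)%N; case: (j == l :> nat) => //= _;
    rewrite ?mulr0n ?mulr1n; ring.
rewrite big_split /= !(sum_delta_mul (fun j => _ * e j)) //; last by lia.
by rewrite cte addn0.
Qed.

End Algorithm.
End Horn.

(** * The Schur-Horn theorem *)

Section HornTheorem.
Context {R : realType} {H : completeNormedModType R[i]}.
Variable ip : {dot H for (@Num.conj R[i])}.
Local Notation nsq := (sqnorm ip).
Local Notation orthonormal_seq := (orthonormal_sequence ip).

Lemma normalize (w : H) : w != 0 ->
  exists2 a : R[i], a != 0 & nsq (a *: w) = 1.
Proof.
move=> w0; have n0 : 0 < nsq w.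
  by rewrite lt_def nsq_ge0 andbT; apply: contra w0 => /eqP/nsq_eq0 ->.
exists (((Num.sqrt (nsq w))^-1)%:C)%C.
  by rewrite (inj_eq (@complexI R) _ 0) invr_eq0 gt_eqF // sqrtr_gt0.
by rewrite nsqZ csq_real exprVn sqr_sqrtr ?ltW // mulVf // gt_eqF.
Qed.

(* [q] is the quadratic form of a compact positive injective operator with
   eigenvectors [f] and eigenvalues [eta]. *)
Theorem schur_horn (q : H -> R) (f : nat -> H) (eta xi : R^nat) :
  orthonormal_seq f ->
  (forall x, (fun N => \sum_(j < N) eta j * csq (ip x (f j))) @ \oo --> q x) ->
  (forall x, x != 0 -> 0 < q x) ->
  noninc eta -> (forall n, 0 <= eta n) -> eta @ \oo --> (0 : R) ->
  noninc xi -> (forall n, 0 < xi n) -> xi @ \oo --> (0 : R) ->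
  maj xi eta ->
  (forall (eps : R) N, 0 < eps -> exists2 n, (N <= n)%N &
     \sum_(i < n) eta i - \sum_(i < n) xi i < eps) \/
  (forall C : R, exists n, C < \sum_(i < n) xi i) ->
  exists u : nat -> H, [/\ orthonormal_seq u, forall k, q (u k) = xi k &
    forall w, (forall k, ip w (u k) = 0) -> w = 0].
Proof.
move=> of_ hq q0 ne e0 e_cvg nx x0 x_cvg me alt.
have inv0 : horn_inv ip q xi 0 (HornState 0 setT f eta).
  by split=> //=; split.
have [F [F0 hF]] := dependent_choice_inv inv0 (exists_horn_step x0 nx).
(* The initial state carries a dummy vector 0; step [k] stores its vector in state [k.+1]. *)
pose u k := hs_vec (F k.+1).
have inv r : horn_inv ip q xi r (F r) by have [] := hF r.
have step r : horn_step ip q xi r (F r) (F r.+1) by have [] := hF r.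
have spaceS r x : hs_space (F r.+1) x <-> hs_space (F r) x /\ ip x (u r) = 0.
  by have [_ _ _ -> _] := step r.
have mono r k x : hs_space (F (r + k)%N) x -> hs_space (F r) x.
  elim: k => [|k IH]; first by rewrite addn0.
  by rewrite addnS => /spaceS[/IH].
have Wu r k : hs_space (F r) (u (r + k)%N).
  by apply: (mono r k); have [] := step (r + k)%N.
have uu r k : ip (u (r + k.+1)%N) (u r) = 0.
  by have := Wu r.+1 k; rewrite addSnnS => /spaceS[].
have nu k : nsq (u k) = 1 by have [_ + _ _ _] := step k.
have qu k : q (u k) = xi k by have [_ _ + _ _] := step k.
have ou : orthonormal_seq u.
  move=> i j; case: (ltngtP i j) => [ij|ji|->]; last by rewrite ipxx nu.
    rewrite ipC -(subnKC ij) addSnnS uu; exact: rmorph0.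
  by rewrite -(subnKC ji) addSnnS uu.
exists u; split=> // w0 w0u; apply/eqP/negPn/negP => /[dup] w0n /normalize[b b0 nw].
set w := b *: w0 in nw.
have wu k : ip w (u k) = 0 by rewrite ipZl w0u mulr0.
have qw : 0 < q w by apply: q0; rewrite scaler_eq0 negb_or b0.
have Ww r : hs_space (F r) w by elim: r => [|r IH]; [rewrite F0|apply/spaceS].
(* Ky Fan's inequality for [w] together with the next [n] vectors. *)
have gap r n : \sum_(i < n) xi (r + i)%N + q w <= \sum_(i < n.+1) hs_eta (F r) i.
  have [og _ hq' [ne' e0' _] _] := inv r.
  pose x k := if k is k'.+1 then u (r + k')%N else w.
  have ox : orthonormal_seq x.
    move=> [|i] [|j] //=; first by rewrite ipxx nw.
    - by rewrite ipC wu rmorph0.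
    - by rewrite ou eqn_add2l.
  have -> : \sum_(i < n) xi (r + i)%N + q w = \sum_(k < n.+1) q (x k).
    rewrite big_ord_recl addrC; congr (_ + _); apply: eq_bigr => i _.
    by rewrite /= qu.
  apply: (@kyfan _ _ _ q _ _ _ og ne' e0' hq' x n.+1).
  - by case=> [|k] //=.
  - by case=> [|k] /=; rewrite ?nw ?nu.
  - move=> j m; rewrite -(onsq1 og j).
    apply: le_trans (bessel ox (hs_frame (F r) j) m).
    by apply: ler_sum => k _; rewrite ipC csqJ.
case: alt => [lim0|div].
  (* The gap at length [n] forces [q w] below the deficit of the majorization plus [eta n]; each of
     the two is made at most a third of [q w]. *)
  have q3 : 0 < q w / 3 by lra.
  have [N hN] := null_seq_le e_cvg q3.
  have [n /hN Nn hn] := lim0 _ N q3.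
  by have := gap 0%N n; rewrite F0 /= big_ord_recr /=; lra.
(* From [r0] on, [xi <= q w / 2], so [gap_slack] makes every step far. The gap at length 0 keeps the
   top eigenvalue at least [q w], so the remainder is at least [q w / 2], above the threshold
   [q w / 3] that bounds entry [M]; this is what [step_decr] asks for. *)
have q2 : 0 < q w / 2 by lra.
have [r0 hr0] := null_seq_le x_cvg q2.
have q3 : 0 < q w / 3 by lra.
have [M hM] : exists M, hs_eta (F r0) M <= q w / 3.
  have [_ _ _ [_ _ c0] _] := inv r0.
  by have [M hM] := null_seq_le c0 q3; exists M; apply: hM.
have main k : hs_eta (F (r0 + k)%N) M <= q w / 3 /\
  \sum_(i < M) hs_eta (F (r0 + k)%N) i + (\sum_(i < k) xi (r0 + i)%N) / 2 <=
  \sum_(i < M) hs_eta (F r0) i.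
  elim: k => [|k [IH1 IH2]]; first by rewrite addn0 big_ord0 mul0r addr0.
  rewrite addnS; set r := (r0 + k)%N in IH1 IH2 *.
  have [_ _ _ [ne' e0' _] me'] := inv r.
  have [_ _ _ _ [l [p [[l0 pl] [lx far] pa pa' ->]]]] := step r.
  have ntail : noninc (fun n => xi (r + n)%N).
    by move=> m n mn; apply: nx; rewrite leq_add2l.
  have xr : xi (r + 0)%N <= q w / 2 by apply: hr0; rewrite addn0 leq_addr.
  have {}far := far (gap_slack ntail ne' (gap r) xr).
  have g0 := gap r 0%N; rewrite big_ord0 add0r big_ord1 /= in g0.
  have el := e0' l.
  split; first by apply: le_trans IH1; exact: (step_le (xi := fun n => xi (r + n)%N) ne' lx pa).
  have Ma : hs_eta (F r) M < hs_eta (F r) 0%N + hs_eta (F r) l - xi (r + 0)%N.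
    by apply: le_lt_trans IH1 _; lra.
  have h := step_decr (xi := fun n => xi (r + n)%N) ne' me' lx pl pa Ma.
  apply: le_trans IH2; rewrite big_ord_recr /= -/r mulrDl.
  rewrite addn0 in far h *; apply: le_trans (lerD h (lexx _)) _; lra.
have [n hn] := div (\sum_(i < r0) xi i + 2 * \sum_(i < M) hs_eta (F r0) i).
have [_ h] := main n.
have hpos : 0 <= \sum_(i < M) hs_eta (F (r0 + n)%N) i.
  by apply: sumr_ge0 => i _; have [_ _ _ [_ + _] _] := inv (r0 + n)%N.
have : \sum_(i < n) xi i <= \sum_(i < r0) xi i + \sum_(i < n) xi (r0 + i)%N.
  apply: (@le_trans _ _ (\sum_(i < r0 + n) xi i)).
    rewrite -!(big_mkord xpredT xi) [leRHS](@big_cat_nat _ _ _ n) ?leq_addl //=.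
    by rewrite lerDl sumr_ge0 // => i _; exact: ltW.
  by rewrite big_split_ord.
lra.
Qed.

End HornTheorem.

(** * Adjoints, projections and positive operators *)

Section Operators.
Context {R : realType} {H : completeNormedModType R[i]}.
Variable ip : {dot H for (@Num.conj R[i])}.
Hypothesis hH : hilbert_norm ip.
Local Notation nsq := (sqnorm ip).
Local Notation orthonormal_seq := (orthonormal_sequence ip).
Implicit Types (x y z w : H).

Lemma ip_inj y z : (forall x, ip x y = ip x z) -> y = z.
Proof.
move=> h; apply/eqP; rewrite -subr_eq0; apply/eqP/(nsq_eq0 (ip := ip)).
by rewrite /sqnorm ipBr h subrr.
Qed.

Lemma adjointE (T : H -> H) y z : (forall x, ip (T x) y = ip x z) ->
  adjoint ip T y = z.
Proof.
move=> h; rewrite /adjoint; case: xgetP => [z' _ /= h'|/(_ z)//].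
by apply: ip_inj => x; rewrite -h -h'.
Qed.

(** The difference of two candidates is also the difference of their residuals, hence orthogonal to
    both candidates and to itself. So uniqueness holds for an arbitrary set [M]. *)
Lemma orthprojE (M : set H) x y : M y -> (forall z, M z -> ip (x - y) z = 0) ->
  orthproj ip M x = y.
Proof.
move=> My hy; rewrite /orthproj; case: xgetP => [y' _ [My' hy']|/(_ y)[]//].
apply/eqP; rewrite -subr_eq0; apply/eqP/(nsq_eq0 (ip := ip)).
have e : y' - y = (x - y) - (x - y') by rewrite opprB [RHS]addrC subrKA.
rewrite /sqnorm {1}e ipBl !ipBr; move: hy hy'.
rewrite /= => hy hy'; rewrite (hy _ My) (hy _ My') (hy' _ My) (hy' _ My').
by rewrite !subr0.
Qed.

Lemma ortho_closure (M : set H) x : (forall z, M z -> ip x z = 0) ->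
  forall z, closure M z -> ip x z = 0.
Proof.
move=> h z /(closure_nsqP hH) hz; apply: csq_eq0; apply/eqP.
rewrite eq_le csq_ge0 andbT; apply/ler_addgt0Pl => eps e0; rewrite addr0.
have n1 : 0 < nsq x + 1 by rewrite ltr_wpDl ?nsq_ge0.
have [y My hy] := hz _ (divr_gt0 e0 n1).
rewrite -[ip x z]subr0 -(h _ My) -ipBr; apply: le_trans (nsq_cs _ _ _) _.
rewrite ltr_pdivlMr // in hy; apply/ltW/(le_lt_trans _ hy).
by rewrite mulrC ler_wpM2l ?nsq_ge0 // lerDl.
Qed.

Section Basis.
Variable e : nat -> H.
Hypothesis he : orthonormal_basis ip e.

Let oe : orthonormal_seq e := he.1.

Lemma basis_total w : (forall k, ip w (e k) = 0) -> w = 0.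
Proof.
move=> h; apply: (cvg_uniq (he.2 w)); apply: (cvg_cst_seq hH (N := 0)) => n _.
by rewrite big1 // => i _; rewrite h scale0r.
Qed.

Lemma basis_inj x y : (forall k, ip x (e k) = ip y (e k)) -> x = y.
Proof.
move=> h; apply/eqP; rewrite -subr_eq0; apply/eqP/basis_total => k.
by rewrite ipBl h subrr.
Qed.

Lemma parseval x : (fun n => \sum_(k < n) csq (ip x (e k))) @ \oo --> nsq x.
Proof.
have -> : (fun n => \sum_(k < n) csq (ip x (e k))) =
    (fun n => nsq (\sum_(k < n) ip x (e k) *: e k)).
  by apply/funext => n; rewrite (nsq_onsum oe (fun k => ip x (e k))).
by apply: cvg_nsq => //; exact: he.2.
Qed.

(** The adjoint vector is built from its coefficients <y, T e_k>. If [S] is a partial sum of their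
    squared moduli, then [S] = <y, T z_n> for the partial vector z_n, whence
    [S ^+ 2 <= nsq y * (C * S)] and [S] stays bounded. *)
Lemma adjointP (T : H -> H) : bounded_op T ->
  forall x y, ip (T x) y = ip x (adjoint ip T y).
Proof.
move=> [linT cT] x y.
have [C C0 hC] := continuous_nsq_bounded hH linT cT.
pose a k := ip y (T (e k)).
have [z hz] : exists z, (fun n => \sum_(k < n) a k *: e k) @ \oo --> z.
  apply: (riesz_fischer hH oe (M := C * nsq y)) => n.
  pose zn := \sum_(k < n) a k *: e k; pose S := \sum_(k < n) csq (a k).
  have nz : nsq zn = S by exact: (nsq_onsum oe a).
  have ty : ip y (T zn) = (S%:C)%C.
    rewrite lin_sum // ip_sumr rmorph_sum /=; apply: eq_bigr => i _.
    by rewrite linZ // ipZr mulrC mul_conj.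
  have := nsq_cs ip y (T zn); rewrite ty csq_real.
  have := hC zn; rewrite nz -/S => h1 h2.
  have S0 : 0 <= S by rewrite -nz nsq_ge0.
  have [->|Sn] := eqVneq S 0; first by rewrite mulr_ge0 ?nsq_ge0 // ltW.
  have Sp : 0 < S by rewrite lt_def Sn.
  rewrite -(ler_pM2r Sp) -expr2; apply: le_trans h2 _.
  by rewrite mulrC mulrAC ler_wpM2r ?nsq_ge0 // .
have hz' k : ip z (e k) = a k.
  apply: (ip_lim_eq hH (N := k.+1) hz) => n kn.
  by rewrite (ip_onsum oe a) kn.
suff : exists z, forall x, ip (T x) y = ip x z.
  by move=> [w hw]; rewrite (adjointE hw).
exists z => {}x.
have h1 := bounded_cvg cT (he.2 x).
have h2 k : ip (T (e k)) y = ip (e k) z by rewrite ipC -/(a k) -hz' -ipC.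
have h3 n : ip (\sum_(k < n) ip x (e k) *: e k) z =
    ip (T (\sum_(k < n) ip x (e k) *: e k)) y.
  by rewrite lin_sum // !ip_suml; apply: eq_bigr => i _; rewrite linZ // !ipZl h2.
apply/eqP; rewrite -subr_eq0; apply/eqP/csq_eq0/eqP.
rewrite eq_le csq_ge0 andbT; apply/ler_addgt0Pl => eps e0; rewrite addr0.
have e4 : 0 < eps / 4 by lra.
have [N1 hN1] := ip_lim hH y h1 e4; have [N2 hN2] := ip_lim hH z (he.2 x) e4.
have := hN1 (maxn N1 N2) (leq_maxl _ _); have := hN2 (maxn N1 N2) (leq_maxr _ _).
rewrite /= h3; set p := ip (T _) y; set r := ip x z; set t := ip (T x) y.
move=> g1 g2; have -> : t - r = (p - r) + (-1) * (p - t) by ring.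
apply: le_trans (csqD_le _ _) _; rewrite csqM.
have -> : csq (-1 : R[i]) = 1 by rewrite /csq /= oppr0 expr0n addr0 sqrrN expr1n.
by rewrite mul1r mulr2n; lra.
Qed.

End Basis.

(** * Positive operators and their quadratic forms *)

Section Positive.
Variable A : H -> H.
Hypothesis pA : positive_op ip A.

Definition qform (T : H -> H) x : R := complex.Re (ip (T x) x).

Let linA : linear A := pA.1.1.

Lemma qformE x : ip (A x) x = ((qform A x)%:C)%C.
Proof. by have [a a0 h] := (ge0_complexP _).1 (pA.2 x); rewrite /qform h. Qed.

Lemma qform_ge0 x : 0 <= qform A x.
Proof. by have := pA.2 x; rewrite qformE ler0c. Qed.

(** Polarization: the imaginary part of <A z, z> vanishes at x + y and at x + iy. *)
Lemma positive_selfadj x y : ip (A x) y = ip x (A y).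
Proof.
have im z : complex.Im (ip (A z) z) = 0 by rewrite qformE.
have h1 := im (x + y); have h2 := im (x + 'i%C *: y).
have hx := im x; have hy := im y.
move: h1 h2; rewrite !(linD linA) !(linZ linA) !ipDl !ipDr !ipZl !ipZr.
rewrite [ip x (A y)]ipC; move: hx hy.
case: (ip (A x) x) => a a'; case: (ip (A y) y) => b b'.
case: (ip (A x) y) => c c'; case: (ip (A y) x) => d d' /= -> ->.
by move=> h1 h2; congr (_ +i* _)%C; lra.
Qed.

Lemma adjoint_positive : adjoint ip A = A.
Proof. by apply/funext => y; apply: adjointE => x; exact: positive_selfadj. Qed.

Lemma qformD x y : qform A (x + y) =
  qform A x + qform A y + complex.Re (ip (A x) y) *+ 2.
Proof.
rewrite /qform (linD linA) !ipDl !ipDr !ReD.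
by rewrite [ip (A y) x]positive_selfadj [ip y (A x)]ipC ReJ; ring.
Qed.

Lemma qformZ (a : R[i]) x : qform A (a *: x) = csq a * qform A x.
Proof.
by rewrite /qform (linZ linA) ipZl ipZr mulrA mul_conj ReZ.
Qed.

Lemma positive_cs x y : csq (ip (A x) y) <= qform A x * qform A y.
Proof.
have [->|h] := eqVneq (csq (ip (A x) y)) 0; first by rewrite mulr_ge0 ?qform_ge0.
have h0 : 0 < csq (ip (A x) y) by rewrite lt_neqAle eq_sym h csq_ge0.
pose a := ip (A x) y.
have : (csq a) ^+ 2 <= qform A x * (csq a * qform A y).
  apply: discriminant_le => [|t]; first by rewrite mulr_ge0 ?csq_ge0 ?qform_ge0.
  have := qform_ge0 (x + ((t%:C)%C * a) *: y).
  rewrite qformD qformZ csqM csq_real ipZr rmorphM /= conj_real -/a.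
  have -> : (t%:C)%C * Num.conj a * a = (t%:C)%C * (a * Num.conj a) by ring.
  by rewrite mul_conj ReZ /= !mulr2n; lra.
by rewrite expr2 mulrCA ler_pM2l.
Qed.

(** Cauchy-Schwarz for the form of [A] at the pair [x], [A x]. It does the work usually done by the
    square root of [A]. *)
Lemma nsq_positive_le x : nsq (A x) ^+ 2 <= qform A x * qform A (A x).
Proof. by rewrite -csq_real -ipxx; exact: positive_cs. Qed.

Lemma qform_eq0 x : qform A x = 0 -> A x = 0.
Proof.
move=> h; apply: (nsq_eq0 (ip := ip)); apply/eqP.
rewrite -sqrf_eq0 eq_le sqr_ge0 andbT.
by have := nsq_positive_le x; rewrite h mul0r.
Qed.

End Positive.
End Operators.

(** * Compact operators: a top eigenvector *)

Lemma exists_left_kernel (F : fieldType) (m n : nat) (M : 'M[F]_(m, n)) :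
  (n < m)%N -> exists2 c : 'rV[F]_m, c != 0 & c *m M = 0.
Proof.
move=> nm; have k0 : kermx M != 0.
  rewrite -mxrank_eq0 mxrank_ker; have := rank_leq_col M; lia.
by have /rowV0Pn[c /sub_kermxP cM c0] := k0; exists c.
Qed.

Lemma inv_succ_small (R : realType) (eps : R) : 0 < eps ->
  exists N, forall n, (N <= n)%N -> (n.+1%:R)^-1 <= eps.
Proof. exact: (null_seq_le (@cvg_harmonic R)). Qed.

Section Spectral.
Context {R : realType} {H : completeNormedModType R[i]}.
Variable ip : {dot H for (@Num.conj R[i])}.
Hypothesis hH : hilbert_norm ip.
Local Notation nsq := (sqnorm ip).
Local Notation orthonormal_seq := (orthonormal_sequence ip).
Implicit Types (x y z w : H).

(** A cluster point that is approached arbitrarily late stands in for a convergent subsequence. *)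
Lemma compact_op_cluster (T : H -> H) (y : nat -> H) : compact_op T ->
  (forall n, nsq (y n) <= 1) ->
  exists z, forall (eps : R) N, 0 < eps ->
    exists2 n, (N <= n)%N & nsq (z - T (y n)) < eps.
Proof.
move=> [_ [K sK [cK _]]] hy.
have FK : ((T \o y) @ \oo) K.
  by exists 0%N => // n _; apply: sK; exists (y n) => //=; rewrite (norm_le1 hH).
have [z [_ cz]] := cK ((T \o y) @ \oo) _ FK.
exists z => eps N e0.
have FN : ((T \o y) @ \oo) ((T \o y) @` [set n | (N <= n)%N]).
  by exists N => // n /= Nn; exists n.
by have [_ [[n /= Nn <-] hn]] := cz _ _ FN (nbhs_nsq hH z e0); exists n.
Qed.

(** Two orthogonal images with squared norms at least [eps] are at squared distance at least
    [2 * eps], so infinitely many of them cannot cluster. *)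
Lemma compact_eigenvalues_cvg0 (T : H -> H) (g : nat -> H) (c : nat -> R[i]) :
  compact_op T -> orthonormal_seq g -> (forall n, T (g n) = c n *: g n) ->
  forall eps : R, 0 < eps -> exists N, forall n, (N <= n)%N -> csq (c n) < eps.
Proof.
move=> cT og hg eps e0; apply/not_existsP => hN.
have h N : exists n, (N <= n)%N /\ eps <= csq (c n).
  have /existsNP[n /not_implyP[Nn /negP]] := hN N.
  by rewrite -leNgt => h; exists n.
have [phi hphi] := choice h.
have [|z hz] := compact_op_cluster (y := g \o phi) cT.
  by move=> n; rewrite (onsq1 og).
have e4 : 0 < eps / 4 by lra.
have [n1 _ h1] := hz _ 0%N e4; have [n2 hn2 h2] := hz _ (phi n1).+1 e4.
have ne : (phi n1 == phi n2) = false.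
  by have := (hphi n2).1 => h3; apply/negbTE; lia.
have : nsq (T (g (phi n2)) - T (g (phi n1))) <
    2 * eps.
  have -> : T (g (phi n2)) - T (g (phi n1)) =
    (z - T (g (phi n1))) - (z - T (g (phi n2))) by rewrite opprB [RHS]addrC subrKA.
  by apply: le_lt_trans (nsqB_le _ _ _) _; rewrite mulr2n; move: h1 h2 => /=; lra.
rewrite nsqB !hg !nsqZ !(onsq1 og) ipZl ipZr og eq_sym ne !mulr0 /=.
have := (hphi n1).2; have := (hphi n2).2; rewrite mul0rn; lra.
Qed.

Section TopEigenvector.
Variables (A : H -> H) (W : set H).
Hypothesis (cA : compact_op A) (pA : positive_op ip A).
Hypothesis WZ : forall a x, W x -> W (a *: x).
Hypothesis WA : forall x, W x -> W (A x).
Hypothesis Wlim : forall u x, (forall n, W (u n)) -> u @ \oo --> x -> W x.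
Hypothesis Wn0 : exists2 x, W x & x != 0.

Local Notation q := (qform ip A).

(** Let [l] be the supremum of [q] on the unit ball of [W]. Since [nsq (A v) <= l * q v], a
    near-maximizer [v] has |A v - l v|^2 at most l (l - q v). By compactness [A v] approaches some
    [z] along suitable near-maximizers, so [v] tends to [z / l]. For [l = 0] this gives nothing, but
    then [A] vanishes on [W] and any unit vector serves. *)
Lemma top_eigenvector : exists x (l : R),
  [/\ W x, nsq x = 1, 0 <= l, A x = (l%:C)%C *: x &
      forall y, W y -> q y <= l * nsq y].
Proof.
have linA : linear A := pA.1.1.
have [C C0 hC] := continuous_nsq_bounded hH linA pA.1.2.
have qC y : nsq y <= 1 -> q y <= C + 1.
  move=> y1; have : q y ^+ 2 <= C.
    rewrite -csq_real -(qformE pA); apply: le_trans (nsq_cs _ _ _) _.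
    have := hC y; have := nsq_ge0 ip y; have := nsq_ge0 ip (A y); nra.
  by have := qform_ge0 pA y; nra.
pose S := [set q y | y in [set y | W y /\ nsq y <= 1]].
have [x0 Wx0 /(normalize ip)[b b0 nx0]] := Wn0.
have Sb : has_sup S.
  split; first by exists (q (b *: x0)), (b *: x0) => //; split; [exact: WZ|rewrite nx0].
  by exists (C + 1) => _ [y [_ y1] <-]; exact: qC.
set l := sup S.
have ql y : W y -> nsq y <= 1 -> q y <= l.
  by move=> Wy y1; apply: ub_le_sup; [case: Sb|exists y].
have l0 : 0 <= l.
  by apply: le_trans (qform_ge0 pA (b *: x0)) _; apply: ql; [exact: WZ|rewrite nx0].
have qn y : W y -> q y <= l * nsq y.
  move=> Wy; have [->|yn] := eqVneq y 0.
    by rewrite nsq0 mulr0 /qform (lin0 linA) ip0l.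
  have [a a0 na] := normalize ip yn.
  have ca : 0 < csq a.
    by rewrite lt_def csq_ge0 andbT; apply: contra a0 => /eqP/csq_eq0 ->.
  have := ql _ (WZ a Wy); rewrite na => /(_ (lexx _)).
  rewrite (qformZ pA) -[X in _ <= X]mulr1 -na nsqZ mulrCA.
  by rewrite ler_pM2l.
have [lz|ln] := eqVneq l 0.
  exists (b *: x0), l; split=> //; first exact: WZ.
  rewrite lz scale0r; apply: (qform_eq0 pA); apply/eqP.
  by rewrite eq_le (qform_ge0 pA) andbT -lz -[leRHS]mulr1 -nx0 qn //; exact: WZ.
have lp : 0 < l by rewrite lt_def ln.
have hs (n : nat) : exists y, [/\ W y, nsq y <= 1 & l - n.+1%:R^-1 < q y].
  have n1 : 0 < n.+1%:R^-1 :> R by rewrite invr_gt0.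
  by have [_ [y [Wy y1] <-] hy] := sup_adherent n1 Sb; exists y.
have [y hy] := choice hs.
have [|z hz] := compact_op_cluster (y := y) cA; first by move=> n; have [] := hy n.
have hv (m : nat) : exists v, [/\ W v, nsq v <= 1, l - m.+1%:R^-1 <= q v &
    nsq (z - A v) <= m.+1%:R^-1].
  have m1 : 0 < m.+1%:R^-1 :> R by rewrite invr_gt0.
  have [n mn hn] := hz _ m m1; have [Wy y1 qy] := hy n.
  exists (y n); split=> //; last exact: ltW.
  apply: le_trans (ltW qy); rewrite lerD2l lerN2.
  by rewrite lef_pV2 ?posrE // ler_nat.
have {y hy hz hs} [v hv'] := choice hv.
have Wv m : W (v m) by have [] := hv' m.
have vz m : nsq (z - (l%:C)%C *: v m) <= 2 * (1 + l) * m.+1%:R^-1.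
  have [_ v1 qv zv] := hv' m.
  have m1 : 0 < m.+1%:R^-1 :> R by rewrite invr_gt0.
  set d := m.+1%:R^-1 in qv zv m1 *.
  have h1 : nsq (A (v m)) <= l * q (v m).
    have [->|An] := eqVneq (nsq (A (v m))) 0; first by rewrite mulr_ge0 ?qform_ge0.
    have Ap : 0 < nsq (A (v m)) by rewrite lt_def An nsq_ge0.
    rewrite -(ler_pM2r Ap) -expr2; apply: le_trans (nsq_positive_le pA _) _.
    rewrite [l * _]mulrC -mulrA ler_wpM2l ?qform_ge0 //.
    by apply: qn; exact: WA.
  have h2 : nsq (A (v m) - (l%:C)%C *: v m) <= l * d.
    rewrite nsqB nsqZ csq_real ipZr conj_real (qformE pA) -rmorphM /= mulr2n.
    have : l ^+ 2 * nsq (v m) <= l ^+ 2 * 1 by rewrite ler_wpM2l ?sqr_ge0.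
    have : l * (l - d) <= l * q (v m) by rewrite ler_wpM2l.
    by rewrite mulrBr mulr1 -expr2; lra.
  have -> : z - (l%:C)%C *: v m = (z - A (v m)) + (A (v m) - (l%:C)%C *: v m).
    by rewrite subrKA.
  by apply: le_trans (nsqD_le _ _ _) _; rewrite mulr2n; lra.
pose x := ((l^-1)%:C)%C *: z.
have vx : v @ \oo --> x.
  apply/(cvg_seqP hH) => eps e0.
  have K0 : 0 < l ^- 2 * (2 * (1 + l)).
    by rewrite !mulr_gt0 ?invr_gt0 ?exprn_gt0 //; lra.
  have e2 : 0 < eps / 2 / (l ^- 2 * (2 * (1 + l))) by rewrite !divr_gt0.
  have [N hN] := inv_succ_small e2; exists N => n /hN.
  rewrite ler_pdivlMr // => h.
  have -> : x - v n = ((l^-1)%:C)%C *: (z - (l%:C)%C *: v n).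
    by rewrite scalerBr scalerA -rmorphM mulVf // scale1r.
  rewrite nsqZ csq_real exprVn.
  apply: (@le_lt_trans _ _ (eps / 2)); last by lra.
  by apply: le_trans h; rewrite [leRHS]mulrC -mulrA ler_wpM2l ?vz // invr_ge0 sqr_ge0.
have Avz : (A \o v) @ \oo --> z.
  apply/(cvg_seqP hH) => eps e0; have e2 : 0 < eps / 2 by lra.
  have [N hN] := inv_succ_small e2; exists N => n /hN h.
  have [_ _ _ h'] := hv' n.
  by apply: le_lt_trans h' _; apply: le_lt_trans h _; lra.
have Axz : A x = z by exact: (cvg_uniq (bounded_cvg pA.1.2 vx) Avz).
(* The lower bound comes from [l - m.+1%:R^-1 <= q (v m) <= l * nsq (v m)]. *)
have nx : nsq x = 1.
  apply/eqP; rewrite eq_le; apply/andP; split.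
    by apply: (cvgn_le (N := 0) (cvg_nsq hH vx)) => n _; have [] := hv' n.
  apply/ler_addgt0Pr => eps e0; rewrite -lerBlDr.
  have [N hN] := inv_succ_small (mulr_gt0 lp e0).
  apply: (cvgn_ge (N := N) (cvg_nsq hH vx)) => n /hN h.
  have [_ _ h' _] := hv' n; have := qn _ (Wv n) => h''.
  rewrite -(ler_pM2l lp) mulrBr mulr1; apply: le_trans h''; apply: le_trans h'.
  by rewrite lerD2l lerN2.
exists x, l; split=> //; first exact: Wlim vx.
by rewrite Axz /x scalerA -rmorphM mulfV // scale1r.
Qed.

End TopEigenvector.
End Spectral.

(** * The spectral theorem and range projections *)

Section SpectralTheorem.
Context {R : realType} {H : completeNormedModType R[i]}.
Variable ip : {dot H for (@Num.conj R[i])}.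
Hypothesis hH : hilbert_norm ip.
Local Notation nsq := (sqnorm ip).
Local Notation orthonormal_seq := (orthonormal_sequence ip).
Implicit Types (x y z w : H).

(** [n] linear conditions on the span of [n.+1] basis vectors; infinite dimension thus keeps the
    extraction of eigenvectors going forever. *)
Lemma exists_orthogonal (e g : nat -> H) n : orthonormal_seq e ->
  exists2 x, (forall k, (k < n)%N -> ip x (g k) = 0) & x != 0.
Proof.
move=> oe; pose M := \matrix_(i < n.+1, j < n) ip (e i) (g j).
have [c c0 cM] := exists_left_kernel M (ltnSn n).
pose a (i : nat) : R[i] := if insub i is Some j then c 0 j else 0.
have aE (i : 'I_n.+1) : a i = c 0 i by rewrite /a valK.
exists (\sum_(i < n.+1) a i *: e i) => [k kn|].
  rewrite ip_suml; have := congr1 (fun m : 'rV_n => m 0 (Ordinal kn)) cM.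
  rewrite !mxE => h; rewrite -[RHS]h; apply: eq_bigr => i _.
  by rewrite ipZl aE mxE.
apply: contra c0 => /eqP h; apply/eqP/rowP => i; rewrite mxE -aE.
by have := ip_onsum oe a n.+1 i; rewrite h ip0l ltn_ord => <-.
Qed.

(** [f] may miss part of the kernel of [A], which an operator of infinite rank never lets it reach.
    The variational last clause takes the place of completeness. *)
Definition spectral (A : H -> H) (f : nat -> H) (s : R^nat) :=
  [/\ orthonormal_seq f, noninc s /\ (forall n, 0 <= s n), s @ \oo --> (0 : R),
      (forall j, A (f j) = ((s j)%:C)%C *: f j) &
      forall n x, (forall k, (k < n)%N -> ip x (f k) = 0) ->
        qform ip A x <= s n * nsq x].

(** No order on [s] is imposed, so that [A] and the diagonal operators with unsorted entries share
    one computation of the range projection. *)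
Definition eigensystem (A : H -> H) (f : nat -> H) (s : R^nat) :=
  [/\ linear A, forall x y, ip (A x) y = ip x (A y), orthonormal_seq f,
      forall j, A (f j) = ((s j)%:C)%C *: f j &
      forall x, (forall j, s j != 0 -> ip x (f j) = 0) -> A x = 0].

Record spec_state := SpecState {
  ss_vec : H; ss_val : R; ss_space : set H }.

Theorem spectral_theorem (e : nat -> H) (A : H -> H) : orthonormal_seq e ->
  compact_positive ip A -> exists f s, spectral A f s.
Proof.
move=> oe [cA pA]; have linA : linear A := pA.1.1.
pose inv n (st : spec_state) := exists (g : nat -> H) (c : nat -> R),
  (forall k, (k < n)%N -> A (g k) = ((c k)%:C)%C *: g k) /\
  ss_space st = [set x | forall k, (k < n)%N -> ip x (g k) = 0].
pose step (n : nat) (st st' : spec_state) :=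
  [/\ ss_space st (ss_vec st'), nsq (ss_vec st') = 1, 0 <= ss_val st',
      A (ss_vec st') = ((ss_val st')%:C)%C *: ss_vec st' &
      (forall y, ss_space st y -> qform ip A y <= ss_val st' * nsq y) /\
      ss_space st' = [set x | ss_space st x /\ ip x (ss_vec st') = 0]].
have inv0 : inv 0%N (SpecState 0 0 setT).
  exists (fun=> 0), (fun=> 0); split=> //=.
  by apply/seteqP; split.
have next n st : inv n st -> exists st', inv n.+1 st' /\ step n st st'.
  case: st => u0 l0' W [g [c [gc /= WE]]].
  have [||||x [l [Wx nx l0 Al ql]]] := @top_eigenvector _ _ ip hH A W cA pA.
  - by rewrite WE => a x hx k kn; rewrite ipZl hx // mulr0.
  - by rewrite WE => x hx k kn; rewrite (positive_selfadj pA) gc // ipZr hx // mulr0.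
  - rewrite WE => u x hu ux k kn; apply: (ip_lim_eq hH (N := 0) ux) => m _; exact: hu.
  - by rewrite WE; exact: exists_orthogonal oe.
  exists (SpecState x l [set y | W y /\ ip y x = 0]); split=> //=.
  exists (fun k => if k == n then x else g k), (fun k => if k == n then l else c k).
  split=> [k|]; first by case: eqP => // kn; rewrite ltnS leq_eqVlt => /predU1P[//|]; exact: gc.
  rewrite WE; apply/seteqP; split=> y /=.
    move=> [Wy yx] k; case: eqP => // kn; rewrite ltnS leq_eqVlt => /predU1P[//|]; exact: Wy.
  move=> h; split=> [k kn|]; last by have := h n (ltnSn n); rewrite eqxx.
  by have := h k (ltnW kn); rewrite (ltn_eqF kn).
have [F [F0 hF]] := dependent_choice_inv inv0 next.
pose f n := ss_vec (F n.+1); pose s n := ss_val (F n.+1).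
have spaceE n x : ss_space (F n) x <-> forall k, (k < n)%N -> ip x (f k) = 0.
  elim: n => [|n IH]; first by rewrite F0.
  have [_ [_ _ _ _ [_ ->]]] := hF n; split=> [[/IH hx xf] k|h].
    by rewrite ltnS leq_eqVlt => /predU1P[->//|]; exact: hx.
  by split; [apply/IH => k kn; apply: h; exact: ltnW|exact: h].
have of_ : orthonormal_seq f.
  have lt i j : (i < j)%N -> ip (f j) (f i) = 0.
    by move=> ij; have [_ [/spaceE + _ _ _ _]] := hF j; apply.
  move=> i j; case: (ltngtP i j) => [ij|ji|->].
  - by rewrite ipC lt // rmorph0.
  - by rewrite lt.
  - by have [_ [_ n1 _ _ _]] := hF j; rewrite ipxx /= n1.
have fs j : A (f j) = ((s j)%:C)%C *: f j by have [_ [_ _ _ ? _]] := hF j.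
have s0 n : 0 <= s n by have [_ [_ _ ? _ _]] := hF n.
have qs n x : (forall k, (k < n)%N -> ip x (f k) = 0) -> qform ip A x <= s n * nsq x.
  by move=> /spaceE hx; have [_ [_ _ _ _ [+ _]]] := hF n; apply.
have qf n : qform ip A (f n) = s n by rewrite /qform fs ipZl of_ eqxx mulr1.
exists f, s; split=> //; last first.
  apply/cvgn_realP => eps e0.
  have [N hN] := compact_eigenvalues_cvg0 hH cA of_ fs (exprn_gt0 2 e0).
  exists N => n /hN; rewrite csq_real sub0r normrN ger0_norm // => h.
  by rewrite -(ltr_pXn2r (n := 2)) ?nnegrE // ltW.
(* [f n] is a unit vector orthogonal to the first [m] eigenvectors, so it competes at stage [m]. *)
split=> // m n mn; rewrite -qf -[s m]mulr1 -(onsq1 of_ n); apply: qs => k km.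
by rewrite of_ gtn_eqF // (leq_trans km).
Qed.

Section Consequences.
Variables (A : H -> H) (f : nat -> H) (s : R^nat).
Hypothesis (pA : positive_op ip A) (spA : spectral A f s).
Local Notation q := (qform ip A).

Let of_ : orthonormal_seq f. Proof. by case: spA. Qed.
Let s0 n : 0 <= s n. Proof. by case: spA => _ []. Qed.
Let linA : linear A := pA.1.1.

Lemma ip_residual_eq0 x n k : (k < n)%N ->
  ip (x - \sum_(j < n) ip x (f j) *: f j) (f k) = 0.
Proof.
by move=> kn; rewrite ipBl (ip_onsum of_ (fun j => ip x (f j))) kn subrr.
Qed.

Lemma qform_decomp x n :
  q x = \sum_(j < n) s j * csq (ip x (f j)) + q (x - \sum_(j < n) ip x (f j) *: f j).
Proof.
have [_ _ _ fs _] := spA.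
set p := \sum_(j < n) ip x (f j) *: f j; set r := x - p.
have Ap : A p = \sum_(j < n) ((s j)%:C)%C * ip x (f j) *: f j.
  by rewrite lin_sum //; apply: eq_bigr => j _; rewrite linZ // fs scalerA mulrC.
have pr : ip (A p) r = 0.
  rewrite Ap ip_suml big1 // => j _.
  by rewrite ipZl [ip (f j) r]ipC (ip_residual_eq0 x (ltn_ord j)) rmorph0 mulr0.
have qp : q p = \sum_(j < n) s j * csq (ip x (f j)).
  rewrite /qform Ap ip_suml Re_sum; apply: eq_bigr => j _.
  rewrite ipZl [ip (f j) p]ipC (ip_onsum of_ (fun j => ip x (f j))) ltn_ord -mulrA ReZ.
  by rewrite mul_conj.
rewrite -qp -[in LHS](subrK p x) -/r addrC (qformD pA) pr /=.
by rewrite mul0rn addr0.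
Qed.

(** The error is [q] of the residual, at most [s n * nsq x] by the variational clause. *)
Lemma spectral_qform x :
  (fun N => \sum_(j < N) s j * csq (ip x (f j))) @ \oo --> q x.
Proof.
have [_ _ s_cvg _ qs] := spA.
apply/cvgn_realP => eps e0.
have n1 : 0 < nsq x + 1 by rewrite ltr_wpDl ?nsq_ge0.
have e2 : 0 < eps / 2 / (nsq x + 1) by rewrite !divr_gt0.
have [N hN] := null_seq_le s_cvg e2; exists N => n /hN hn.
rewrite (qform_decomp x n) [X in `|X|]addrAC subrr add0r ger0_norm ?qform_ge0 //.
apply: le_lt_trans (qs n _ _) _; first by move=> k; exact: ip_residual_eq0.
have h : nsq (x - \sum_(j < n) ip x (f j) *: f j) <= nsq x.
  rewrite nsq_residual // gerBl sumr_ge0 // => j _; exact: csq_ge0.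
move: hn; rewrite ler_pdivlMr // => hn.
have := s0 n; have := nsq_ge0 ip x; nra.
Qed.

Lemma spectral_kernel x : (forall j, s j != 0 -> ip x (f j) = 0) -> A x = 0.
Proof.
move=> h; apply: (qform_eq0 pA); apply/eqP.
rewrite eq_le (qform_ge0 pA) andbT.
apply: (cvgn_le (N := 0) (spectral_qform (x := x))) => n _.
rewrite big1 // => j _; have [->|/h ->] := eqVneq (s j) 0; first by rewrite mul0r.
by rewrite csq0 mulr0.
Qed.

Lemma spectral_apply x j : ip (A x) (f j) = ((s j)%:C)%C * ip x (f j).
Proof.
have [_ _ _ fs _] := spA.
by rewrite (positive_selfadj pA) fs ipZr conj_real.
Qed.

Lemma spectral_eigensystem : eigensystem A f s.
Proof.
have [_ _ _ fs _] := spA.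
by split=> //; [exact: positive_selfadj | exact: spectral_kernel].
Qed.

End Consequences.

(** * The range projection in an eigensystem *)

Section RangeProjection.
Variables (A : H -> H) (f : nat -> H) (s : R^nat).
Hypothesis es : eigensystem A f s.

Let linA : linear A. Proof. by case: es. Qed.
Let adjA x y : ip (A x) y = ip x (A y). Proof. by case: es. Qed.
Let of_ : orthonormal_seq f. Proof. by case: es. Qed.
Let fs j : A (f j) = ((s j)%:C)%C *: f j. Proof. by case: es. Qed.
Let kerA x : (forall j, s j != 0 -> ip x (f j) = 0) -> A x = 0.
Proof. by case: es => _ _ _ _; apply. Qed.

Definition in_range (j : nat) : R[i] := (s j != 0)%:R.

Definition range_series := tensor_series ip f f in_range.

Lemma in_range_le j : csq (in_range j) <= 1.
Proof.
rewrite /in_range; case: (s j != 0); last by rewrite csq0.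
by rewrite /csq /= expr0n addr0 expr1n.
Qed.

Lemma range_series_closure x : closure (range A) (range_series x).
Proof.
apply/(closure_nsqP hH) => eps e0.
have := (cvg_seqP hH _ _).1 (tensor_series_cvg hH of_ of_ in_range_le (x := x)).
move=> /(_ _ e0)[N hN]; exists (\sum_(k < N) (in_range k * ip x (f k)) *: f k); last exact: hN.
(* A preimage is found by dividing by the eigenvalues; where [s k = 0] the factor [in_range k]
   already kills the term. *)
exists (\sum_(k < N) (in_range k * ip x (f k) * (((s k)^-1)%:C)%C) *: f k) => //.
rewrite lin_sum //; apply: eq_bigr => k _; rewrite linZ // fs scalerA.
congr (_ *: _); rewrite /in_range; have [->|sk] := eqVneq (s k) 0.
  by rewrite /= !mul0r.
by rewrite -[LHS]mulrA -rmorphM mulVf // mulr1.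
Qed.

Lemma range_series_residual x : A (x - range_series x) = 0.
Proof.
apply: kerA => j sj; rewrite ipBl (ip_tensor_series hH of_ of_ in_range_le).
by rewrite /in_range sj mul1r subrr.
Qed.

Lemma range_projE x : range_proj ip A x = range_series x.
Proof.
apply: orthprojE; first exact: range_series_closure.
apply: (ortho_closure hH) => _ [y _ <-].
by rewrite -adjA range_series_residual ip0l.
Qed.

Lemma range_projK x : A (x - range_proj ip A x) = 0.
Proof. by rewrite range_projE range_series_residual. Qed.

Lemma range_proj_ortho x y : A y = 0 -> ip (range_proj ip A x) y = 0.
Proof.
move=> Ay; rewrite ipC.
rewrite (ortho_closure hH (M := range A) (x := y)) ?rmorph0 //.
  by move=> _ [z _ <-]; rewrite -adjA Ay ip0l.
by rewrite range_projE; exact: range_series_closure.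
Qed.

Lemma range_proj_id : range_proj ip A = id <-> (forall x, A x = 0 -> x = 0).
Proof.
split=> [h x Ax|h].
  apply: (nsq_eq0 (ip := ip)); rewrite /sqnorm -{1}[x](congr1 (fun g => g x) h).
  by rewrite range_proj_ortho.
apply/funext => x; have /h/eqP := range_projK x.
by rewrite subr_eq0 eq_sym => /eqP.
Qed.

End RangeProjection.
End SpectralTheorem.

(** * Traces and diagonal operators *)

Lemma nneseries_EFin (R : realType) (s : R^nat) (l : R) :
  (fun n => \sum_(k < n) s k) @ \oo --> l ->
  (\sum_(0 <= k <oo) (s k)%:E)%E = l%:E.
Proof.
move=> h; apply/cvg_lim => //.
have -> : (fun n => (\sum_(0 <= k < n) (s k)%:E)%E) =
    (fun n => (\sum_(k < n) s k)%:E).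
  by apply/funext => n; rewrite big_mkord sumEFin.
by apply: cvg_EFin; [exact: nearW | exact: h].
Qed.

Section Traces.
Context {R : realType} {H : completeNormedModType R[i]}.
Variable ip : {dot H for (@Num.conj R[i])}.
Hypothesis hH : hilbert_norm ip.
Local Notation nsq := (sqnorm ip).
Local Notation orthonormal_seq := (orthonormal_sequence ip).
Implicit Types (x y z w : H).

(** Tonelli on the double series of s_j |<v_k, f_j>|^2. Only Parseval's identity is asked of [v],
    since it is later the image of a basis under the adjoint of an isometry. *)
Lemma trace_frame (q : H -> R) (f v : nat -> H) (s : R^nat) :
  orthonormal_seq f -> (forall j, 0 <= s j) ->
  (forall x, (fun N => \sum_(j < N) s j * csq (ip x (f j))) @ \oo --> q x) ->
  (forall x, (fun N => \sum_(k < N) csq (ip x (v k))) @ \oo --> nsq x) ->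
  (\sum_(0 <= k <oo) (q (v k))%:E = \sum_(0 <= j <oo) (s j)%:E)%E.
Proof.
move=> of_ s0 hq hv.
rewrite (eq_eseriesr (g := fun k => (\sum_(j <oo) (s j * csq (ip (v k) (f j)))%:E)%E)); last first.
  by move=> k _; rewrite (nneseries_EFin (hq (v k))).
rewrite nneseries_interchange; last first.
  by move=> i j; rewrite lee_fin mulr_ge0 ?csq_ge0.
apply: eq_eseriesr => j _.
rewrite (nneseries_EFin (l := s j * nsq (f j))) ?(onsq1 of_) ?mulr1 //.
rewrite -[s j in X in _ --> X]mulr1 -(onsq1 of_ j).
have -> : (fun n => \sum_(k < n) s j * csq (ip (v k) (f j))) =
    (fun n => s j * \sum_(k < n) csq (ip (f j) (v k))).
  apply/funext => n; rewrite mulr_sumr; apply: eq_bigr => k _.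
  by rewrite ipC csqJ.
by apply: cvgM; [exact: cvg_cst | exact: hv].
Qed.

(** * Operators diagonal in the fixed basis *)

Section DiagonalOperators.
Variable e : nat -> H.
Hypothesis he : orthonormal_basis ip e.
Let oe : orthonormal_seq e := he.1.

Definition diag_op (d : R^nat) : H -> H :=
  tensor_series ip e e (fun k => ((d k)%:C)%C).

Lemma diag_expectationE (T : H -> H) (d : R^nat) :
  (forall k, ip (T (e k)) (e k) = ((d k)%:C)%C) ->
  diag_expectation ip e T = diag_op d.
Proof.
move=> h; rewrite /diag_op (_ : (fun k => ((d k)%:C)%C) = (fun k => ip (T (e k)) (e k))) //.
by apply/funext => k; rewrite h.
Qed.

Section Bounded.
Variables (d : R^nat) (C : R).
Hypothesis (d0 : forall k, 0 <= d k) (dC : forall k, d k <= C).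

Lemma csq_diag_le k : csq ((d k)%:C)%C <= C ^+ 2.
Proof. by rewrite csq_real ler_sqr ?nnegrE // (le_trans (d0 k)). Qed.

Lemma ip_diagonal x k : ip (diag_op d x) (e k) = ((d k)%:C)%C * ip x (e k).
Proof. exact: (ip_tensor_series hH oe oe csq_diag_le). Qed.

Lemma diagonal_linear : linear (diag_op d).
Proof. exact: (tensor_series_linear hH oe oe csq_diag_le). Qed.

Lemma diagonal_bounded : bounded_op (diag_op d).
Proof.
split; first exact: diagonal_linear.
apply: (nsq_bounded_continuous hH diagonal_linear (C := C ^+ 2)).
exact: (nsq_tensor_series hH oe oe csq_diag_le).
Qed.

Lemma diagonal_basis k : diag_op d (e k) = ((d k)%:C)%C *: e k.
Proof.
apply: (basis_inj hH he) => j; rewrite ip_diagonal ipZl oe.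
by case: eqP => [->|_] //; rewrite !mulr0.
Qed.

Lemma diagonal_diagonal_op : diagonal_op ip e (diag_op d).
Proof.
split; first exact: diagonal_bounded.
by move=> j k /negbTE jk; rewrite diagonal_basis ipZl oe jk mulr0.
Qed.

Lemma diagonal_selfadj x y : ip (diag_op d x) y = ip x (diag_op d y).
Proof.
rewrite (tensor_series_adj hH oe oe csq_diag_le) /diag_op.
by under [X in tensor_series _ _ _ X]eq_fun do rewrite conj_real.
Qed.

Lemma diagonal_eigensystem : eigensystem ip (diag_op d) e d.
Proof.
split; [exact: diagonal_linear|exact: diagonal_selfadj|exact: oe|exact: diagonal_basis|].
move=> x h; apply: (basis_total hH he) => k; rewrite ip_diagonal.
by have [->|/h ->] := eqVneq (d k) 0; rewrite ?mul0r ?mulr0.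
Qed.

Lemma diagonal_range_perp k :
  ip (range_proj_perp ip (diag_op d) (e k)) (e k) = (d k == 0)%:R.
Proof.
rewrite /range_proj_perp (range_projE hH diagonal_eigensystem) ipBl.
rewrite (ip_tensor_series hH oe oe (@in_range_le _ d)) oe eqxx mulr1 /in_range.
by case: eqP => _; rewrite ?subr0 ?subrr.
Qed.

Lemma diagonal_range_id : range_proj ip (diag_op d) = id <-> forall k, d k != 0.
Proof.
rewrite (range_proj_id hH diagonal_eigensystem); split=> [h k|h x].
  apply/eqP => dk; have /h : diag_op d (e k) = 0 by rewrite diagonal_basis dk scale0r.
  by move/(congr1 nsq); rewrite nsq0 (onsq1 oe) => /eqP; rewrite oner_eq0.
move=> Dx; apply: (basis_total hH he) => k; apply/eqP.
have /eqP := ip_diagonal x k; rewrite Dx ip0l eq_sym mulf_eq0.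
by rewrite (inj_eq (@complexI R) _ 0) (negbTE (h k)).
Qed.

End Bounded.

(** The diagonal operator is the square of the self-adjoint one with entries [Num.sqrt (d k)]. *)
Lemma diagonal_positive (d : R^nat) (C : R) : (forall k, 0 <= d k) ->
  (forall k, d k <= C) -> positive_op ip (diag_op d).
Proof.
move=> d0 dC; split; first exact: (diagonal_bounded d0 dC).
pose r k := Num.sqrt (d k).
have r0 k : 0 <= r k by exact: sqrtr_ge0.
have rC k : r k <= Num.sqrt C by rewrite ler_sqrt ?(le_trans (d0 k)).
have rr x : diag_op d x = diag_op r (diag_op r x).
  apply: (basis_inj hH he) => k; rewrite (ip_diagonal d0 dC) !(ip_diagonal r0 rC).
  by rewrite mulrA -rmorphM /= -expr2 sqr_sqrtr.
by move=> x; rewrite rr (diagonal_selfadj r0 rC) ip_ge0.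
Qed.

Lemma diagonal_inj (d d' : R^nat) (C : R) : (forall k, 0 <= d k) ->
  (forall k, d k <= C) -> (forall k, 0 <= d' k) -> (forall k, d' k <= C) ->
  diag_op d = diag_op d' -> d = d'.
Proof.
move=> d0 dC d0' dC' h; apply/funext => k.
have := congr1 (fun T : H -> H => ip (T (e k)) (e k)) h.
rewrite (ip_diagonal d0 dC) (ip_diagonal d0' dC') oe eqxx !mulr1.
exact: complexI.
Qed.

End DiagonalOperators.
End Traces.

(** * Unitary and partial isometry orbits *)

Lemma nneseries_le (R : realType) (u : nat -> \bar R) (b : \bar R) :
  (forall k, (0 <= u k)%E) ->
  (forall n, (\sum_(k < n) u k <= b)%E) -> (\sum_(0 <= k <oo) u k <= b)%E.
Proof.
move=> u0 h; apply: lime_le; first by apply: is_cvg_nneseries => k _ _.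
by apply: nearW => n; rewrite big_mkord.
Qed.

Section Orbits.
Context {R : realType} {H : completeNormedModType R[i]}.
Variable ip : {dot H for (@Num.conj R[i])}.
Hypothesis hH : hilbert_norm ip.
Local Notation nsq := (sqnorm ip).
Local Notation orthonormal_seq := (orthonormal_sequence ip).
Implicit Types (x y z w : H).
Variable e : nat -> H.
Hypothesis he : orthonormal_basis ip e.
Let oe : orthonormal_seq e := he.1.

Lemma csq1 : csq (1 : R[i]) = 1.
Proof. by rewrite /csq /= expr0n addr0 expr1n. Qed.

Section Isometries.
Variables u v : nat -> H.
Hypothesis (ou : orthonormal_seq u) (ov : orthonormal_seq v).

(** The partial isometry carrying [u k] to [v k], with initial space the closed span of [u]; it is
    unitary when both sequences are total. *)
Definition transport : H -> H := tensor_series ip u v (fun=> 1).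

Let c1 (k : nat) : csq (1 : R[i]) <= 1.
Proof. by rewrite csq1. Qed.

Lemma ip_transport x k : ip (transport x) (v k) = ip x (u k).
Proof. by rewrite (ip_tensor_series hH ou ov c1) mul1r. Qed.

Lemma transport_bounded : bounded_op transport.
Proof.
split; first exact: (tensor_series_linear hH ou ov c1).
apply: (nsq_bounded_continuous hH (tensor_series_linear hH ou ov c1) (C := 1)).
exact: (nsq_tensor_series hH ou ov c1).
Qed.

Lemma transport_frame k : transport (u k) = v k.
Proof.
by apply: (tensor_series_uniq hH ou ov c1) => [j|y ->//]; rewrite ou ov mul1r.
Qed.

End Isometries.

Lemma transport_adj u v x y : orthonormal_seq u -> orthonormal_seq v ->
  ip (transport u v x) y = ip x (transport v u y).
Proof.
move=> ou ov; rewrite (tensor_series_adj hH ou ov (C := 1)) => [|k]; last by rewrite csq1.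
rewrite /transport (_ : (fun k : nat => Num.conj 1) = fun=> 1) //.
by apply/funext => k; exact: rmorph1.
Qed.

Lemma adjoint_transport u v : orthonormal_seq u -> orthonormal_seq v ->
  adjoint ip (transport u v) = transport v u.
Proof.
by move=> ou ov; apply/funext => y; apply: adjointE => x; exact: transport_adj.
Qed.

Lemma total_basis u : orthonormal_seq u ->
  (forall w, (forall k, ip w (u k) = 0) -> w = 0) -> orthonormal_basis ip u.
Proof.
move=> ou tu; split=> // x.
have c1 (k : nat) : csq (1 : R[i]) <= 1 by rewrite csq1.
have := tensor_series_cvg hH ou ou c1 (x := x).
rewrite (_ : tensor_series ip u u (fun=> 1) x = x).
  by under eq_fun do under eq_bigr do rewrite mul1r.
apply/eqP; rewrite -subr_eq0; apply/eqP/tu => k.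
by rewrite ipBl (ip_transport ou ou) subrr.
Qed.

Lemma transport_unitary u : orthonormal_basis ip u -> unitary_op ip (transport u e).
Proof.
move=> hu; have ou : orthonormal_seq u := hu.1.
split; first exact: transport_bounded.
  rewrite adjoint_transport //; apply/funext => x /=.
  by apply: (basis_inj hH he) => k; rewrite !ip_transport.
rewrite adjoint_transport //; apply/funext => x /=.
by apply: (basis_inj hH hu) => k; rewrite !ip_transport.
Qed.

Lemma adjoint_nsq_le (V : H -> H) : bounded_op V ->
  exists2 C : R, 0 < C & forall y, nsq (adjoint ip V y) <= C * nsq y.
Proof.
move=> bV; have [C C0 hC] := continuous_nsq_bounded hH bV.1 bV.2.
exists C => // y; set z := adjoint ip V y.
have [->|zn] := eqVneq (nsq z) 0; first by rewrite mulr_ge0 ?nsq_ge0 ?ltW.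
have zp : 0 < nsq z by rewrite lt_def zn nsq_ge0.
rewrite -(ler_pM2r zp) -expr2 -csq_real -ipxx -(adjointP hH he bV).
apply: le_trans (nsq_cs _ _ _) _; rewrite mulrAC ler_wpM2r ?nsq_ge0 //.
Qed.

Lemma qform_bounded (A : H -> H) : positive_op ip A ->
  exists2 C : R, 0 < C & forall x, qform ip A x <= C * nsq x.
Proof.
move=> pA; have [C C0 hC] := continuous_nsq_bounded hH pA.1.1 pA.1.2.
(* [C] bounds the square of the operator norm, and [C + 1] dominates its square root. *)
exists (C + 1) => [|x]; first by rewrite addr_gt0.
have : qform ip A x ^+ 2 <= ((C + 1) * nsq x) ^+ 2.
  rewrite -csq_real -(qformE pA); apply: le_trans (nsq_cs _ _ _) _.
  rewrite exprMn [nsq x ^+ 2]expr2 mulrA ler_wpM2r ?nsq_ge0 //.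
  apply: le_trans (hC x) _; rewrite ler_wpM2r ?nsq_ge0 //; nra.
by rewrite ler_sqr ?nnegrE ?qform_ge0 // mulr_ge0 ?nsq_ge0 // addr_ge0 // ltW.
Qed.

Section CompactPositive.
Variable A : H -> H.
Hypothesis hA : compact_positive ip A.
Let pA : positive_op ip A := hA.2.
Let linA : linear A := pA.1.1.
Local Notation q := (qform ip A).

Lemma exists_eigensystem : exists f s, spectral ip A f s /\ eigensystem ip A f s.
Proof.
have [f [s fs]] := spectral_theorem hH oe hA.
by exists f, s; split=> //; exact: spectral_eigensystem.
Qed.

Local Notation P := (range_proj ip A).

Lemma proj_kernel x : A (x - P x) = 0.
Proof. by have [f [s [_ es]]] := exists_eigensystem; exact: (range_projK hH es). Qed.

Lemma rproj_ortho x y : A y = 0 -> ip (P x) y = 0.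
Proof. by have [f [s [_ es]]] := exists_eigensystem; exact: (range_proj_ortho hH es). Qed.

Lemma proj_idP : P = id <-> (forall x, A x = 0 -> x = 0).
Proof. by have [f [s [_ es]]] := exists_eigensystem; exact: (range_proj_id hH es). Qed.

Lemma proj_bounded : bounded_op P.
Proof.
have [f [s [_ es]]] := exists_eigensystem.
have of_ : orthonormal_seq f by case: es.
have -> : P = range_series ip f s by apply/funext => x; exact: (range_projE hH es).
have h := @in_range_le _ s.
split; first exact: (tensor_series_linear hH of_ of_ h).
apply: (nsq_bounded_continuous hH (tensor_series_linear hH of_ of_ h) (C := 1)).
exact: (nsq_tensor_series hH of_ of_ h).
Qed.

Lemma proj_selfadj x y : ip (P x) y = ip x (P y).
Proof.
have h1 : ip (P x) (y - P y) = 0 by apply: rproj_ortho; exact: proj_kernel.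
have h2 : ip (x - P x) (P y) = 0.
  by rewrite ipC rproj_ortho ?rmorph0 //; exact: proj_kernel.
move/eqP: h1; rewrite ipBr subr_eq0 => /eqP ->.
by move/eqP: h2; rewrite ipBl subr_eq0 => /eqP ->.
Qed.

Lemma proj_idem y : P (P y) = P y.
Proof.
have linP := proj_bounded.1.
apply/eqP; rewrite eq_sym -subr_eq0 -(linB linP); apply/eqP.
apply: (ip_inj (ip := ip)) => z.
by rewrite -proj_selfadj ip0r rproj_ortho ?proj_kernel.
Qed.

Lemma proj_apply x : A (P x) = A x.
Proof.
by apply/eqP; rewrite eq_sym -subr_eq0 -(linB linA) proj_kernel.
Qed.

Lemma proj_fix x : P (A x) = A x.
Proof.
by apply: (ip_inj (ip := ip)) => y; rewrite -proj_selfadj -!(positive_selfadj pA) proj_apply.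
Qed.

Lemma proj_join_self : proj_join ip P (range_proj ip (adjoint ip A)) = P.
Proof.
rewrite (adjoint_positive pA); apply/funext => x; apply: orthprojE.
  apply: subset_closure; exists (P x); first by exists x.
  by exists (P 0); [exists 0|rewrite (lin0 proj_bounded.1) addr0].
apply: (ortho_closure hH) => _ [_ [a _ <-] [_ [b _ <-] <-]].
by rewrite -(linD proj_bounded.1) ipC rproj_ortho ?proj_kernel // rmorph0.
Qed.

Section Orbit.
Variable V : H -> H.
Hypothesis bV : bounded_op V.
Local Notation V' := (adjoint ip V).

Definition orbit_diag (k : nat) : R := q (V' (e k)).

Lemma orbit_diag_ge0 k : 0 <= orbit_diag k.
Proof. exact: qform_ge0. Qed.

Lemma orbit_diag_le : exists C : R, forall k, orbit_diag k <= C.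
Proof.
have [C C0 hC] := adjoint_nsq_le bV; have [D D0 hD] := qform_bounded pA.
exists (D * C) => k; apply: le_trans (hD _) _.
by rewrite ler_pM2l //; have := hC (e k); rewrite (onsq1 oe) mulr1.
Qed.

Lemma orbit_expectation :
  diag_expectation ip e (V \o A \o V') = diag_op ip e orbit_diag.
Proof.
by apply: diag_expectationE => k /=; rewrite (adjointP hH he bV) (qformE pA).
Qed.
End Orbit.

Lemma unitary_frame U : unitary_op ip U ->
  orthonormal_seq (fun k => adjoint ip U (e k)) /\
  (forall w, (forall k, ip w (adjoint ip U (e k)) = 0) -> w = 0).
Proof.
move=> [bU UU' U'U]; split=> [j k|w hw].
  rewrite -(adjointP hH he bU).
  by rewrite -[U (adjoint _ _ _)](congr1 (fun g => g (e j)) (esym UU')) /= oe.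
rewrite -[w](congr1 (fun g => g w) U'U) /=.
have -> : U w = 0.
  by apply: (basis_total hH he) => k; rewrite (adjointP hH he bU).
apply: (ip_inj (ip := ip)) => x; rewrite -(adjointP hH he bU) !ip0r //.
Qed.

(** [U] is cut down to [U \o P], whose initial projection is [P]; as P A P = A, the conjugate of [A]
    is unchanged. *)
Lemma unitary_orbit_partial U : unitary_op ip U ->
  partial_isometry_orbit ip A (U \o A \o adjoint ip U).
Proof.
move=> uU; have [bU UU' U'U] := uU.
have linU : linear U := bU.1; have linP := proj_bounded.1.
have adjV y : adjoint ip (U \o P) y = P (adjoint ip U y).
  by apply: adjointE => x /=; rewrite (adjointP hH he bU) proj_selfadj.
have U'Ux x : adjoint ip U (U x) = x by exact: (congr1 (fun g => g x) U'U).
exists (U \o P); last first.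
  by apply/funext => x /=; rewrite adjV proj_apply proj_fix.
split.
  split.
    split; first by move=> a x y; rewrite /= linP linU.
    move=> x; apply: continuous_comp; [exact: proj_bounded.2|exact: bU.2].
  move=> x hx; have Px : P x = x.
    have h : ip x (x - P x) = 0.
      by apply: hx => /=; rewrite (linB linP) proj_idem subrr (lin0 linU).
    apply/eqP; rewrite eq_sym -subr_eq0; apply/eqP/(nsq_eq0 (ip := ip)).
    by rewrite /sqnorm ipBl h rproj_ortho ?proj_kernel // subrr.
  apply/(norm_eq_nsq hH); rewrite /= Px /sqnorm.
  by rewrite (adjointP hH he bU) U'Ux.
by rewrite proj_join_self; apply/funext => x /=; rewrite adjV U'Ux proj_idem.
Qed.

End CompactPositive.
End Orbits.

(** * The inclusion and its properness *)

Section InclusionAndProperness.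
Context {R : realType} {H : completeNormedModType R[i]}.
Variable ip : {dot H for (@Num.conj R[i])}.
Hypothesis hH : hilbert_norm ip.
Local Notation nsq := (sqnorm ip).
Local Notation orthonormal_seq := (orthonormal_sequence ip).
Implicit Types (x y z w : H).
Variable e : nat -> H.
Hypothesis he : orthonormal_basis ip e.
Let oe : orthonormal_seq e := he.1.
Variable A : H -> H.
Hypothesis hA : compact_positive ip A.
Let pA : positive_op ip A := hA.2.
Let linA : linear A := pA.1.1.
Local Notation q := (qform ip A).
Local Notation P := (range_proj ip A).
Local Notation D := (diag_op ip e).
Local Notation odiag := (orbit_diag ip e A).

Lemma perp_qform x : complex.Re (ip (range_proj_perp ip A x) x) = nsq (x - P x).
Proof.
rewrite /range_proj_perp /sqnorm [in RHS]ipBr [ip _ (P x) in RHS]ipC.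
by rewrite (rproj_ortho hH he hA) ?rmorph0 ?subr0 //; exact: (proj_kernel hH he hA).
Qed.

Lemma trace_perp_le U : unitary_op ip U ->
  (Tr ip e (range_proj_perp ip (D (odiag U))) <= Tr ip e (range_proj_perp ip A))%E.
Proof.
move=> uU; have [bU _ _] := uU; have [ou _] := unitary_frame hH he uU.
have [C hC] := orbit_diag_le hH he hA bU.
pose u k := adjoint ip U (e k).
have Au k : odiag U k = 0 -> A (u k) = 0 by exact: qform_eq0.
rewrite /Tr; apply: nneseries_le => [k|n].
  rewrite (diagonal_range_perp hH he (orbit_diag_ge0 e hA U) hC) lee_fin.
  by case: eqP.
under eq_bigr do rewrite (diagonal_range_perp hH he (orbit_diag_ge0 e hA U) hC).
under [leRHS]eq_eseriesr do rewrite perp_qform.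
pose c i : R := (odiag U i == 0)%:R.
(* Each zero entry counts 1 = |u_i|^2, spread over the basis by Parseval. After exchanging the sums
   the traces compare term by term: for fixed [k], Bessel's inequality for [e k - P (e k)] against
   the [u i] lying in the kernel. *)
have -> : (\sum_(i < n) (complex.Re ((odiag U i == 0)%:R : R[i]))%:E =
  \sum_(i < n) \sum_(0 <= k <oo) (c i * csq (ip (u i) (e k)))%:E)%E.
  apply: eq_bigr => i _; rewrite (nneseries_EFin (l := c i * nsq (u i))).
    by rewrite (onsq1 ou) mulr1 /c; case: eqP.
  under eq_fun do rewrite -mulr_sumr.
  by apply: cvgM; [exact: cvg_cst|exact: parseval].
rewrite -nneseries_sum; last first.
  by move=> i k _; rewrite lee_fin mulr_ge0 ?csq_ge0 // /c; case: eqP.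
apply: lee_nneseries => [k _ _|k _].
  by apply: sume_ge0 => i _; rewrite lee_fin mulr_ge0 ?csq_ge0 // /c; case: eqP.
rewrite sumEFin lee_fin; apply: le_trans (bessel ou (e k - P (e k)) n).
apply: ler_sum => i _; rewrite /c; case: eqP => [/Au Aui|_]; last by rewrite mul0r csq_ge0.
have -> : ip (e k - P (e k)) (adjoint ip U (e i)) = ip (e k) (u i).
  by rewrite ipBl (rproj_ortho hH he hA) // subr0.
by rewrite mul1r ipC csqJ.
Qed.

Definition EU := diag_expectation ip e @` unitary_orbit ip A.
Definition EV := diag_expectation ip e @` partial_isometry_orbit ip A.
Definition EV_le := EV `&` [set B | diagonal_op ip e B /\
  (Tr ip e (range_proj_perp ip B) <= Tr ip e (range_proj_perp ip A))%E].

Lemma EU_elim B : EU B -> exists2 U, unitary_op ip U & B = D (odiag U).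
Proof.
move=> [_ [U uU <-] <-]; exists U => //.
by have [bU _ _] := uU; exact: orbit_expectation.
Qed.

Lemma EU_intro U : unitary_op ip U -> EU (D (odiag U)).
Proof.
move=> uU; have [bU _ _] := uU; exists (U \o A \o adjoint ip U); first by exists U.
exact: orbit_expectation.
Qed.

Lemma EU_sub_EV : EU `<=` EV.
Proof.
move=> _ [_ [U uU <-] <-]; exists (U \o A \o adjoint ip U) => //.
exact: (unitary_orbit_partial hH he hA).
Qed.

Lemma EU_sub_EV_le : EU `<=` EV_le.
Proof.
move=> B EB; split; first exact: EU_sub_EV.
have [U uU ->] := EU_elim EB; have [bU _ _] := uU; split; last exact: trace_perp_le.
have [C hC] := orbit_diag_le hH he hA bU.
exact: (diagonal_diagonal_op hH he (orbit_diag_ge0 e hA U) hC).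
Qed.

(** * Infinite rank: the nonzero eigenvalues as a diagonal *)

Section Frame.
Variables (f : nat -> H) (s : R^nat).
Hypotheses (spA : spectral ip A f s) (es : eigensystem ip A f s).
Let of_ : orthonormal_seq f. Proof. by case: spA. Qed.
Let ni_s : noninc s. Proof. by case: spA => _ []. Qed.
Let s0 n : 0 <= s n. Proof. by case: spA => _ []. Qed.
Let fs j : A (f j) = ((s j)%:C)%C *: f j. Proof. by case: es. Qed.

Lemma infinite_rank_pos : ~ finite_rank A -> forall n, 0 < s n.
Proof.
move=> nfr n; rewrite lt_def s0 andbT; apply/eqP => sn0; apply: nfr.
have ex : exists n, s n == 0 by exists n; apply/eqP.
pose m := ex_minn ex.
have [sm0 lt] : s m = 0 /\ forall j, (s j != 0) = (j < m)%N.
  rewrite /m; case: ex_minnP => k /eqP sk mk; split=> // j.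
  case: ltnP => [jk|kj]; first by apply/eqP => /eqP /mk; rewrite leqNgt jk.
  by apply/negbTE; rewrite negbK eq_le s0 andbT -sk; exact: ni_s.
have dec x : A x = \sum_(j < m) (((s j)%:C)%C * ip x (f j)) *: f j.
  have : A (x - \sum_(j < m) ip x (f j) *: f j) = 0.
    have [_ _ _ _ ker] := es; apply: ker => j; rewrite lt => jm.
    exact: (ip_residual_eq0 spA).
  rewrite (linB linA) => /eqP; rewrite subr_eq0 => /eqP ->.
  by rewrite lin_sum //; apply: eq_bigr => j _; rewrite linZ // fs scalerA mulrC.
exists m, (fun i => f i); split.
  move=> c h i; pose a (j : nat) : R[i] := if insub j is Some k then c k else 0.
  have aE (k : 'I_m) : a k = c k by rewrite /a valK.
  have := ip_onsum of_ a m i; rewrite ltn_ord aE => <-.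
  by under eq_bigr do rewrite aE; rewrite h ip0l.
apply/seteqP; split=> [_ [x _ <-]|x [c ->]].
  by exists (fun j => ((s j)%:C)%C * ip x (f j)); exact: dec.
exists (\sum_(i < m) (c i * (((s i)^-1)%:C)%C) *: f i) => //.
rewrite lin_sum //; apply: eq_bigr => j _; rewrite linZ // fs scalerA -mulrA.
by rewrite -rmorphM mulVf ?mulr1 // lt.
Qed.

Lemma transport_orbit : (forall n, 0 < s n) -> EV (D s).
Proof.
move=> sp; pose V := transport ip f e.
have bV : bounded_op V by exact: transport_bounded.
have V' : adjoint ip V = transport ip e f by exact: (adjoint_transport hH).
have VV x : adjoint ip V (V x) = P x.
  rewrite V' (range_projE hH es); apply/esym.
  apply: (tensor_series_uniq hH of_ of_ (@in_range_le _ s)) => [k|y hy].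
    by rewrite !(ip_transport hH) // /in_range gt_eqF // mul1r.
  apply: (tensor_series_ortho hH oe of_ (C := 1)) => // k.
  by rewrite csq1.
exists (V \o A \o adjoint ip V); last first.
  rewrite (orbit_expectation hH he hA bV); congr (D _); apply/funext => k.
  by rewrite /orbit_diag V' (transport_frame hH) // /qform fs ipZl of_ eqxx mulr1.
exists V => //; split; last first.
  by rewrite (proj_join_self hH he hA); apply/funext.
split=> // x hx; apply/(norm_eq_nsq hH).
have h : ip x (x - P x) = 0.
  apply: hx; apply: (basis_inj hH he) => k; rewrite ip0l (ip_transport hH) //.
  have Ar := proj_kernel hH he hA x.
  apply/eqP; have := spectral_apply pA spA (x - P x) k.
  rewrite Ar ip0l => /eqP; rewrite eq_sym mulf_eq0 => /orP[|//].
  by rewrite (inj_eq (@complexI R) _ 0) gt_eqF.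
rewrite /sqnorm (adjointP hH he bV) VV.
by move/eqP: h; rewrite ipBr subr_eq0 => /eqP ->.
Qed.

(** Since all [s n] are positive, [w] is orthogonal to every [f j]. Removing the component along [w]
    from the residual of [x] leaves [q] unchanged and lowers the squared norm by |<x, w>|^2. *)
Lemma qform_le_kernel w n x : A w = 0 -> nsq w = 1 -> (forall n, 0 < s n) ->
  q x <= \sum_(j < n) (s j - s n) * csq (ip x (f j)) +
         s n * (nsq x - csq (ip x w)).
Proof.
move=> Aw nw sp.
have fw j : ip (f j) w = 0.
  have : ip (A (f j)) w = 0 by rewrite (positive_selfadj pA) Aw ip0r.
  rewrite fs ipZl => /eqP; rewrite mulf_eq0 => /orP[|/eqP//].
  by rewrite (inj_eq (@complexI R) _ 0) gt_eqF.
set r := x - \sum_(j < n) ip x (f j) *: f j.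
pose a := ip r w; pose r' := r - a *: w.
have aE : a = ip x w.
  by rewrite /a ipBl ip_suml big1 ?subr0 // => j _; rewrite ipZl fw mulr0.
have qr : q r = q r'.
  rewrite -[in LHS](subrK (a *: w) r) -/r' (qformD pA) (qformZ pA).
  rewrite (positive_selfadj pA) (linZ linA) Aw scaler0 ip0r /=.
  by rewrite [q w](_ : _ = 0) ?mulr0 ?mul0rn ?addr0 // /qform Aw ip0l.
have nr : nsq r' = nsq r - csq a.
  rewrite nsqB nsqZ nw mulr1 ipZr mulrC mul_conj /= mulr2n; lra.
rewrite (qform_decomp pA spA x n) -/r qr.
have [_ _ _ _ qs] := spA.
have := qs n r' _; rewrite nr (nsq_residual of_) aE => h.
apply: le_trans (lerD (lexx _) (h _)) _.
  move=> k kn; rewrite ipBl ipZl (ip_residual_eq0 spA x kn) sub0r ipC fw.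
  by rewrite rmorph0 mulr0 oppr0.
under [in leRHS]eq_bigr do rewrite mulrBl.
rewrite sumrB -mulr_sumr; lra.
Qed.

Lemma unitary_orbit_kernel U w : unitary_op ip U -> A w = 0 ->
  (forall n, 0 < s n) -> odiag U = s -> w = 0.
Proof.
move=> uU Aw sp dU; have [bU _ _] := uU; have [ou tu] := unitary_frame hH he uU.
apply/eqP/negPn/negP => /(normalize ip)[a a0 nw]; move/negP: a0; apply.
set w1 := a *: w in nw.
have Aw1 : A w1 = 0 by rewrite (linZ linA) Aw scaler0.
pose u k := adjoint ip U (e k).
suff h : w1 = 0 by move: nw; rewrite h nsq0 => /esym/eqP; rewrite oner_eq0.
apply: tu => k; rewrite ipC; apply/eqP; rewrite conjc_eq0; apply/eqP/csq_eq0.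
(* Length [k.+1] includes the coefficient at [k]. With both diagonals equal, the positive factor
   [s k.+1] cancels and the sum of the |<u_i, w>|^2 is at most 0. *)
have := kyfan_sum (m := k.+1) (n := k.+1) (b := fun k j => csq (ip (u k) (f j)))
  (q := fun k => q (u k)) (t := fun k => 1 - csq (ip (u k) w1)) ni_s.
have -> : \sum_(i < k.+1) q (u i) = \sum_(i < k.+1) s i.
  by apply: eq_bigr => i _; rewrite -dU.
rewrite -[in X in _ -> _ -> X](sum_sub_const k.+1 s (s k.+1)) lerD2l.
rewrite ler_pM2l // sumrB sumr_const card_ord => h.
apply/eqP; rewrite eq_le csq_ge0 andbT.
suff : k.+1%:R <= k.+1%:R - \sum_(i < k.+1) csq (ip (u i) w1) :> R.
  rewrite lerBrDl -lerBrDr subrr => h0; apply: le_trans h0.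
  by rewrite big_ord_recr /= lerDr sumr_ge0 // => i _; exact: csq_ge0.
apply: h => [i _|j _].
  by rewrite -[X in X - _](onsq1 ou i); exact: qform_le_kernel.
rewrite -(onsq1 of_ j); apply: le_trans (bessel ou (f j) k.+1).
by apply: ler_sum => i _; rewrite ipC csqJ.
Qed.

End Frame.

Lemma EU_proper : ~ (range_proj ip A = id \/ finite_rank A) -> EU `<` EV_le.
Proof.
move=> /not_orP[nid nfr]; split; first exact: EU_sub_EV_le.
have [f [s [spA es]]] := exists_eigensystem hH he hA.
have sp := infinite_rank_pos spA es nfr.
have s0 n : 0 <= s n by exact: ltW.
have sC n : s n <= s 0%N by case: spA => _ [+ _] _ _ _; apply.
have [w [Aw wn]] : exists w, A w = 0 /\ w <> 0.
  apply: contrapT => h; apply: nid; apply/(proj_idP hH he hA) => x Ax.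
  by apply: contrapT => xn; apply: h; exists x.
have EVs : EV_le (D s).
  split; first exact: transport_orbit spA es sp.
  split; first exact: (diagonal_diagonal_op hH he s0 sC).
  rewrite /Tr (_ : (\sum_(0 <= k <oo) _)%E = 0%E :> \bar R); last first.
    apply: eseries0 => k _ _; rewrite (diagonal_range_perp hH he s0 sC).
    by rewrite gt_eqF.
  by apply: nneseries_ge0 => k _ _; rewrite perp_qform lee_fin nsq_ge0.
move=> /(_ _ EVs)/EU_elim[U uU h]; have [bU _ _] := uU; apply: wn.
have [C hC] := orbit_diag_le hH he hA bU.
apply: (unitary_orbit_kernel spA es uU Aw sp).
apply: (diagonal_inj hH he (C := Num.max C (s 0%N)) _ _ _ _ (esym h)) => k //.
- exact: orbit_diag_ge0.
- by rewrite le_max hC.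
- by rewrite le_max sC orbT.
Qed.

End InclusionAndProperness.

(** * Rearrangements, dimensions and singular numbers *)

Lemma card_II_inj n m : (`I_n #= `I_m)%card -> n = m.
Proof.
by rewrite card_eq_le !card_le_II => /andP[h1 h2]; apply/eqP; rewrite eqn_leq h1.
Qed.

Lemma card_bounded_pred (p : pred nat) N : (forall k, p k -> (k < N)%N) ->
  ([set k | p k] #= `I_(count p (iota 0 N)))%card.
Proof.
move=> pN; set l := seq.filter p (iota 0 N).
have ul : uniq l by rewrite filter_uniq // iota_uniq.
have lE k : (k \in l) = p k.
  by rewrite mem_filter mem_iota add0n /=; case: (boolP (p k)) => // /pN ->.
have -> : [set k | p k] = nth 0%N l @` `I_(size l).
  apply/seteqP; split=> [k /= pk|_ [i /= il <-]]; last by rewrite -lE mem_nth.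
  by exists (index k l); rewrite ?nth_index ?lE //= index_mem lE.
rewrite -size_filter -/l; apply: inj_card_eq => i j; rewrite !inE => /= il jl /eqP.
by rewrite nth_uniq // => /eqP.
Qed.

Section Sequences.
Context {R : realType}.
Implicit Types s d : R^nat.

Lemma c0star_noninc s : c0star s <-> [/\ forall n, 0 <= s n, noninc s & s @ \oo --> (0 : R)].
Proof.
by split=> -[s0 ns sc]; split.
Qed.

Lemma level_bound s (l : R) : s @ \oo --> (0 : R) -> 0 < l ->
  exists N, forall k, s k == l -> (k < N)%N.
Proof.
move=> sc l0; have l2 : 0 < l / 2 by lra.
have [N hN] := null_seq_le sc l2; exists N => k /eqP sk.
by rewrite ltnNge; apply/negP => /hN; rewrite sk; lra.
Qed.

(** If the sequences agree below [n] and [s' n < s n], the level [s n] occurs once more in [s] at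
    [n], but never again in the nonincreasing [s']. *)
Lemma same_levels_le s s' : c0star s -> c0star s' ->
  (forall l, 0 < l -> exists n : nat, ([set k | s k = l] #= `I_n)%card /\
     ([set k | s' k = l] #= `I_n)%card) ->
  forall n, (forall j, (j < n)%N -> s j = s' j) -> s n <= s' n.
Proof.
move=> /c0star_noninc[s0 ns sc] /c0star_noninc[s0' ns' sc'] h n IH.
rewrite leNgt; apply/negP => lt; have l0 : 0 < s n by exact: le_lt_trans lt.
have [m [h1 h2]] := h _ l0.
have [N1 hN1] := level_bound sc l0; have [N2 hN2] := level_bound sc' l0.
pose N := maxn n.+1 (maxn N1 N2).
have b1 k : s k == s n -> (k < N)%N.
  by move=> /hN1 /leq_trans; apply; rewrite /N !leq_max leqnn /= orbT.
have b2 k : s' k == s n -> (k < N)%N.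
  by move=> /hN2 /leq_trans; apply; rewrite /N !leq_max leqnn /= !orbT.
have c1 := card_bounded_pred b1; have c2 := card_bounded_pred b2.
have E (t : R^nat) : [set k | t k == s n] = [set k | t k = s n].
  by apply/seteqP; split=> k /= /eqP.
rewrite E in c1; rewrite E in c2.
have e1 := card_II_inj (card_eq_trans (card_esym c1) h1).
have e2 := card_II_inj (card_eq_trans (card_esym c2) h2).
have nN : (n < N)%N by rewrite /N leq_max ltnSn.
have : (count (fun k => s' k == s n) (iota 0 N) <
        count (fun k => s k == s n) (iota 0 N))%N; last by rewrite e1 e2 ltnn.
rewrite -(subnKC (ltnW nN)) iotaD !count_cat.
have -> : count (fun k => s' k == s n) (iota 0 n) = count (fun k => s k == s n) (iota 0 n).
  by apply: eq_in_count => k; rewrite mem_iota add0n => /andP[_ /IH ->].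
have -> : count (fun k => s' k == s n) (iota (0 + n) (N - n)) = 0%N.
  apply/eqP; rewrite -leqn0 leqNgt -has_count; apply/hasPn => k.
  rewrite mem_iota => /andP[nk _]; rewrite lt_eqF //; apply: le_lt_trans lt; exact: ns'.
rewrite addn0 -[X in (X < _)%N]addn0 ltn_add2l -has_count.
apply/hasP; exists n => //=; rewrite mem_iota add0n leqnn /=; lia.
Qed.

Lemma same_levels_eq s s' : c0star s -> c0star s' ->
  (forall l, 0 < l -> exists n : nat, ([set k | s k = l] #= `I_n)%card /\
     ([set k | s' k = l] #= `I_n)%card) -> s = s'.
Proof.
move=> cs cs' h; apply/funext => n; elim/ltn_ind: n => n IH.
apply/eqP; rewrite eq_le (same_levels_le cs cs' h) //=.
apply: (same_levels_le cs' cs) => [l /h[m [h1 h2]]|j /IH //]; by exists m.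
Qed.

Lemma exists_unvisited_max d (s : seq nat) : (forall k, 0 < d k) -> d @ \oo --> (0 : R) ->
  exists2 k, k \notin s & forall j, j \notin s -> d j <= d k.
Proof.
move=> d0 dc.
have [k0 k0s] : exists k0, k0 \notin s.
  exists (\max_(i <- s) i).+1; apply/negP => h.
  by have := @leq_bigmax_seq _ s xpredT id _ h isT; rewrite ltnn.
have [N hN] := null_seq_le dc (d0 k0).
pose M := maxn N k0.+1.
have k0M : (k0 < M)%N by rewrite leq_max leqnn orbT.
pose K0 : 'I_M := Ordinal k0M.
have [k ks km] := @arg_maxP _ _ _ K0 (fun i : 'I_M => val i \notin s) (fun i : 'I_M => d i) k0s.
exists (val k) => // j js; have [jM|Mj] := ltnP j M.
  exact: (km (Ordinal jM)).
apply: (@le_trans _ _ (d k0)); last exact: (km K0).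
by apply: hN; apply: leq_trans Mj; rewrite leq_maxl.
Qed.

(** Greedy enumeration by the largest unvisited entry. It is onto because of positivity: an entry
    [d j > 0] never visited would bound all chosen entries from below, against their convergence to
    0. *)
Lemma decreasing_rearrangement d : (forall k, 0 < d k) -> d @ \oo --> (0 : R) ->
  exists p p' : nat -> nat, [/\ cancel p p', cancel p' p, noninc (d \o p) &
    (d \o p) @ \oo --> (0 : R)].
Proof.
move=> d0 dc.
pose P (n : nat) (s : seq nat) := uniq s.
pose Q (n : nat) (s s' : seq nat) := exists k, [/\ s' = k :: s, k \notin s &
  forall j, j \notin s -> d j <= d k].
have [F [F0 hF]] : exists F : nat -> seq nat, F 0%N = [::] /\
    forall n, P n (F n) /\ Q n (F n) (F n.+1).
  apply: (@dependent_choice_inv _ P Q [::]) => // n s us.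
  have [k ks km] := exists_unvisited_max s d0 dc.
  by exists (k :: s); split; [rewrite /P /= ks|exists k].
pose p n := head 0%N (F n.+1).
have FS n : [/\ F n.+1 = p n :: F n, p n \notin F n &
    forall j, j \notin F n -> d j <= d (p n)].
  by have [_ [k [e kn km]]] := hF n; rewrite /p e.
have Fin n j : (j \in F n) = [exists i : 'I_n, p i == j].
  elim: n => [|n IH]; first by rewrite F0; apply/esym/existsP => -[[]].
  have [-> _ _] := FS n; rewrite inE IH; apply/orP/existsP.
    case=> [/eqP ->|/existsP[i hi]]; first by exists ord_max => /=.
    by exists (widen_ord (leqnSn n) i).
  move=> [i hi]; have := ltn_ord i; rewrite ltnS leq_eqVlt => /orP[/eqP e|lt].
    by left; rewrite -(eqP hi) e.
  by right; apply/existsP; exists (Ordinal lt).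
have pF i n : (i < n)%N -> p i \in F n.
  by move=> lt; rewrite Fin; apply/existsP; exists (Ordinal lt).
have pinj : injective p.
  move=> i j e; case: (ltngtP i j) => // lt.
    by have [_ + _] := FS j; rewrite -e pF.
  by have [_ + _] := FS i; rewrite e pF.
have ndp : noninc (d \o p).
  move=> m n; elim: n => [|n IH]; first by rewrite leqn0 => /eqP ->.
  rewrite leq_eqVlt => /predU1P[->//|]; rewrite ltnS => /IH; apply: le_trans => /=.
  have [_ _ h] := FS n; apply: h; apply/negP; rewrite Fin => /existsP[i /eqP /pinj e].
  by have := ltn_ord i; rewrite e; lia.
have dpc : (d \o p) @ \oo --> (0 : R).
  apply/cvgn_realP => eps e0; have e2 : 0 < eps / 2 by lra.
  have [N hN] := null_seq_le dc e2.
  have [m hm] : exists m, (N <= p m)%N.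
    apply: contrapT => h.
    have lt i : (p i < N)%N by rewrite ltnNge; apply/negP => hi; apply: h; exists i.
    have /leq_card : injective (fun i : 'I_N.+1 => Ordinal (lt i)).
      by move=> i j /(congr1 val) /= /pinj /val_inj.
    by rewrite !card_ord ltnn.
  exists m => n mn; rewrite sub0r normrN gtr0_norm //=.
  apply: le_lt_trans (ndp _ _ mn) _ => /=; have := hN _ hm; lra.
have psurj j : exists i, p i = j.
  apply: contrapT => h.
  have [N hN] := null_seq_le dpc (divr_gt0 (d0 j) (ltr0n _ 2)).
  have : d j <= d (p N).
    have [_ _ hh] := FS N; apply: hh; rewrite Fin; apply/negP => /existsP[i /eqP e].
    by apply: h; exists i.
  by have := hN N (leqnn N); have := d0 j => /=; lra.
have [p' hp'] := choice psurj.
by exists p, p'; split=> // i; apply: pinj; rewrite hp'.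
Qed.

End Sequences.

Section Dimension.
Context {R : realType} {H : completeNormedModType R[i]}.

Lemma has_dim_le (W : set H) n m : has_dim W n -> has_dim W m -> (n <= m)%N.
Proof.
move=> [v [v_ind hv]] [w [_ hw]]; rewrite leqNgt; apply/negP => mn.
have ex (i : 'I_n) : exists c : 'I_m -> R[i], v i = \sum_j c j *: w j.
  have : W (v i).
    rewrite hv; exists (fun k => (k == i)%:R).
    rewrite (bigD1 i) //= eqxx scale1r big1 ?addr0 // => k /negbTE ->.
    by rewrite scale0r.
  by rewrite hw.
have [M hM] := choice ex.
have [c c0 cM] := exists_left_kernel (\matrix_(i < n, j < m) M i j) mn.
move/eqP: c0; apply; apply/rowP => i; rewrite mxE; apply: (v_ind (c 0)).
under eq_bigr do rewrite hM scaler_sumr.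
rewrite exchange_big big1 //= => j _.
under eq_bigr do rewrite scalerA.
rewrite -scaler_suml; have := congr1 (fun X : 'rV_m => X 0 j) cM; rewrite !mxE.
under eq_bigr do rewrite mxE.
by move=> ->; rewrite scale0r.
Qed.

Lemma has_dim_uniq (W : set H) n m : has_dim W n -> has_dim W m -> n = m.
Proof. by move=> h1 h2; apply/eqP; rewrite eqn_leq !(has_dim_le (W := W)). Qed.

Variable ip : {dot H for (@Num.conj R[i])}.

Lemma singular_numbersE (T : H -> H) (s : R^nat) : is_singular_numbers ip T s ->
  singular_numbers ip T = s.
Proof.
move=> hs; rewrite /singular_numbers; case: xgetP => [s' _ hs'|/(_ s)//].
apply: same_levels_eq; [exact: hs'.1|exact: hs.1|move=> l l0].
have [n [h1 d1]] := hs.2 l l0; have [m [h2 d2]] := hs'.2 l l0.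
by exists n; split=> //; rewrite -(has_dim_uniq d2 d1).
Qed.

End Dimension.

(** * Operators with a positive eigenbasis *)

Section EigenBasis.
Context {R : realType} {H : completeNormedModType R[i]}.
Variable ip : {dot H for (@Num.conj R[i])}.
Hypothesis hH : hilbert_norm ip.
Local Notation nsq := (sqnorm ip).
Local Notation orthonormal_seq := (orthonormal_sequence ip).
Implicit Types (x y z w : H).

Section SingularNumbers.
Variables (A : H -> H) (f : nat -> H) (s : R^nat).
Hypotheses (pA : positive_op ip A) (hf : orthonormal_basis ip f).
Hypotheses (fs : forall j, A (f j) = ((s j)%:C)%C *: f j) (sp : forall j, 0 < s j).
Let of_ : orthonormal_seq f := hf.1.

(** A positive root [S] of A^2 satisfies [S g = - s j g] for [g = S (f j) - s j f j]; since <S g, g>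
    is nonnegative and [s j > 0], [g] vanishes. *)
Lemma op_abs_positive : op_abs ip A = A.
Proof.
rewrite /op_abs (adjoint_positive pA) /op_sqrt.
case: xgetP => [S _ [pS SS]|/(_ A)[]//].
have linS := pS.1.1; have linA := pA.1.1.
have Sf j : S (f j) = ((s j)%:C)%C *: f j.
  pose g := S (f j) - ((s j)%:C)%C *: f j.
  have Sg : S g = - (((s j)%:C)%C *: g).
    have SSf : S (S (f j)) = ((s j)%:C)%C *: (((s j)%:C)%C *: f j).
      by rewrite -[S (S _)](congr1 (fun T => T (f j)) (esym SS)) /= fs (linZ linA) fs.
    rewrite (linB linS) (linZ linS) SSf scalerBr opprB //.
  apply/eqP; rewrite -subr_eq0 -/g; apply/eqP/(nsq_eq0 (ip := ip)).
  have := qform_ge0 pS g; rewrite /qform Sg ipNl ipZl ReN ReZ -/(nsq g) oppr_ge0.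
  rewrite pmulr_rle0 // => h; apply/eqP; rewrite eq_le h nsq_ge0 //.
apply/funext => x; apply: (basis_inj hH hf) => k.
by rewrite (positive_selfadj pS) Sf (positive_selfadj pA) fs.
Qed.

Lemma eigenspace_has_dim (l : R) N : 0 < l -> (forall k, s k == l -> (k < N)%N) ->
  has_dim (eigenspace_op A l) (count (fun k => s k == l) (iota 0 N)).
Proof.
move=> l0 hN; rewrite -size_filter; set L := seq.filter _ _.
have uL : uniq L by rewrite filter_uniq // iota_uniq.
have LE k : (k \in L) = (s k == l).
  by rewrite mem_filter mem_iota add0n /=; case: (boolP (s k == l)) => // /hN ->.
pose t (i : 'I_(size L)) := nth 0%N L i.
have tinj (i j : 'I_(size L)) : (t i == t j) = (i == j).
  by rewrite /t nth_uniq.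
have st i : s (t i) = l by apply/eqP; rewrite -LE mem_nth.
have linA := pA.1.1.
have ipsum (c : 'I_(size L) -> R[i]) i : ip (\sum_i c i *: f (t i)) (f (t i)) = c i.
  rewrite ip_suml (bigD1 i) //= big1 ?addr0 => [|j /negbTE ji].
    by rewrite ipZl of_ eqxx mulr1.
  by rewrite ipZl of_ tinj ji mulr0.
exists (fun i => f (t i)); split=> [c h i|].
  by rewrite -(ipsum c i) h ip0l.
apply/seteqP; split=> [x /= Ax|x [c ->] /=]; last first.
  rewrite /eigenspace_op /= (lin_sum linA) scaler_sumr; apply: eq_bigr => i _.
  by rewrite (linZ linA) fs st !scalerA mulrC.
exists (fun i => ip x (f (t i))); apply: (basis_inj hH hf) => k.
have [kL|kL] := boolP (k \in L).
  have iL : (index k L < size L)%N by rewrite index_mem.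
  have -> : k = t (Ordinal iL) by rewrite /t /= nth_index.
  by rewrite (ipsum (fun i => ip x (f (t i)))).
rewrite ip_suml big1 => [|i _]; last first.
  rewrite ipZl of_; case: eqP => [tk|_]; last by rewrite mulr0.
  by move: kL; rewrite -tk mem_nth.
apply/eqP; have : ip (A x) (f k) = ((l)%:C)%C * ip x (f k) by rewrite Ax ipZl.
rewrite (positive_selfadj pA) fs ipZr conj_real => /eqP.
rewrite -subr_eq0 -mulrBl mulf_eq0 -rmorphB => /orP[|//].
rewrite (inj_eq (@complexI R) _ 0) subr_eq0 => sk.
by move: kL; rewrite LE sk.
Qed.

Lemma eigenbasis_singular_numbers : noninc s -> s @ \oo --> (0 : R) ->
  singular_numbers ip A = s.
Proof.
move=> ns sc; apply: singular_numbersE; split.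
  by apply/c0star_noninc; split=> // n; exact: ltW.
move=> l l0; have [N hN] := level_bound sc l0.
exists (count (fun k => s k == l) (iota 0 N)); split.
  rewrite (_ : [set k | s k = l] = [set k | s k == l]).
    exact: card_bounded_pred.
  by apply/seteqP; split=> k /= /eqP.
by rewrite op_abs_positive; exact: eigenspace_has_dim.
Qed.

End SingularNumbers.

(** * Null diagonals give compact operators *)

Section CompactDiagonal.
Variable e : nat -> H.
Hypothesis he : orthonormal_basis ip e.
Let oe : orthonormal_seq e := he.1.

(** The limit is the supremum of the [a] for which [a <= g y] holds along [F]; the ultrafilter
    property supplies the upper estimate. *)
Lemma ultra_bounded_cvg (F : set_system H) (g : H -> R) (M : R) : UltraFilter F ->
  F [set y | `|g y| <= M] ->
  exists c : R, forall eps : R, 0 < eps -> F [set y | `|g y - c| < eps].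
Proof.
move=> FU FM; have FP : ProperFilter F by exact: ultra_proper.
pose S := [set a | F [set y | a <= g y]].
have hS : has_sup S.
  split.
    exists (- M); rewrite /S /=; apply: filterS FM => y /=.
    by rewrite ler_norml => /andP[].
  exists M => a Sa.
  have [y [/= ay]] := filter_ex (filterI Sa FM).
  by rewrite ler_norml => /andP[_]; exact: le_trans.
exists (sup S) => eps e0.
have e2 : 0 < eps / 2 by lra.
have [a Sa ha] := sup_adherent e2 hS.
have h2 : F [set y | g y < sup S + eps].
  have [h|h] := in_ultra_setVsetC [set y | sup S + eps <= g y] FU.
    have : sup S + eps <= sup S by apply: ub_le_sup => //; case: hS.
    by lra.
  by apply: filterS h => y /= /negP; rewrite -ltNge.
apply: filterS (filterI Sa h2) => y [/= h3 h4].
rewrite ltr_norml; apply/andP; split; lra.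
Qed.

Lemma ultra_ip_cvg (F : set_system H) (M : R) v : UltraFilter F ->
  F [set y | nsq y <= M] -> nsq v = 1 ->
  exists c : R[i], forall eps : R, 0 < eps -> F [set y | csq (ip y v - c) < eps].
Proof.
move=> FU FM v1; have FP : ProperFilter F by exact: ultra_proper.
have bnd (a b : R) : 0 <= M -> a ^+ 2 + b ^+ 2 <= M -> `|a| <= M + 1.
  move=> M0 h; rewrite -ler_sqr ?nnegrE ?addr_ge0 // real_normK ?num_real //.
  have := sqr_ge0 b; nra.
have hb : F [set y | csq (ip y v) <= M].
  apply: filterS FM => y /=; apply: le_trans.
  by apply: le_trans (nsq_cs _ _ _) _; rewrite v1 mulr1.
have M0 : 0 <= M.
  by have [y /= hy] := filter_ex hb; apply: le_trans hy; exact: csq_ge0.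
have [|c1 h1] := @ultra_bounded_cvg F (fun y => complex.Re (ip y v)) (M + 1) FU.
  by apply: filterS hb => y /=; exact: bnd.
have [|c2 h2] := @ultra_bounded_cvg F (fun y => complex.Im (ip y v)) (M + 1) FU.
  by apply: filterS hb => y /=; rewrite /csq addrC; exact: bnd.
exists (c1 +i* c2)%C => eps e0.
have s0 : 0 < Num.sqrt (eps / 2) by rewrite sqrtr_gt0; lra.
apply: filterS (filterI (h1 _ s0) (h2 _ s0)) => y [/=].
case: (ip y v) => a b /= g1 g2; rewrite /csq /=.
have sq t : `|t| < Num.sqrt (eps / 2) -> t ^+ 2 < eps / 2.
  move=> ht; rewrite -real_normK ?num_real // -[ltRHS](sqr_sqrtr (a := eps / 2)); last by lra.
  by rewrite ltr_sqr ?nnegrE // ltW.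
have := sq _ g1; have := sq _ g2; lra.
Qed.

Lemma finite_near (F : set_system H) (c : nat -> R[i]) n : ProperFilter F ->
  (forall k (eps : R), 0 < eps -> F [set y | csq (ip y (e k) - c k) < eps]) ->
  forall eps : R, 0 < eps ->
  F [set y | \sum_(k < n) csq (ip y (e k) - c k) < eps].
Proof.
move=> FP hc; elim: n => [|n IH] eps e0.
  by apply: filterS filterT => y _ /=; rewrite big_ord0.
have e2 : 0 < eps / 2 by lra.
apply: filterS (filterI (IH _ e2) (hc n _ e2)) => y [/= h1 h2].
by rewrite big_ord_recr /=; lra.
Qed.

(* Along an ultrafilter all coordinates converge, and the tails are uniformly small
   on the image of the unit ball. *)
Lemma diagonal_compact (d : R^nat) : (forall k, 0 <= d k) -> d @ \oo --> (0 : R) ->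
  compact_op (diag_op ip e d).
Proof.
move=> d0 dc.
have [C dC] : exists C, forall k, d k <= C.
  have [N hN] := null_seq_le dc ltr01.
  exists (1 + \sum_(k < N) d k) => k; have [kN|Nk] := ltnP k N.
    rewrite (bigD1 (Ordinal kN)) //= addrCA lerDl addr_ge0 // sumr_ge0 //.
  by apply: le_trans (hN _ Nk) _; rewrite lerDl sumr_ge0.
split; first exact: (diagonal_bounded hH he d0 dC).
pose T := diag_op ip e d; pose K := closure (T @` [set x | `|x| <= 1]).
pose S n y := \sum_(k < n) ip y (e k) *: e k.
have SB n y z : S n (y - z) = S n y - S n z.
  by rewrite /S -sumrB; apply: eq_bigr => k _; rewrite ipBl scalerBl.
have nS n y : nsq (y - S n y) <= nsq y.
  by rewrite nsq_residual // gerBl sumr_ge0 // => k _; exact: csq_ge0.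
have tail (eps : R) : 0 < eps -> exists N, forall y, K y -> nsq (y - S N y) <= eps.
  move=> e0; have e1 : 0 < Num.sqrt (eps / 4) by rewrite sqrtr_gt0; lra.
  have [N hN] := null_seq_le dc e1; exists N => y /(closure_nsqP hH) Ky.
  have e4 : 0 < eps / 4 by lra.
  have [_ [x /= x1 <-] hx] := Ky _ e4.
  (* The tail of [T x] is again a diagonal operator applied to [x], with entries at most
     [Num.sqrt (eps / 4)]. *)
  pose d' k := if (k < N)%N then 0 else d k.
  have d'0 k : 0 <= d' k by rewrite /d'; case: ifP.
  have d'e k : d' k <= Num.sqrt (eps / 4).
    by rewrite /d'; case: ltnP => [_|/hN //]; exact: ltW.
  have Tx : T x - S N (T x) = diag_op ip e d' x.
    apply: (basis_inj hH he) => k.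
    rewrite ipBl (ip_onsum oe (fun k => ip (T x) (e k))) (ip_diagonal hH he d'0 d'e).
    rewrite /d'; case: ifP => _; first by rewrite subrr mul0r.
    by rewrite subr0 (ip_diagonal hH he d0 dC).
  have h1 : nsq (T x - S N (T x)) <= eps / 4.
    rewrite Tx; have h := nsq_tensor_series hH oe oe (csq_diag_le d'0 d'e) x.
    apply: le_trans h _; rewrite sqr_sqrtr; last by lra.
    by rewrite -[leRHS]mulr1 ler_pM2l // -(norm_le1 hH).
  have h2 : nsq ((y - T x) - S N (y - T x)) <= eps / 4.
    by apply: le_trans (nS _ _) _; exact: ltW.
  have -> : y - S N y = ((y - T x) - S N (y - T x)) + (T x - S N (T x)).
    by rewrite SB opprB addrACA subrK [X in _ = y + X]addrAC subrr sub0r.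
  by apply: le_trans (nsqD_le _ _ _) _; rewrite mulr2n; lra.
exists K; first exact: subset_closure.
split; last exact: closed_closure.
rewrite compact_ultra => F FU FK; have FP : ProperFilter F by exact: ultra_proper.
have FM : F [set y | nsq y <= 2 * C ^+ 2 + 2].
  apply: filterS FK => y /(closure_nsqP hH) Ky /=.
  have [_ [x /= x1 <-] hx] := Ky _ ltr01.
  have h := nsq_tensor_series hH oe oe (csq_diag_le d0 dC) x.
  have h1 : nsq (T x) <= C ^+ 2.
    by apply: le_trans h _; rewrite -[leRHS]mulr1 ler_wpM2l ?sqr_ge0 // -(norm_le1 hH).
  rewrite -[y](subrK (T x)); apply: le_trans (nsqD_le _ _ _) _.
  by rewrite mulr2n; lra.
have ex k := ultra_ip_cvg FU FM (onsq1 oe k).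
have [c hc] := choice ex.
pose Z n := \sum_(k < n) c k *: e k.
have near (eps : R) : 0 < eps -> exists N, forall n, (N <= n)%N ->
    F [set y | nsq (y - Z n) < eps].
  move=> e0; have e4 : 0 < eps / 4 by lra.
  have e8 : 0 < eps / 8 by lra.
  have [N hN] := tail _ e8; exists N => n Nn.
  apply: filterS (filterI FK (finite_near n FP hc e4)) => y [Ky /= hy].
  have -> : y - Z n = (y - S n y) + (S n y - Z n) by rewrite subrKA.
  have h1 : nsq (y - S n y) <= eps / 8.
    apply: le_trans (hN _ Ky); rewrite !nsq_residual // lerD2l lerN2.
    exact: (sum_csq_homo (fun k => ip y (e k)) Nn).
  have h2 : nsq (S n y - Z n) < eps / 4.
    rewrite /S /Z -sumrB; under eq_bigr do rewrite -scalerBl.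
    by rewrite (nsq_onsum oe (fun k => ip y (e k) - c k)).
  by apply: le_lt_trans (nsqD_le _ _ _) _; rewrite mulr2n; lra.
have [p Zp] : exists p : H, Z @ \oo --> p.
  apply: (cauchy_seq_cvg hH) => eps e0; have e4 : 0 < eps / 4 by lra.
  have [N hN] := near _ e4; exists N => m n /hN hm /hN hn.
  have [y [/= h1 h2]] := filter_ex (filterI hm hn).
  have -> : Z m - Z n = (y - Z n) - (y - Z m) by rewrite opprB [RHS]addrC subrKA.
  by apply: le_lt_trans (nsqB_le _ _ _) _; rewrite mulr2n; lra.
have Fp (eps : R) : 0 < eps -> F [set y | nsq (p - y) < eps].
  move=> e0; have e4 : 0 < eps / 4 by lra.
  have [N1 hN1] := near _ e4; have [N2 hN2] := (cvg_seqP hH _ _).1 Zp _ e4.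
  have := hN1 _ (leq_maxl N1 N2); have := hN2 _ (leq_maxr N1 N2) => g1.
  apply: filterS => y /= g2.
  have -> : p - y = (p - Z (maxn N1 N2)) - (y - Z (maxn N1 N2)) by rewrite opprB subrKA.
  by apply: le_lt_trans (nsqB_le _ _ _) _; rewrite mulr2n; lra.
exists p; split; last first.
  by have := (cvg_nsqP hH (F := F) _ id p).2; apply.
apply/(closure_nsqP hH) => eps e0; have e4 : 0 < eps / 4 by lra.
have [y [/= /(closure_nsqP hH) Ky h1]] := filter_ex (filterI FK (Fp _ e4)).
have [z Tz h2] := Ky _ e4; exists z => //.
have -> : p - z = (p - y) + (y - z) by rewrite subrKA.
by apply: le_lt_trans (nsqD_le _ _ _) _; rewrite mulr2n; lra.
Qed.

End CompactDiagonal.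
End EigenBasis.

(** * Operators with trivial kernel *)

Lemma limn_einf_frequently (R : realType) (u : nat -> \bar R) (eps : \bar R) N :
  (limn_einf u < eps)%E -> exists2 n, (N <= n)%N & (u n < eps)%E.
Proof.
rewrite limn_einf_lim => h.
have : (einfs u N < eps)%E.
  apply: le_lt_trans h.
  rewrite (cvg_lim _ (ereal_nondecreasing_cvgn (nondecreasing_einfs u))) //.
  by apply: ereal_sup_ubound; exists N.
by move=> /ereal_inf_lt[_ [n /= Nn <-] hn]; exists n.
Qed.

Section InjectiveCase.
Context {R : realType} {H : completeNormedModType R[i]}.
Variable ip : {dot H for (@Num.conj R[i])}.
Hypothesis hH : hilbert_norm ip.
Local Notation nsq := (sqnorm ip).
Local Notation orthonormal_seq := (orthonormal_sequence ip).
Implicit Types (x y z w : H).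
Variable e : nat -> H.
Hypothesis he : orthonormal_basis ip e.
Let oe : orthonormal_seq e := he.1.
Local Notation D := (diag_op ip e).

Lemma basis_perm (p p' : nat -> nat) : cancel p' p -> cancel p p' ->
  orthonormal_basis ip (e \o p).
Proof.
move=> pp' p'p; apply: (total_basis hH) => [j k|w hw] /=.
  by rewrite oe (inj_eq (can_inj p'p)).
by apply: (basis_total hH he) => k; rewrite -[k]pp'; exact: hw.
Qed.

Lemma trace_eigenbasis (A : H -> H) (f : nat -> H) (s : R^nat) : positive_op ip A ->
  orthonormal_seq f -> (forall j, 0 <= s j) ->
  (forall x, (fun N => \sum_(j < N) s j * csq (ip x (f j))) @ \oo --> qform ip A x) ->
  (Tr ip e A = \sum_(0 <= j <oo) (s j)%:E)%E.
Proof.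
move=> pA of_ s0 hq; rewrite -(trace_frame of_ s0 hq (parseval hH he)).
by [].
Qed.

Section DiagonalSequence.
Variables (d : R^nat) (p p' : nat -> nat).
Hypotheses (d0 : forall k, 0 < d k) (dc : d @ \oo --> (0 : R)).
Hypotheses (pp' : cancel p p') (p'p : cancel p' p) (ndp : noninc (d \o p)).
Hypothesis (dpc : (d \o p) @ \oo --> (0 : R)).

Lemma diag_ge0 k : 0 <= d k. Proof. exact: ltW. Qed.

Lemma diag_le k : d k <= d (p 0%N).
Proof. by have := ndp (leq0n (p' k)); rewrite /= p'p. Qed.

Lemma diag_compact_positive : compact_positive ip (D d).
Proof.
split; first exact: (diagonal_compact hH he diag_ge0 dc).
exact: (diagonal_positive hH he diag_ge0 diag_le).
Qed.

Lemma diag_singular_numbers : singular_numbers ip (D d) = d \o p.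
Proof.
apply: (eigenbasis_singular_numbers hH (f := e \o p)) => //.
- by have [] := diag_compact_positive.
- exact: basis_perm p'p pp'.
- by move=> j /=; rewrite (diagonal_basis hH he diag_ge0 diag_le).
- by move=> j /=.
Qed.

Lemma diag_op_abs : op_abs ip (D d) = D d.
Proof.
apply: (op_abs_positive hH (f := e) (s := d)) => //.
- by have [] := diag_compact_positive.
- by move=> j; rewrite (diagonal_basis hH he diag_ge0 diag_le).
Qed.

Lemma diag_trace : Tr ip e (D d) = (\sum_(0 <= k <oo) (d k)%:E)%E.
Proof.
apply: eq_eseriesr => k _.
by rewrite (ip_diagonal hH he diag_ge0 diag_le) oe eqxx mulr1.
Qed.

Lemma diag_trace_perm : Tr ip e (D d) = (\sum_(0 <= k <oo) (d (p k))%:E)%E.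
Proof.
rewrite diag_trace !nneseries_esumT => [|k|k]; try by rewrite lee_fin diag_ge0.
rewrite (reindex_esum setT setT p) //; split=> //.
  by move=> i j _ _; exact: (can_inj pp').
by move=> k _; exists (p' k).
Qed.

End DiagonalSequence.
Section Main.
Variable A : H -> H.
Hypothesis hA : compact_positive ip A.
Hypothesis RA : range_proj ip A = id.
Let pA : positive_op ip A := hA.2.
Let linA : linear A := pA.1.1.
Local Notation q := (qform ip A).
Local Notation EU := (EU ip e A).
Local Notation EV := (EV ip e A).
Local Notation odiag := (orbit_diag ip e A).

Let kerA x : A x = 0 -> x = 0.
Proof. exact: (proj_idP hH he hA).1. Qed.

Variables (f : nat -> H) (s : R^nat).
Hypothesis spA : spectral ip A f s.
Let of_ : orthonormal_seq f. Proof. by case: spA. Qed.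
Let ni_s : noninc s. Proof. by case: spA => _ []. Qed.
Let s0 n : 0 <= s n. Proof. by case: spA => _ []. Qed.
Let sc : s @ \oo --> (0 : R). Proof. by case: spA. Qed.
Let fs j : A (f j) = ((s j)%:C)%C *: f j. Proof. by case: spA. Qed.

Lemma spectral_pos n : 0 < s n.
Proof.
rewrite lt_def s0 andbT; apply/eqP => sn.
have /kerA fn : A (f n) = 0 by rewrite fs sn scale0r.
by have := onsq1 of_ n; rewrite fn nsq0 => /esym/eqP; rewrite oner_eq0.
Qed.

Lemma spectral_basis : orthonormal_basis ip f.
Proof.
apply: (total_basis hH of_) => w hw; apply: kerA.
by apply: (spectral_kernel pA spA) => j _.
Qed.

Lemma singular_numbers_spectral : singular_numbers ip A = s.
Proof.
apply: (eigenbasis_singular_numbers hH (f := f)) => //; first exact: spectral_basis.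
exact: spectral_pos.
Qed.

Lemma trace_spectral : (Tr ip e A = \sum_(0 <= j <oo) (s j)%:E)%E.
Proof. by apply: (trace_eigenbasis (f := f)) => // x; exact: spectral_qform. Qed.

Lemma qform_pos x : x != 0 -> 0 < q x.
Proof.
move=> xn; rewrite lt_def (qform_ge0 pA) andbT; apply: contra xn => /eqP.
by move=> /(qform_eq0 pA)/kerA ->.
Qed.

(** * Diagonals produced by isometries when A is injective *)

Section Isometry.
Variable V : H -> H.
Hypotheses (bV : bounded_op V) (VV : adjoint ip V \o V = id).
Local Notation V' := (adjoint ip V).

Lemma isometry_ip x y : ip (V x) (V y) = ip x y.
Proof.
by rewrite (adjointP hH he bV) -[V' (V y)]/((V' \o V) y) VV.
Qed.

Lemma nsq_coisometry y : nsq (V' y) <= nsq y.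
Proof.
have [->|zn] := eqVneq (nsq (V' y)) 0; first exact: nsq_ge0.
have zp : 0 < nsq (V' y) by rewrite lt_def zn nsq_ge0.
rewrite -(ler_pM2l zp) -expr2 -csq_real -ipxx -(adjointP hH he bV).
apply: le_trans (nsq_cs _ _ _) _.
by rewrite [nsq (V _)]/sqnorm isometry_ip.
Qed.

Lemma coisometry_ip k j : ip (V' (e k)) (f j) = ip (e k) (V (f j)).
Proof. by rewrite ipC -(adjointP hH he bV) -ipC. Qed.

Lemma basis_coord_cvg0 y : (fun k => csq (ip (e k) y)) @ \oo --> (0 : R).
Proof.
have h := parseval hH he (x := y).
have h1 : (fun n => \sum_(k < n.+1) csq (ip y (e k))) @ \oo --> nsq y.
  by have := h; rewrite -cvg_shiftS.
rewrite -(subrr (nsq y)).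
have -> : (fun k => csq (ip (e k) y)) =
  (fun n => \sum_(k < n.+1) csq (ip y (e k)) - \sum_(k < n) csq (ip y (e k))).
  apply/funext => n; rewrite big_ord_recr [RHS]addrC addKr.
  by rewrite ipC csqJ.
exact: cvgB.
Qed.

(** For each fixed [j] the coefficient <e_k, V f_j> tends to 0 with [k]. Finitely many [j] matter,
    as the remaining eigenvalues contribute at most [s n]. *)
Lemma isometry_diag_cvg0 : odiag V @ \oo --> (0 : R).
Proof.
apply/cvgn_realP => eps e0; have e2 : 0 < eps / 2 by lra.
have [n0 hn0] := null_seq_le sc e2; pose n := n0.
have sn : s n <= eps / 2 by exact: hn0.
have h m : (fun k => \sum_(j < m) (s j - s n) * csq (ip (e k) (V (f j)))) @ \oo --> (0 : R).
  elim: m => [|m IH].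
    by under eq_fun do rewrite big_ord0; exact: cvg_cst.
  under eq_fun do rewrite big_ord_recr /=.
  have := cvgD IH (cvgM (cvg_cst (s m - s n)) (basis_coord_cvg0 (V (f m)))).
  by rewrite mulr0 addr0; apply.
have [N hN] := null_seq_le (h n) (divr_gt0 e0 (ltr0n _ 4)).
exists N => k /hN hk; rewrite sub0r normrN ger0_norm ?orbit_diag_ge0 //.
have h1 : odiag V k <= \sum_(j < n) (s j - s n) * csq (ip (V' (e k)) (f j)) + s n * 1.
  rewrite /orbit_diag (qform_decomp pA spA _ n).
  have [_ _ _ _ qs] := spA.
  apply: le_trans (lerD (lexx _) (qs n _ (fun k kn => ip_residual_eq0 spA _ kn))) _.
  rewrite (nsq_residual of_); under [in leRHS]eq_bigr do rewrite mulrBl.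
  rewrite sumrB -mulr_sumr.
  have : s n * nsq (V' (e k)) <= s n * 1.
    by rewrite ler_wpM2l // -(onsq1 oe k) nsq_coisometry.
  by rewrite mulrBr; lra.
apply: le_lt_trans h1 _; under eq_bigr do rewrite coisometry_ip.
by move: hk; rewrite mulr1; lra.
Qed.

Lemma isometry_maj (p : nat -> nat) : injective p -> maj (odiag V \o p) s.
Proof.
move=> pinj n.
have oep : orthonormal_seq (e \o p).
  by move=> j k /=; rewrite oe (inj_eq pinj).
apply: (@kyfan _ _ ip q f s setT of_ ni_s s0 _ (fun k => V' (e (p k))) n) => //.
- by move=> x _; exact: spectral_qform.
- by move=> k; rewrite -(onsq1 oe (p k)) nsq_coisometry.
move=> j m; rewrite -(onsq1 of_ j) -[leRHS](_ : nsq (V (f j)) = _); last first.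
  by rewrite /sqnorm isometry_ip.
apply: le_trans (bessel oep (V (f j)) m); apply: ler_sum => k _ /=.
by rewrite coisometry_ip ipC csqJ.
Qed.

Lemma isometry_trace :
  (\sum_(0 <= k <oo) (odiag V k)%:E = \sum_(0 <= j <oo) (s j)%:E)%E.
Proof.
apply: (trace_frame (q := q) (v := fun k => V' (e k)) of_ s0) => [x|x].
  exact: spectral_qform.
have -> : nsq x = nsq (V x) by rewrite /sqnorm isometry_ip.
have := parseval hH he (x := V x).
have -> // : (fun n => \sum_(k < n) csq (ip (V x) (e k))) =
  (fun n => \sum_(k < n) csq (ip x (V' (e k)))).
by apply/funext => n; apply: eq_bigr => k _; rewrite (adjointP hH he bV).
Qed.

End Isometry.

Lemma EV_elim B : EV B -> range_proj ip B = id -> exists V,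
  [/\ bounded_op V, adjoint ip V \o V = id, B = D (odiag V) &
      forall k, 0 < odiag V k].
Proof.
move=> [_ [V [[bV _] VV] <-] <-]; rewrite (orbit_expectation hH he hA bV) => RB.
exists V; split=> //; first by rewrite VV (proj_join_self hH he hA) RA.
have [C hC] := orbit_diag_le hH he hA bV.
move=> k; rewrite lt_def orbit_diag_ge0 // andbT.
exact: (diagonal_range_id hH he (orbit_diag_ge0 e hA V) hC).1.
Qed.

Lemma EU_range_id B : EU B -> range_proj ip B = id.
Proof.
move=> /(EU_elim hH he hA)[U uU ->]; have [bU _ _] := uU.
have [C hC] := orbit_diag_le hH he hA bU.
apply/(diagonal_range_id hH he (orbit_diag_ge0 e hA U) hC) => k.
apply/eqP => /(qform_eq0 pA)/kerA uk.
have [ou _] := unitary_frame hH he uU.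
by have := onsq1 ou k; rewrite uk nsq0 => /esym/eqP; rewrite oner_eq0.
Qed.

Lemma diag_in_EU (d : R^nat) (p p' : nat -> nat) : (forall k, 0 < d k) ->
  cancel p p' -> cancel p' p -> noninc (d \o p) -> (d \o p) @ \oo --> (0 : R) ->
  maj (d \o p) s ->
  (forall (eps : R) N, 0 < eps -> exists2 n, (N <= n)%N &
     \sum_(i < n) s i - \sum_(i < n) d (p i) < eps) \/
  (forall C : R, exists n, C < \sum_(i < n) d (p i)) -> EU (D d).
Proof.
move=> d0 pp' p'p ndp dpc md alt.
have [u [ou qu tu]] := schur_horn of_ (fun x => spectral_qform pA spA (x := x)) qform_pos
  ni_s s0 sc ndp (fun n => d0 (p n)) dpc md alt.
(* The vectors were built for the sorted diagonal; [p'] returns each to the index it belongs to. *)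
pose v := u \o p'.
have ov : orthonormal_seq v by move=> j k; rewrite /v /= ou (inj_eq (can_inj p'p)).
have bv : orthonormal_basis ip v.
  by apply: (total_basis hH ov) => w hw; apply: tu => k; rewrite -[k]pp'; exact: hw.
have uU := transport_unitary hH he bv.
rewrite (_ : d = odiag (transport ip v e)); first exact: EU_intro.
apply/funext => k; rewrite /orbit_diag (adjoint_transport hH ov oe).
by rewrite (transport_frame hH oe ov) /v /= qu /= p'p.
Qed.

Lemma diagonal_compact_elim B : diagonal_op ip e B -> compact_positive ip B ->
  range_proj ip B = id -> exists d : R^nat,
  [/\ B = D d, forall k, 0 < d k & d @ \oo --> (0 : R)].
Proof.
move=> [bB dB] [cB pB] RB; pose d k := qform ip B (e k).
have d0 k : 0 <= d k by exact: qform_ge0.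
have Be k : B (e k) = ((d k)%:C)%C *: e k.
  apply: (basis_inj hH he) => j; rewrite ipZl oe.
  have [->|/dB ->] := eqVneq k j; first by rewrite mulr1 (qformE pB).
  by rewrite mulr0.
have [C C0 hC] := qform_bounded hH pB.
have dC k : d k <= C by have := hC (e k); rewrite (onsq1 oe) mulr1.
have BD : B = D d.
  apply/funext => x; apply: (basis_inj hH he) => k.
  by rewrite (ip_diagonal hH he d0 dC) (positive_selfadj pB) Be ipZr conj_real.
exists d; split=> // [k|].
  rewrite lt_def d0 andbT; apply: (diagonal_range_id hH he d0 dC).1.
  by rewrite -BD.
apply/cvgn_realP => eps e0.
have [N hN] := compact_eigenvalues_cvg0 hH cB oe Be (exprn_gt0 2 e0).
exists N => n /hN; rewrite csq_real sub0r normrN ger0_norm // => h.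
by rewrite -(ltr_pXn2r (n := 2)) ?nnegrE // ltW.
Qed.

Lemma majE (xi eta : R^nat) : majorized xi eta <-> maj xi eta.
Proof. by split=> h n; have := h n; rewrite !big_mkord. Qed.

End Main.
End InjectiveCase.

(** * The proposition *)

Section SeriesAlternatives.
Context {R : realType}.
Implicit Types x s : R^nat.

Lemma infinite_series_unbounded x : (forall k, 0 <= x k) ->
  (\sum_(0 <= k <oo) (x k)%:E = +oo)%E ->
  forall C : R, exists n, C < \sum_(i < n) x i.
Proof.
move=> x0 h C; apply: contrapT => /forallNP hn.
have : (\sum_(0 <= k <oo) (x k)%:E <= C%:E)%E.
  apply: nneseries_le => [k|n]; first by rewrite lee_fin.
  by rewrite sumEFin lee_fin leNgt; apply/negP; exact: hn.
by rewrite h.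
Qed.

Lemma finite_series_cvg x : (forall k, 0 <= x k) ->
  (\sum_(0 <= k <oo) (x k)%:E < +oo)%E -> exists l : R,
  (fun n => \sum_(i < n) x i) @ \oo --> l /\ (\sum_(0 <= k <oo) (x k)%:E = l%:E)%E.
Proof.
move=> x0 h.
have hc : cvgn (fun n => \sum_(i < n) x i).
  apply: nondecreasing_is_cvgn.
    apply/nondecreasing_seqP => n; by rewrite big_ord_recr lerDl.
  exists (fine (\sum_(0 <= k <oo) (x k)%:E)%E) => _ [n _ <-].
  rewrite -lee_fin fineK; last first.
    by rewrite ge0_fin_numE // nneseries_ge0 // => k _ _; rewrite lee_fin.
  rewrite -sumEFin -(big_mkord xpredT (fun i => (x i)%:E)).
  by apply: nneseries_lim_ge => k _ _; rewrite lee_fin.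
by exists (limn (fun n => \sum_(i < n) x i)); split=> //; exact: nneseries_EFin.
Qed.

(** With equal finite sums the partial sums of [s - x] converge to 0, so the liminf is a limit. *)
Lemma equal_finite_series_strongly_majorized x s :
  (forall k, 0 <= x k) -> (forall k, 0 <= s k) ->
  (\sum_(0 <= k <oo) (x k)%:E = \sum_(0 <= k <oo) (s k)%:E)%E ->
  (\sum_(0 <= k <oo) (s k)%:E < +oo)%E -> maj x s -> strongly_majorized x s.
Proof.
move=> x0 s0 xs sfin ms; split; first exact/majE.
have [l [sl hl]] := finite_series_cvg s0 sfin.
have [m [xm hm]] : exists m : R, (fun n => \sum_(i < n) x i) @ \oo --> m /\
    (\sum_(0 <= k <oo) (x k)%:E = m%:E)%E by apply: finite_series_cvg; rewrite ?xs.
have lm : l = m by move: xs; rewrite hl hm => -[].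
have -> : (fun n => (\sum_(0 <= j < n) (s j - x j))%:E) =
    (fun n => (\sum_(i < n) s i - \sum_(i < n) x i)%:E).
  by apply/funext => n; rewrite big_mkord sumrB.
have h : (fun n => (\sum_(i < n) s i - \sum_(i < n) x i)%:E) @ \oo --> 0%E.
  apply: cvg_EFin; first exact: nearW.
  by have := cvgB sl xm; rewrite lm subrr; apply.
by have [-> _] := cvg_limn_einf_sup h.
Qed.

Lemma strongly_majorized_frequently x s : strongly_majorized x s ->
  forall (eps : R) N, 0 < eps -> exists2 n, (N <= n)%N &
     \sum_(i < n) s i - \sum_(i < n) x i < eps.
Proof.
move=> [_ h] eps N e0.
have [|n Nn] := @limn_einf_frequently _
  (fun n => (\sum_(0 <= j < n) (s j - x j))%:E) eps%:E N.
  by rewrite h lte_fin.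
by rewrite lte_fin big_mkord sumrB => hn; exists n.
Qed.

End SeriesAlternatives.
Theorem proposition6p6 (R : realType) (H : completeNormedModType R[i])
    (ip : {dot H for (@Num.conj R[i])}) (hH : hilbert_norm ip)
    (e : nat -> H) (he : orthonormal_basis ip e)
    (A : H -> H) (hA : compact_positive ip A) :
  let EU := diag_expectation ip e @` unitary_orbit ip A in
  let EV := diag_expectation ip e @` partial_isometry_orbit ip A in
  let EV_le := EV `&` [set B | diagonal_op ip e B /\
      (Tr ip e (range_proj_perp ip B) <= Tr ip e (range_proj_perp ip A))%E] in
  [/\ EU `<=` EV_le,
      range_proj ip A = id ->
        [/\ EU = EV `&` [set B | diagonal_op ip e B /\ range_proj ip B = id],
            Tr ip e A = +oo%E ->
              EU = [set B | [/\ diagonal_op ip e B, compact_positive ip B,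
                       majorized (singular_numbers ip B)
                                 (singular_numbers ip A) &
                       range_proj ip B = id]] `\`
                   [set B | trace_class ip e B] &
            (Tr ip e A < +oo)%E ->
              EU = [set B | [/\ diagonal_op ip e B, compact_positive ip B,
                       strongly_majorized (singular_numbers ip B)
                                          (singular_numbers ip A) &
                       range_proj ip B = id]]] &
      ~ (range_proj ip A = id \/ finite_rank A) -> EU `<` EV_le].
Proof.
move=> EU0 EV0 EV_le0.
split; [exact: EU_sub_EV_le| |exact: EU_proper].
move=> RA; have oe : orthonormal_sequence ip e := he.1.
have [f [s spA]] := spectral_theorem hH oe hA.
have pA : positive_op ip A := hA.2.
have s0 n : 0 <= s n by case: spA => _ [_ + _ _ _].
have sA := singular_numbers_spectral hH he hA RA spA.
have tA := trace_spectral hH he hA spA.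
have fwd B : EV ip e A B -> range_proj ip B = id -> exists d p p',
    [/\ B = diag_op ip e d, (forall k, 0 < d k) /\ d @ \oo --> (0 : R),
        cancel p p' /\ cancel p' p,
        noninc (d \o p) /\ (d \o p) @ \oo --> (0 : R) &
        maj (d \o p) s /\ Tr ip e B = Tr ip e A].
  move=> EB RB; have [V [bV VV -> dp]] := EV_elim hH he hA RA EB RB.
  have dc := isometry_diag_cvg0 hH he hA spA bV VV.
  have [p [p' [pp' p'p ndp dpc]]] := decreasing_rearrangement dp dc.
  exists (orbit_diag ip e A V), p, p'; split=> //; split.
    exact: (isometry_maj hH he hA spA bV VV (can_inj pp')).
  rewrite tA -(isometry_trace hH he hA spA bV VV).
  exact: (diag_trace hH he dp p'p ndp).
have EUdiag B : EU0 B -> diagonal_op ip e B.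
  by move=> /(EU_sub_EV_le hH he hA)[_ []].
have EUV B : EU0 B -> EV ip e A B /\ range_proj ip B = id.
  by move=> EB; split; [exact: (EU_sub_EV hH he hA)|exact: (EU_range_id hH he hA RA)].
have trp (d : R^nat) p p' : (forall k, 0 < d k) -> d @ \oo --> (0 : R) ->
    cancel p p' -> cancel p' p -> noninc (d \o p) ->
    Tr ip e (diag_op ip e d) = (\sum_(0 <= k <oo) ((d \o p) k)%:E)%E.
  by move=> d0 dc pp' p'p ndp; exact: (diag_trace_perm hH he d0 pp' p'p ndp).
have conv B d p p' : B = diag_op ip e d -> (forall k, 0 < d k) -> d @ \oo --> (0 : R) ->
    cancel p p' -> cancel p' p -> noninc (d \o p) -> (d \o p) @ \oo --> (0 : R) ->
    maj (d \o p) s -> Tr ip e B = +oo%E \/ strongly_majorized (d \o p) s -> EU0 B.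
  move=> -> d0 dc pp' p'p ndp dpc md alt.
  apply: (diag_in_EU hH he hA RA spA d0 pp' p'p ndp dpc md).
  case: alt => [tB|sm]; [right|left; exact: strongly_majorized_frequently sm].
  by apply: (infinite_series_unbounded (x := d \o p)) => [k|]; [exact/ltW/d0|rewrite -(trp d p p')].
have strong (d : R^nat) p p' : (forall k, 0 < d k) -> d @ \oo --> (0 : R) ->
    cancel p p' -> cancel p' p -> noninc (d \o p) ->
    maj (d \o p) s -> Tr ip e (diag_op ip e d) = Tr ip e A -> (Tr ip e A < +oo)%E ->
    strongly_majorized (d \o p) s.
  move=> d0 dc pp' p'p ndp md tr tfin.
  apply: equal_finite_series_strongly_majorized => // [k||]; first exact/ltW/d0.
    by rewrite -tA -tr (trp _ p p').
  by rewrite -tA.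
split.
- apply/seteqP; split=> [B EB|B [EB [_ RB]]].
    by have [h1 h2] := EUV B EB; split=> //; split=> //; exact: EUdiag.
  have [d [p [p' [-> [d0 dc] [pp' p'p] [ndp dpc] [md tr]]]]] := fwd B EB RB.
  apply: (conv _ d p p') => //.
  (* A finite common trace gives strong majorization, an infinite one gives the divergent
     alternative of the Schur-Horn construction. *)
  have [tfin|] := boolP (Tr ip e A < +oo)%E; first by right; apply: (strong d p p').
  by rewrite -leNgt leye_eq => /eqP tinf; left; rewrite tr.
- move=> tinf; apply/seteqP; split=> [B EB|B [[dB cB mB RB] nB]].
    have [h1 h2] := EUV B EB.
    have [d [p [p' [BE [d0 dc] [pp' p'p] [ndp dpc] [md tr]]]]] := fwd B h1 h2.
    have sB := diag_singular_numbers hH he d0 dc pp' p'p ndp dpc.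
    have cB := diag_compact_positive hH he d0 dc p'p ndp.
    split; last first.
      rewrite /= BE => -[_]; rewrite (diag_op_abs hH he d0 dc p'p ndp) -BE tr tinf.
      by rewrite ltxx.
    split=> //; [exact: EUdiag|by rewrite BE|].
    by rewrite BE sB sA; apply/majE.
  have [d [BE d0 dc]] := diagonal_compact_elim hH he dB cB RB.
  have [p [p' [pp' p'p ndp dpc]]] := decreasing_rearrangement d0 dc.
  have sB := diag_singular_numbers hH he d0 dc pp' p'p ndp dpc.
  apply: (conv _ d p p') => //; first by move: mB; rewrite BE sB sA => /majE.
  left; apply/eqP; rewrite -leye_eq leNgt; apply/negP => tfin; apply: nB.
  split; first by case: cB => _ [].
  by rewrite BE (diag_op_abs hH he d0 dc p'p ndp) -BE.
- move=> tfin; apply/seteqP; split=> [B EB|B [dB cB mB RB]].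
    have [h1 h2] := EUV B EB.
    have [d [p [p' [BE [d0 dc] [pp' p'p] [ndp dpc] [md tr]]]]] := fwd B h1 h2.
    have sB := diag_singular_numbers hH he d0 dc pp' p'p ndp dpc.
    have cB := diag_compact_positive hH he d0 dc p'p ndp.
    split=> //; [exact: EUdiag|by rewrite BE|].
    by rewrite BE sB sA; apply: (strong d p p') => //; rewrite -BE.
  have [d [BE d0 dc]] := diagonal_compact_elim hH he dB cB RB.
  have [p [p' [pp' p'p ndp dpc]]] := decreasing_rearrangement d0 dc.
  have sB := diag_singular_numbers hH he d0 dc pp' p'p ndp dpc.
  move: mB; rewrite BE sB sA => mB.
  by apply: (conv _ d p p') => //; [apply/majE; case: mB|right].
Qed.
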